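(* Let $d\le n$, let $A$ be a based quasi-hereditary graded $\Bbbk$-superalgebra with $\mathfrak a$-conforming heredity data $I,X,Y$, and let $\Bbbk\to\mathbb F$ be a ring homomorphism to a field. Suppose that $(A,\mathfrak a)$ is a unital pair and $(A_{\mathbb F})_{\bar1}\subset J(A_{\mathbb F})$, where $J$ denotes the Jacobson radical. Moreover, suppose that $e\in\mathfrak a$ is an adapted idempotent such that $\bar A_{\mathbb F}$, where $\bar A=eAe$, is indecomposable, and that $|\bar I|>1$. Then $T^{\bar A}_{\bar{\mathfrak a}}(n,d)_{\mathbb F}$ is indecomposable, where $\bar{\mathfrak a}=e\mathfrak ae$.
   Context: $\Bbbk$ is a commutative integral domain of characteristic $0$, $n\in\mathbb Z_{>0}$, $d\in\mathbb Z_{\ge0}$. An algebra is indecomposable if it is not the direct sum of two nonzero two-sided ideals (ideals of graded superalgebras being homogeneous). The subscript $\mathbb F$ denotes $-\otimes_\Bbbk\mathbb F$. Based quasi-hereditary algebras. A graded $\Bbbk$-supermodule is $V=\bigoplus_{m\in\mathbb Z,\varepsilon\in\mathbb Z/2}V^m_\varepsilon$, with $V_\varepsilon=\bigoplus_mV^m_\varepsilon$; elements of the $V^m_\varepsilon$ are homogeneous; for a set $S$ of homogeneous elements, $S_\varepsilon=S\cap V_\varepsilon$. A graded $\Bbbk$-superalgebra is a (not necessarily unital) associative algebra $A$ with $A^m_\varepsilon A^l_\delta\subseteq A^{m+l}_{\varepsilon+\delta}$. Heredity data on $A$ consist of a finite poset $I$ and finite sets $X=\bigsqcup_{i\in I}X(i)$,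 $Y=\bigsqcup_{i\in I}Y(i)$ of homogeneous elements with distinguished initial elements $e_i\in X(i)\cap Y(i)$ such that, with $A^{>i}=\mathrm{span}(xy\mid j>i,\ x\in X(j),\ y\in Y(j))$: (a) $B=\{xy\mid i\in I,x\in X(i),y\in Y(i)\}$ is a basis of $A$; (b) for $x\in X(i)$, $y\in Y(i)$, $a\in A$, $ax$ is congruent mod $A^{>i}$ to a linear combination of elements of $X(i)$, and $ya$ to one of elements of $Y(i)$; (c) for $i,j\in I$, $x\in X(i)$, $y\in Y(i)$: $xe_i=x$, $e_ix=\delta_{x,e_i}x$, $e_iy=y$, $ye_i=\delta_{y,e_i}y$, $e_jx\in\{x,0\}$, $ye_j\in\{y,0\}$. Then $A$ is called based quasi-hereditary. For a subalgebra $\mathfrak a\subseteq A_{\bar0}$ the data is $\mathfrak a$-conforming if $I,X_{\bar0},Y_{\bar0}$ is heredity data for $\mathfrak a$; if moreover $A$ is unital and $1_A\in\mathfrak a$, then $(A,\mathfrak a)$ is a unital pair. For $\tilde A=A_{\mathbb F}/A_{\mathbb F}^{>i}$, $\Delta(i)=\tilde A\tilde e_i$ has basis $v_x=\tilde x$ $(x\in X(i))$; one has $yx\equiv f_i(y,x)e_i\pmod{A^{>i}}$ for scalars $f_i(y,x)$, and $L(i)=\Delta(i)/\{v=\sum_xc_xv_x\mid\sum_xc_xf_i(y,x)=0\ \forall y\in Y(i)\}$ is irreducible; these are all irreducible graded $A_{\mathbb F}$-supermodules up to isomorphism and shifts. Adapted idempotents. A homogeneous idempotent $e\in A$ is adapted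 if for all $i\in I$ there are subsets $\bar X(i)\subseteq X(i)$, $\bar Y(i)\subseteq Y(i)$ such that for $x\in X(i)$, $y\in Y(i)$: $ex=x$ if $x\in\bar X(i)$ and $ex=0$ otherwise; $ye=y$ if $y\in\bar Y(i)$ and $ye=0$ otherwise ($e=1$ is allowed). In this statement $\bar I=\{i\in I\mid eL(i)\ne0\}$, so that $\{eL(i)\mid i\in\bar I\}$ is a complete set of simple $\bar A_{\mathbb F}$-modules (up to isomorphism and shifts). The algebra $\bar A=eAe$ has basis $\bar B=\{xy\mid i\in I,x\in\bar X(i),y\in\bar Y(i)\}$. The algebra $T^{\bar A}_{\bar{\mathfrak a}}(n,d)$. Let $\bar B_{\mathfrak c}=\{xy\in\bar B\mid i\in I,\ x\in\bar X(i)_{\bar1},\ y\in\bar Y(i)_{\bar1}\}$. $\mathrm{Tri}^{\bar B}(n,d)$ is the set of $(\boldsymbol b,\boldsymbol r,\boldsymbol s)\in\bar B^d\times[1,n]^d\times[1,n]^d$ such that for $k\ne l$, $(b_k,r_k,s_k)=(b_l,r_l,s_l)$ only if $b_k$ is even. $\mathfrak S_d$ acts on words by $(z_1\cdots z_d)\sigma=z_{\sigma1}\cdots z_{\sigma d}$, diagonally on triples. Put $\xi^a_{r,s}=aE_{r,s}\in M_n(\bar A)$. $\mathfrak S_d$ acts on the superalgebra $M_n(\bar A)^{\otimes d}$ by $(\xi^{a_1}_{r_1,s_1}\otimes\cdots\otimes\xi^{a_d}_{r_d,s_d})^\sigma=(-1)^{\langle\sigma;\boldsymbol a\rangle}\xi^{a_{\sigma1}}_{r_{\sigma1},s_{\sigma1}}\otimes\cdots\otimes\xi^{a_{\sigma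 d}}_{r_{\sigma d},s_{\sigma d}}$, $\langle\sigma;\boldsymbol a\rangle=\#\{k<l\mid\sigma^{-1}k>\sigma^{-1}l,\ a_k,a_l\text{ odd}\}$; $S^{\bar A}(n,d)$ is the algebra of invariants. For $(\boldsymbol b,\boldsymbol r,\boldsymbol s)\in\mathrm{Tri}^{\bar B}(n,d)$, $\xi^{\boldsymbol b}_{\boldsymbol r,\boldsymbol s}=\sum_\sigma(\xi^{b_1}_{r_1,s_1}\otimes\cdots\otimes\xi^{b_d}_{r_d,s_d})^\sigma$ over shortest representatives of $\mathrm{Stab}(\boldsymbol b,\boldsymbol r,\boldsymbol s)\backslash\mathfrak S_d$, and $\eta^{\boldsymbol b}_{\boldsymbol r,\boldsymbol s}=\big(\prod_{b\in\bar B_{\mathfrak c},\,r,s\in[1,n]}\#\{k\mid(b_k,r_k,s_k)=(b,r,s)\}!\big)\,\xi^{\boldsymbol b}_{\boldsymbol r,\boldsymbol s}$. Then $T^{\bar A}_{\bar{\mathfrak a}}(n,d)=\mathrm{span}_\Bbbk(\eta^{\boldsymbol b}_{\boldsymbol r,\boldsymbol s})$, a subalgebra of $S^{\bar A}(n,d)$. *)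

(* Defs.v *)
From HB Require Import structures.
From mathcomp Require Import all_boot all_order all_algebra all_fingroup.
From mathcomp Require Import finmap boolp classical_sets.

Set Implicit Arguments.
Unset Strict Implicit.
Unset Printing Implicit Defensive.

Import Order.TTheory GRing.Theory.

Local Open Scope classical_set_scope.
Local Open Scope ring_scope.

Section Span.
Variables (R : nzRingType) (V : lmodType R).

Definition span (P : set V) : set V :=
  [set v | exists s : seq (R * V),
     (forall p, p \in s -> P p.2) /\ v = \sum_(p <- s) p.1 *: p.2].

Definition submodule (P : set V) : Prop :=
  P 0 /\ forall (c : R) (x y : V), P x -> P y -> P (c *: x + y).

End Span.

(* A (Z x Z/2)-grading is a family of submodules [gr m eps]; the parity is
   a boolean, [true] being odd. *)
Section Graded.
Variables (R : nzRingType) (V : lmodType R) (gr : int -> bool -> set V).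

Definition homogeneous (x : V) : Prop := exists m eps, gr m eps x.

Definition grading : Prop :=
  [/\ forall m eps, submodule (gr m eps),
      forall v, exists s : seq V,
        (forall x, x \in s -> homogeneous x) /\ v = \sum_(x <- s) x &
      forall (s : seq (int * bool)) (u : int * bool -> V),
        uniq s -> (forall p, p \in s -> gr p.1 p.2 (u p)) ->
        \sum_(p <- s) u p = 0 -> forall p, p \in s -> u p = 0].

Definition parity_part (eps : bool) : set V :=
  [set v | exists s : seq V,
     (forall x, x \in s -> exists m, gr m eps x) /\ v = \sum_(x <- s) x].

Definition is_odd (v : V) : bool := `[< parity_part true v >].
Definition is_even (v : V) : bool := `[< parity_part false v >].

End Graded.

Section Algebras.
Variables (R : comNzRingType) (A : algType R).

Definition graded_superalgebra (gr : int -> bool -> set A) : Prop :=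
  grading gr /\
  forall m l eps delta (a b : A),
    gr m eps a -> gr l delta b -> gr (m + l) (eps (+) delta) (a * b).

Definition subalgebra (S : set A) : Prop :=
  submodule S /\ forall a b : A, S a -> S b -> S (a * b).

Definition two_sided_ideal (J : set A) : Prop :=
  submodule J /\ forall a x : A, J x -> J (a * x) /\ J (x * a).

Definition homogeneous_ideal (gr : int -> bool -> set A) (J : set A) : Prop :=
  two_sided_ideal J /\
  forall x, J x -> exists s : seq A,
    (forall z, z \in s -> homogeneous gr z /\ J z) /\ x = \sum_(z <- s) z.

Definition indecomposable (gr : int -> bool -> set A) : Prop :=
  ~ exists J1 J2 : set A,
      [/\ homogeneous_ideal gr J1 /\ homogeneous_ideal gr J2,
          (exists2 x, J1 x & x != 0) /\ (exists2 x, J2 x & x != 0),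
          forall x, J1 x -> J2 x -> x = 0 &
          forall a, exists x y, [/\ J1 x, J2 y & a = x + y]].

Definition left_ideal (J : set A) : Prop :=
  submodule J /\ forall a x : A, J x -> J (a * x).

Definition maximal_left_ideal (J : set A) : Prop :=
  [/\ left_ideal J, ~ J 1 &
      forall K : set A, left_ideal K -> J `<=` K -> ~ K 1 -> K `<=` J].

Definition jacobson : set A :=
  [set a | forall J : set A, maximal_left_ideal J -> J a].

Definition corner (e : A) : set A := [set e * a * e | a in setT].

End Algebras.

(* [iota : U -> W] exhibits W as the extension of scalars along [phi] of the
   submodule S of U; the values of [iota] outside S are irrelevant. *)
Section BaseChange.
Variables (k : comNzRingType) (F : fieldType) (phi : {rmorphism k -> F}).

Definition semilinear_on (U : lmodType k) (S : set U) (V : lmodType F)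
    (g : U -> V) : Prop :=
  forall (c : k) (x y : U), S x -> S y -> g (c *: x + y) = phi c *: g x + g y.

Definition is_base_change (U : lmodType k) (S : set U) (W : lmodType F)
    (iota : U -> W) : Prop :=
  semilinear_on S iota /\
  forall (V : lmodType F) (g : U -> V), semilinear_on S g ->
    (exists h : {linear W -> V}, forall x, S x -> h (iota x) = g x) /\
    (forall h h' : {linear W -> V},
       (forall x, S x -> h (iota x) = h' (iota x)) -> h =1 h').

Definition is_algebra_base_change (A : algType k) (S : set A)
    (AF : algType F) (iota : A -> AF) : Prop :=
  is_base_change S iota /\
  forall x y, S x -> S y -> iota (x * y) = iota x * iota y.

Definition gr_ext (A : algType k) (gr : int -> bool -> set A) (S : set A)
    (AF : algType F) (iota : A -> AF) (m : int) (eps : bool) : set AF :=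
  span [set iota x | x in S `&` gr m eps].

End BaseChange.

Section Heredity.
Variables (k : comNzRingType) (A : algType k) (gr : int -> bool -> set A).
Variables (disp : Order.disp_t) (I : finPOrderType disp).

(* A^{>i} *)
Definition span_gt (X Y : I -> {fset A}) (i : I) : set A :=
  span [set b | exists (j : I) (x y : A),
          [/\ (i < j)%O, x \in X j, y \in Y j & b = x * y]].

Definition lincomb (X Y : I -> {fset A}) (c : I -> A -> A -> k) : A :=
  \sum_(i : I) \sum_(x <- X i) \sum_(y <- Y i) c i x y *: (x * y).

(* Heredity data on a subalgebra S of A.  As usual for bases, the products xy
   form a basis as a family indexed by the triples (i, x, y). *)
Record heredity_data (S : set A) (X Y : I -> {fset A}) (ei : I -> A) : Prop :=
  HeredityData {
    her_X : forall i x, x \in X i -> S x /\ homogeneous gr x;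
    her_Y : forall i y, y \in Y i -> S y /\ homogeneous gr y;
    her_X_disj : forall i j, i != j -> [disjoint X i & X j]%fset;
    her_Y_disj : forall i j, i != j -> [disjoint Y i & Y j]%fset;
    her_init : forall i, ei i \in X i /\ ei i \in Y i;
    her_basis_gen : forall a, S a -> exists c, a = lincomb X Y c;
    her_basis_free : forall c, lincomb X Y c = 0 ->
      forall i x y, x \in X i -> y \in Y i -> c i x y = 0;
    her_left : forall i x a, x \in X i -> S a ->
      exists2 v, span [set z | z \in X i] v & span_gt X Y i (a * x - v);
    her_right : forall i y a, y \in Y i -> S a ->
      exists2 v, span [set z | z \in Y i] v & span_gt X Y i (y * a - v);
    her_idemX : forall i j x, x \in X i ->
      [/\ x * ei i = x, ei i * x = (if x == ei i then x else 0) &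
          ei j * x = x \/ ei j * x = 0];
    her_idemY : forall i j y, y \in Y i ->
      [/\ ei i * y = y, y * ei i = (if y == ei i then y else 0) &
          y * ei j = y \/ y * ei j = 0]
  }.

Definition even_fset (X : I -> {fset A}) (i : I) : {fset A} :=
  [fset x in X i | is_even gr x]%fset.

Definition odd_fset (X : I -> {fset A}) (i : I) : {fset A} :=
  [fset x in X i | is_odd gr x]%fset.

Definition conforming (aa : set A) (X Y : I -> {fset A}) (ei : I -> A) : Prop :=
  [/\ subalgebra aa, aa `<=` parity_part gr false &
      heredity_data aa (even_fset X) (even_fset Y) ei].

(* [Xb] and [Yb] are the subsets witnessing that e is adapted. *)
Definition adapted (X Y : I -> {fset A}) (e : A)
    (Xb Yb : I -> {fset A}) : Prop :=
  [/\ homogeneous gr e, e * e = e,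
      forall i, (Xb i `<=` X i)%fset /\ (Yb i `<=` Y i)%fset,
      forall i x, x \in X i -> e * x = (if x \in Xb i then x else 0) &
      forall i y, y \in Y i -> y * e = (if y \in Yb i then y else 0)].

End Heredity.

(* The modules Delta(i) and L(i) over A_F are subquotients of A_F: writing
   N for A_F e_i + A_F^{>i} ([Delta_lift]) and R for the preimage in N of the
   radical of Delta(i) ([rad_lift]), Delta(i) = N / A_F^{>i} and
   L(i) = N / R. *)
Section Simples.
Variables (k : comNzRingType) (F : fieldType) (phi : {rmorphism k -> F}).
Variables (A : algType k) (AF : algType F) (iota : A -> AF).
Variables (disp : Order.disp_t) (I : finPOrderType disp).
Variables (X Y : I -> {fset A}) (ei : I -> A).

Definition span_gt_ext (i : I) : set AF :=
  span [set iota a | a in span_gt X Y i].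

Definition Delta_lift (i : I) : set AF :=
  [set v | exists a : AF, span_gt_ext i (v - a * iota (ei i))].

(* [f x] below is f_i(y, x), which is unique. *)
Definition rad_lift (i : I) : set AF :=
  [set v | exists c : A -> F,
     span_gt_ext i (v - \sum_(x <- X i) c x *: iota x) /\
     forall y, y \in Y i -> exists f : A -> k,
       (forall x, x \in X i -> span_gt X Y i (y * x - f x *: ei i)) /\
       \sum_(x <- X i) c x * phi (f x) = 0].

Definition eL_neq0 (e : A) (i : I) : Prop :=
  exists v : AF, Delta_lift i v /\ ~ rad_lift i (iota e * v).

Definition Ibar (e : A) : {set I} := [set i | `[< eL_neq0 e i >]]%SET.

End Simples.

Section MatrixTensorPower.
Variables (k : comNzRingType) (A : algType k) (gr : int -> bool -> set A).
Variables (e : A) (n d : nat).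

(* M_n(eAe) inside M_n(A), graded entrywise. *)
Definition matC : set 'M[A]_n := [set u | forall r s, corner e (u r s)].

Definition matC_gr (m : int) (eps : bool) : set 'M[A]_n :=
  [set u | matC u /\ forall r s, gr m eps (u r s)].

Definition tupC : set {ffun 'I_d -> 'M[A]_n} :=
  [set u | forall j, matC (u j)].

Definition upd (u : {ffun 'I_d -> 'M[A]_n}) (l : 'I_d) (x : 'M[A]_n) :
    {ffun 'I_d -> 'M[A]_n} :=
  [ffun j => if j == l then x else u j].

(* k acts on 'M[A]_n through its central image in A. *)
Definition multilinear (V : lmodType k)
    (g : {ffun 'I_d -> 'M[A]_n} -> V) : Prop :=
  forall (u : {ffun 'I_d -> 'M[A]_n}) (l : 'I_d) (c : k) (x y : 'M[A]_n),
    tupC u -> matC x -> matC y ->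
    g (upd u l (c%:A *: x + y)) = c *: g (upd u l x) + g (upd u l y).

(* TP, with [tau u] standing for u_1 (x) ... (x) u_d, is the tensor power
   M_n(eAe)^{(x) d} over k, multiplied with the Koszul sign rule. *)
Definition is_tensor_power (TP : algType k)
    (tau : {ffun 'I_d -> 'M[A]_n} -> TP) : Prop :=
  [/\ multilinear tau,
      forall (V : lmodType k) (g : {ffun 'I_d -> 'M[A]_n} -> V),
        multilinear g ->
        (exists h : {linear TP -> V},
           forall u, tupC u -> h (tau u) = g u) /\
        (forall h h' : {linear TP -> V},
           (forall u, tupC u -> h (tau u) = h' (tau u)) ->
           h =1 h') &
      forall (u v : {ffun 'I_d -> 'M[A]_n}) (p q : 'I_d -> bool),
        (forall j, exists m, matC_gr m (p j) (u j)) ->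
        (forall j, exists m, matC_gr m (q j) (v j)) ->
        tau u * tau v =
          (-1) ^+ #|[set lj : 'I_d * 'I_d |
                     [&& (lj.1 < lj.2)%N, p lj.2 & q lj.1]]%SET|
          *: tau [ffun j => u j *m v j]].

Definition tensor_gr (TP : algType k) (tau : {ffun 'I_d -> 'M[A]_n} -> TP)
    (m : int) (eps : bool) : set TP :=
  span [set z | exists (u : {ffun 'I_d -> 'M[A]_n}) (mm : 'I_d -> int)
                       (p : 'I_d -> bool),
    [/\ forall j, matC_gr (mm j) (p j) (u j),
        m = \sum_(j < d) mm j,
        eps = \big[addb/false]_(j < d) p j &
        z = tau u]].

End MatrixTensorPower.

Section GeneralizedSchur.
Variables (k : comNzRingType) (A : algType k) (gr : int -> bool -> set A).
Variables (disp : Order.disp_t) (I : finPOrderType disp).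
Variables (Xb Yb : I -> {fset A}) (n d : nat).

Definition products (X Y : I -> {fset A}) : {fset A} :=
  \big[fsetU/fset0]_(i : I) [fset x * y | x in X i, y in Y i]%fset.

Definition Bbar : {fset A} := products Xb Yb.
Definition Bbar_c : {fset A} := products (odd_fset gr Xb) (odd_fset gr Yb).

(* The word (b_1, r_1, s_1) ... (b_d, r_d, s_d). *)
Definition triples := {ffun 'I_d -> A * 'I_n * 'I_n}.

Definition Tri (t : triples) : Prop :=
  (forall j, (t j).1.1 \in Bbar) /\
  forall j l, j != l -> t j = t l -> is_even gr (t j).1.1.

Definition stab (t : triples) : {set 'S_d} :=
  [set s : 'S_d | [forall j, t (s j) == t j]]%SET.

Definition perm_length (s : 'S_d) : nat :=
  #|[set jl : 'I_d * 'I_d | (jl.1 < jl.2)%N && (s jl.2 < s jl.1)%N]%SET|.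

(* Permutations act on words by (z sigma)_j = z_(sigma j), so the product
   rho sigma in the coset Stab sigma is j |-> rho (sigma j), which is
   [sigma * rho] for the product of [perm]. *)
Definition shortest_rep (t : triples) (s : 'S_d) : bool :=
  [forall r in stab t, (perm_length s <= perm_length (s * r)%g)%N].

Definition odd_inversions (s : 'S_d) (t : triples) : nat :=
  #|[set jl : 'I_d * 'I_d |
     [&& (jl.1 < jl.2)%N, ((s^-1)%g jl.2 < (s^-1)%g jl.1)%N,
         is_odd gr (t jl.1).1.1 & is_odd gr (t jl.2).1.1]]%SET|.

Variables (TP : algType k) (tau : {ffun 'I_d -> 'M[A]_n} -> TP).

Definition pure_act (t : triples) (s : 'S_d) : TP :=
  (-1) ^+ odd_inversions s t
  *: tau [ffun j => (t (s j)).1.1 *: delta_mx (t (s j)).1.2 (t (s j)).2].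

Definition xi_elt (t : triples) : TP :=
  \sum_(s : 'S_d | shortest_rep t s) pure_act t s.

Definition eta_factor (t : triples) : nat :=
  (\prod_(b <- Bbar_c) \prod_(r < n) \prod_(s < n)
     (#|[set j : 'I_d | t j == (b, r, s)]%SET|)`!)%N.

Definition eta_elt (t : triples) : TP := (eta_factor t)%:R *: xi_elt t.

Definition T_alg : set TP := span [set z | exists2 t, Tri t & z = eta_elt t].

End GeneralizedSchur.

(* Main.v *)
Require Import Defs.
From HB Require Import structures.
From mathcomp Require Import all_boot all_order all_algebra all_fingroup.
From mathcomp Require Import finmap boolp classical_sets.
From mathcomp Require Import zify ring.

Set Implicit Arguments.
Unset Strict Implicit.
Unset Printing Implicit Defensive.

Import Order.TTheory GRing.Theory.

Local Open Scope classical_set_scope.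
Local Open Scope ring_scope.

Local Notation span := Defs.span.

(** Write [C] for the corner algebra extended to [F], and [T] for the algebra
    spanned by the elements eta, extended to [F]. A decomposition into two
    ideals splits the unit into central orthogonal idempotents, so it suffices
    that a central idempotent [z] of [T] is [0] or [1].

    The algebra [C]. The bilinear forms on the cells have Gram matrices, and a
    rank factorisation of the [i]-th one is a matrix representation on
    [e L(i)]. Let [rho] be the direct sum of these representations. Its image
    contains all the matrix units of every block ([rho_unit]), its kernel is
    nilpotent ([rho_kernel_nilpotent]), odd elements act by zero because they
    lie in the Jacobson radical ([rho_odd_bC]), and there are at least two
    blocks ([two_colours]). Indecomposability of [C] means that a central
    element which is idempotent modulo the kernel acts by [0] or by [1]
    ([central_idempotent_rho]): its even component of degree zero has the same
    action and lifts to an idempotent generating a homogeneous ideal.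

    The algebra [T]. In terms of coefficients at words, the integral form of [T]
    consists of the functions that are invariant under signed place
    permutations and divisible by certain factorials ([T_algP]); divisibility
    survives products by counting orbits ([star_lattice]). Hence the integral
    form has a finite basis, and the coefficients extend to a multiplicative
    map on [T]. In positive characteristic this map may have a kernel, since the
    factorials may vanish, but the kernel contains no nonzero idempotent: its
    elements come from multiples of the characteristic, so a long product of
    them comes from a multiple of the characteristic in the integral form
    ([extended_coefficients]).

    The idempotent [z]. Let [T] act on a tensor product in which one slot is the
    regular module of [C] and the others are semisimple modules. Odd elements
    act by zero in all slots but one, so the Koszul signs disappear
    ([en_bstar]). As [d <= n], one may take tensors in the matrix positions
    [(R j, j)] with [j] running through [d] distinct columns, and [z] commutes
    with their orbit sums. This determines [z] by its entries at the positions
    [(s j, j)], one for each permutation [s], and these entries intertwine the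
    action of [C] in the slots with its permutation by [s] ([central_slot]). If
    [s] moves a slot, the entry there is annihilated by the radical of [C] on
    both sides; such an element is itself in the radical, as otherwise its block
    would be a direct factor of [C] although there are other blocks
    ([socle_in_radical]). If [s = 1], the entries are central in [C] and
    idempotent modulo the radical, so they act by [0] or [1], and comparing
    slots shows that the same scalar occurs everywhere
    ([central_idempotent_scalar]). So [z] acts by [0] or by [1] on all tensor
    products of the modules [e L(i)]. Since an idempotent that acts by zero on
    all of them vanishes ([sm_detects]), [z] or [1 - z] is zero. *)

(** * Signs of place permutations *)

Section Signs.
Variable d : nat.
Implicit Types (s : 'S_d) (p q : 'I_d -> bool).

Local Notation "\xor_ ( a < b ) F" :=
  (\big[addb/false]_(ab : 'I_d * 'I_d | (ab.1 < ab.2)%N)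
     (fun a b : 'I_d => F) ab.1 ab.2)
  (at level 41, a name, b name, F at level 41).

(** Reindexing by [s] permutes the unordered pairs of places; only the order
    within a pair may change. *)
Lemma xor_pairs_perm (f : 'I_d -> 'I_d -> bool) s :
  (forall a b, f a b = f b a) ->
  \xor_(a < b) f (s a) (s b) = \xor_(a < b) f a b.
Proof.
move=> f_sym.
pose h (ab : 'I_d * 'I_d) := ((s^-1)%g ab.1, (s^-1)%g ab.2).
have h_inj : injective h by move=> [a b] [a' b'] [] /perm_inj -> /perm_inj ->.
rewrite (reindex_inj h_inj) /= /h /=.
under eq_bigr do rewrite !permKV.
rewrite (bigID (fun ab : 'I_d * 'I_d => (ab.1 < ab.2)%N)) /=.
rewrite [in RHS](bigID (fun ab : 'I_d * 'I_d => ((s^-1)%g ab.1 < (s^-1)%g ab.2)%N)) /=.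
congr addb; first by apply: eq_bigl => -[a b] /=; rewrite andbC.
pose sw (ab : 'I_d * 'I_d) := (ab.2, ab.1).
have sw_inj : injective sw by move=> [a b] [a' b'] [-> ->].
rewrite (reindex_inj sw_inj) /= /sw /=; apply: eq_big => [[a b]|[a b] _] /=; last exact: f_sym.
have := inj_eq (@perm_inj _ (s^-1)%g) a b; rewrite -!val_eqE /=; lia.
Qed.

(** The exponent [<s; a>] modulo 2 for a word [a] whose odd letters are in the
    places marked by [p]. *)
Definition inversion_sign s p : bool :=
  \xor_(a < b) [&& ((s^-1)%g b < (s^-1)%g a)%N, p a & p b].

(** The exponent of the sign in the product of two pure tensors: the factors of
    the second one, with parities [q], move past the later factors of the first
    one, with parities [p]. *)
Definition koszul_sign p q : bool := \xor_(a < b) (p b && q a).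

(** The symmetric form of the inversion relation, to which [xor_pairs_perm]
    applies. *)
Let invb s (a b : 'I_d) := ((a < b)%N != ((s^-1)%g a < (s^-1)%g b)%N).

Let invb_sym s a b : invb s a b = invb s b a.
Proof.
rewrite /invb; case: (eqVneq a b) => [->//|ab].
have : (s^-1)%g a != (s^-1)%g b by rewrite (inj_eq perm_inj).
move: ab; rewrite -!val_eqE /=; lia.
Qed.

Let inversion_signE s p : inversion_sign s p = \xor_(a < b) [&& invb s a b, p a & p b].
Proof.
apply: eq_bigr => -[a b] /= ab; congr andb; rewrite /invb ab.
have : (s^-1)%g a != (s^-1)%g b.
  by rewrite (inj_eq perm_inj) -val_eqE /= neq_ltn ab.
rewrite -val_eqE /=; lia.
Qed.

(** A pair of places is inverted by a product when exactly one of the two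
    factors inverts it. *)
Lemma inversion_signM s1 s2 p :
  inversion_sign (s2 * s1)%g p
  = inversion_sign s1 p (+) inversion_sign s2 (fun a => p (s1 a)).
Proof.
rewrite !inversion_signE.
pose f a b := [&& invb s2 ((s1^-1)%g a) ((s1^-1)%g b), p a & p b].
have -> : \xor_(a < b) [&& invb s2 a b, p (s1 a) & p (s1 b)] = \xor_(a < b) f a b.
  rewrite -(xor_pairs_perm s1) /f; last first.
    by move=> a b; rewrite invb_sym [p a && _]andbC.
  by apply: eq_bigr => -[a b] _; rewrite !permK.
rewrite -big_split; apply: eq_bigr => -[a b] /= _; rewrite /f /invb invMg !permM.
case: (a < b)%N; case: ((s1^-1)%g a < (s1^-1)%g b)%N;
by case: ((s2^-1)%g _ < _)%N; case: (p a); case: (p b).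
Qed.

(** Only pairs of odd places count, and none of these is inverted. *)
Lemma inversion_sign_fixed s p : (forall a, p a -> s a = a) -> inversion_sign s p = false.
Proof.
move=> fix_s; rewrite /inversion_sign big1 // => -[a b] /= ab.
case pa: (p a); last by rewrite andbF.
case pb: (p b); last by rewrite !andbF.
by rewrite -{1}(fix_s _ pa) -{1}(fix_s _ pb) !permK andbT ltnNge ltnW.
Qed.

Lemma eq_inversion_sign s p q : p =1 q -> inversion_sign s p = inversion_sign s q.
Proof. by move=> pq; apply: eq_bigr => ab _; rewrite !pq. Qed.

Lemma eq_koszul_sign p q p' q' :
  p =1 p' -> q =1 q' -> koszul_sign p q = koszul_sign p' q'.
Proof. by move=> pp qq; apply: eq_bigr => ab _; rewrite pp qq. Qed.

(** The signed place permutations act by automorphisms of the super tensor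
    power: an inverted pair changes both sides by the same bilinear form. *)
Lemma koszul_sign_perm s p q :
  koszul_sign (fun a => p (s a)) (fun a => q (s a))
  = koszul_sign p q (+) (inversion_sign s p (+) (inversion_sign s q
      (+) inversion_sign s (fun a => p a (+) q a))).
Proof.
rewrite !inversion_signE /koszul_sign.
pose f a b := if ((s^-1)%g a < (s^-1)%g b)%N then p b && q a else
  if ((s^-1)%g b < (s^-1)%g a)%N then p a && q b else false.
have -> : \xor_(a < b) (p (s b) && q (s a)) = \xor_(a < b) f a b.
  rewrite -(xor_pairs_perm s) /f; last first.
    by move=> a b; case: ltngtP => // _; rewrite andbC.
  by apply: eq_bigr => -[a b] /= ab; rewrite !permK ab.
rewrite -!big_split; apply: eq_bigr => -[a b] /= ab; rewrite /f /invb ab.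
have : (s^-1)%g a != (s^-1)%g b.
  by rewrite (inj_eq perm_inj) -val_eqE /= neq_ltn ab.
rewrite -val_eqE /=; case: ltngtP => //= _ _;
by case: (p a); case: (p b); case: (q a); case: (q b).
Qed.

Lemma odd_card_xor (T : finType) (P : pred T) :
  odd #|[set x | P x]%SET| = \big[addb/false]_(x : T) P x.
Proof.
rewrite cardsE -sum1_card (big_morph odd oddD (erefl : odd 0 = false)).
by rewrite big_mkcond; apply: eq_bigr => x _; rewrite unfold_in; case: (P x).
Qed.

Lemma odd_inversions_parity s p :
  odd #|[set jl : 'I_d * 'I_d | [&& (jl.1 < jl.2)%N,
     ((s^-1)%g jl.2 < (s^-1)%g jl.1)%N, p jl.1 & p jl.2]]%SET| = inversion_sign s p.
Proof.
rewrite odd_card_xor /inversion_sign [RHS]big_mkcond; apply: eq_bigr => ab _.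
by case: (ab.1 < ab.2)%N.
Qed.

Lemma odd_koszul_parity p q :
  odd #|[set lj : 'I_d * 'I_d | [&& (lj.1 < lj.2)%N, p lj.2 & q lj.1]]%SET|
  = koszul_sign p q.
Proof.
rewrite odd_card_xor /koszul_sign [RHS]big_mkcond; apply: eq_bigr => ab _.
by case: (ab.1 < ab.2)%N.
Qed.

Lemma koszul_sign_witness p q :
  koszul_sign p q -> exists a b : 'I_d, [/\ a != b, p b & q a].
Proof.
move=> k1; apply: contrapT => no; move: k1; rewrite /koszul_sign big1 // => -[a b] /= ab.
apply/negP => /andP[pb qa]; apply: no; exists a, b; split=> //.
by rewrite -val_eqE /= neq_ltn ab.
Qed.

Lemma inversion_sign_witness s p :
  inversion_sign s p -> exists a b : 'I_d, [/\ a != b, p b & p a].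
Proof.
move=> k1; apply: contrapT => no; move: k1; rewrite /inversion_sign big1 // => -[a b] /= ab.
apply/negP => /and3P[_ pa pb]; apply: no; exists a, b; split=> //.
by rewrite -val_eqE /= neq_ltn ab.
Qed.

End Signs.

(** * Young subgroups *)

Section Young.
Variables (d : nat) (T : finType) (c : 'I_d -> T).

Definition young (D : {set 'I_d}) : {set 'S_d} :=
  [set s : 'S_d | perm_on D s && [forall j, c (s j) == c j]]%SET.

Lemma youngP D s : reflect (perm_on D s /\ forall j, c (s j) = c j) (s \in young D).
Proof.
rewrite inE; apply: (iffP andP) => [[Ds /forallP cs]|[Ds cs]]; split=> //.
  by move=> j; apply/eqP.
by apply/forallP => j; apply/eqP.
Qed.

Lemma group_set_young D : group_set (young D).
Proof.
apply/group_setP; split=> [|s t /youngP[Ds cs] /youngP[Dt ct]]; apply/youngP; split.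
- exact: perm_on1.
- by move=> j; rewrite perm1.
- exact: perm_onM.
- by move=> j; rewrite permM ct.
Qed.
Canonical young_group D := group (group_set_young D).

(** No colour occurs in both parts, so a permutation preserving colours
    preserves the parts and is the product of its restrictions. *)
Lemma card_youngU (D1 D2 : {set 'I_d}) :
  (forall a b, a \in D1 -> b \in D2 -> c a != c b) ->
  #|young (D1 :|: D2)| = (#|young D1| * #|young D2|)%N.
Proof.
move=> sep.
have TI : (young D1 :&: young D2 = 1)%g.
  apply/trivgP/fintype.subsetP => s; rewrite inE => /andP[/youngP[D1s _] /youngP[D2s _]].
  apply/set1P/permP => j; rewrite perm1.
  case D1j: (j \in D1); last by rewrite (out_perm D1s) // D1j.
  case D2j: (j \in D2); last by rewrite (out_perm D2s) // D2j.
  by have := sep _ _ D1j D2j; rewrite eqxx.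
rewrite -(TI_cardMg TI); apply: eq_card => s; apply/idP/idP; last first.
  case/mulsgP => s1 s2 /youngP[D1s cs1] /youngP[D2s cs2] ->; apply/youngP; split.
    apply/perm_onM/(fintype.subset_trans D2s); first exact: fintype.subset_trans D1s (finset.subsetUl _ _).
    exact: finset.subsetUr.
  by move=> j; rewrite permM cs2.
case/youngP => Ds cs.
have N1 : s \in ('N(D1 | 'P))%g.
  apply/astabsP => j /=; rewrite apermE; apply/idP/idP => Dj; last first.
    have : s j \in D1 :|: D2 by rewrite perm_closed // inE Dj.
    by rewrite inE => /orP[//|/(sep _ _ Dj)]; rewrite cs eqxx.
  have : j \in D1 :|: D2 by rewrite -(perm_closed _ Ds) inE Dj.
  by rewrite inE => /orP[//|/(sep _ _ Dj)]; rewrite cs eqxx.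
have N2 : s \in ('N(D2 | 'P))%g.
  apply/astabsP => j /=; rewrite apermE; apply/idP/idP => Dj; last first.
    have : s j \in D1 :|: D2 by rewrite perm_closed // inE Dj orbT.
    by rewrite inE => /orP[/sep/(_ Dj)|//]; rewrite cs eqxx.
  have : j \in D1 :|: D2 by rewrite -(perm_closed _ Ds) inE Dj orbT.
  by rewrite inE => /orP[/sep/(_ Dj)|//]; rewrite cs eqxx.
have sE : s = (restr_perm D1 s * restr_perm D2 s)%g.
  apply/permP => j; rewrite permM.
  case D1j: (j \in D1).
    rewrite (restr_permE N1) // (out_perm (restr_perm_on _ _)) //.
    apply/negP => D2sj; have := sep _ _ D1j D2sj; by rewrite cs eqxx.
  rewrite (out_perm (restr_perm_on D1 _)) ?D1j //.
  case D2j: (j \in D2); first by rewrite (restr_permE N2).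
  by rewrite (out_perm (restr_perm_on D2 _)) ?D2j // (out_perm Ds) // inE D1j D2j.
rewrite {1}sE; apply/mem_mulg; apply/youngP; split; rewrite ?restr_perm_on // => j.
  case D1j: (j \in D1); first by rewrite (restr_permE N1).
  by rewrite (out_perm (restr_perm_on D1 _)) ?D1j.
case D2j: (j \in D2); first by rewrite (restr_permE N2).
by rewrite (out_perm (restr_perm_on D2 _)) ?D2j.
Qed.

Lemma card_young (P : pred T) :
  #|young [set j | P (c j)]%SET| = (\prod_(l | P l) (#|[set j | c j == l]%SET|)`!)%N.
Proof.
have gen (ls : seq T) : uniq ls ->
    #|young [set j | c j \in ls]%SET| = (\prod_(l <- ls) (#|[set j | c j == l]%SET|)`!)%N.
  elim: ls => [_|l ls IH /= /andP[l_ls /IH {}IH]].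
    rewrite big_nil (_ : young _ = 1%g) ?cards1 //.
    apply/setP => s; rewrite !inE; apply/andP/eqP => [[Ds _]|->].
      apply/permP => j; rewrite perm1 (out_perm Ds) //; by rewrite inE in_nil.
    by rewrite perm_on1; split=> //; apply/forallP => j; rewrite perm1.
  have -> : [set j | c j \in l :: ls]%SET = [set j | c j == l]%SET :|: [set j | c j \in ls]%SET.
    by apply/setP => j; rewrite !inE.
  rewrite card_youngU => [|a b]; last first.
    by rewrite !inE => /eqP -> bls; apply: contraNneq l_ls => ->.
  rewrite IH big_cons -card_perm; congr muln; apply: eq_card => s.
  rewrite !inE [RHS]unfold_in; apply/andP/idP => [[]//|Ds]; split=> //.
  apply/forallP => j; case Dj: (j \in [set j | c j == l]%SET).
    have := Dj; rewrite -(perm_closed j Ds) !inE => /eqP ->.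
    by move: Dj; rewrite inE => /eqP ->.
  by rewrite (out_perm Ds) ?Dj.
have := gen (enum P) (enum_uniq _); rewrite big_enum /= => <-.
by congr #|young _|; apply/setP => j; rewrite !inE mem_enum.
Qed.

End Young.

(** Summing an invariant function orbit by orbit gains the index of the
    stabiliser at every point. *)
Lemma orbit_sum_dvd (R : comNzRingType) (gT : finGroupType) (G : {group gT})
    (T : finType) (to : {action gT &-> T}) (f : T -> R) :
  (forall g x, g \in G -> f (to x g) = f x) ->
  (forall x, exists q, f x = #|('C_G[x | to])%g|%:R * q) ->
  exists q, \sum_x f x = #|G|%:R * q.
Proof.
move=> f_inv f_dvd.
have acts : [acts G, on [set: T]%SET | to]%g by apply/actsP => g _ x; rewrite !inE.
have -> : \sum_x f x = \sum_(O in orbit to G @: [set: T]%SET) \sum_(x in O) f x.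
  rewrite -(set_partition_big _ (orbit_partition acts)) /=.
  by apply: eq_bigl => x; rewrite inE.
apply: (big_ind (fun s => exists q, s = #|G|%:R * q)).
- by exists 0; rewrite mulr0.
- by move=> _ _ [q ->] [q' ->]; exists (q + q'); rewrite mulrDr.
move=> O /imsetP[x _ ->].
have -> : \sum_(y in orbit to G x) f y = #|orbit to G x|%:R * f x.
  rewrite mulr_natl -sumr_const; apply: eq_bigr => y /orbitP[g Gg <-].
  exact: f_inv.
have [q ->] := f_dvd x; exists q; rewrite mulrA -natrM.
by congr (_%:R * _); apply: card_orbit_stab.
Qed.

(** * Products of coefficient functions *)

Lemma natr_neq0 (R : idomainType) : [pchar R] =i pred0 ->
  forall m, (0 < m)%N -> m%:R != 0 :> R.
Proof. by move=> char0 m; rewrite lt0n ((pcharf0P R).1 char0). Qed.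

Lemma neq_ffun (T : finType) (K : eqType) (f g : {ffun T -> K}) :
  f != g -> exists j, f j != g j.
Proof.
move=> fg; apply: contrapT => no; case/eqP: fg; apply/ffunP => j.
by apply: contrapT => /eqP fgj; apply: no; exists j.
Qed.

Section Star.
Variables (d : nat) (L : finType) (par cl : L -> bool).
Local Notation word := {ffun 'I_d -> L}.

Definition wact (w : word) (s : 'S_d) : word := [ffun j => w (s j)].

Lemma wactM w s t : wact (wact w s) t = wact w (t * s)%g.
Proof. by apply/ffunP => j; rewrite !ffunE permM. Qed.

Lemma wact1 w : wact w 1%g = w.
Proof. by apply/ffunP => j; rewrite !ffunE perm1. Qed.

Lemma wactK s : cancel (wact^~ s) (wact^~ (s^-1)%g).
Proof. by move=> w; rewrite /= wactM mulVg wact1. Qed.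

Lemma wact_inj s : injective (wact^~ s). Proof. exact: can_inj (wactK s). Qed.

Lemma inversion_sign_tperm (a b : 'I_d) (p : 'I_d -> bool) :
  b = a.+1 :> nat -> inversion_sign (tperm a b) p = p a && p b.
Proof.
move=> ab; rewrite /inversion_sign tpermV (bigD1 (a, b)) /=; last by rewrite ab.
rewrite tpermL tpermR {1}ab ltnSn /= big1 ?addbF // => -[x y] /= /andP[xy xyab].
rewrite [(_ < _)%N](_ : _ = false) //; apply/negP => lt_yx; case/negP: xyab; move: lt_yx.
rewrite -pair_eqE /pair_eq -!val_eqE /=; move: xy.
case: (tpermP a b y) => [->|->|/eqP ya /eqP yb];
  case: (tpermP a b x) => [->|->|/eqP xa /eqP xb]; try lia;
  try (rewrite -val_eqE /= in ya; rewrite -val_eqE /= in yb); try (rewrite -val_eqE /= in xa; rewrite -val_eqE /= in xb); lia.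
Qed.

Section Ring.
Variables (R : comNzRingType) (G : L -> L -> L -> R).

(** The multiplication of the super tensor power in terms of the coefficients
    of words in a homogeneous basis. *)
Definition star_term (x y : word -> R) (w u v : word) : R :=
  (-1) ^+ koszul_sign (par \o u) (par \o v) *
  (x u * y v * \prod_j G (u j) (v j) (w j)).

Definition star (x y : word -> R) (w : word) : R :=
  \sum_u \sum_v star_term x y w u v.

Definition sign_invariant (x : word -> R) : Prop :=
  forall w s, x (wact w s) = (-1) ^+ inversion_sign s (par \o w) * x w.

(** The ratio of [eta] to [xi]; [cl] marks the letters whose multiplicities
    enter. *)
Definition fac (w : word) : nat :=
  (\prod_(l | cl l) (#|[set j | w j == l]%SET|)`!)%N.

(** For the letters of the matrix algebra these are the coefficient functions
    of the elements of [T]: this is [T_algP]. *)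
Definition eta_lattice (x : word -> R) : Prop :=
  sign_invariant x /\ forall w, exists q, x w = (fac w)%:R * q.

Lemma eta_lattice0 : eta_lattice (fun _ => 0).
Proof. by split=> [w s|w]; [rewrite mulr0|exists 0; rewrite mulr0]. Qed.

Lemma eta_lattice_lin c x y : eta_lattice x -> eta_lattice y ->
  eta_lattice (fun w => c * x w + y w).
Proof.
move=> [x_inv x_dvd] [y_inv y_dvd]; split=> [w s|w].
  by rewrite x_inv y_inv mulrDr mulrCA.
have [q1 ->] := x_dvd w; have [q2 ->] := y_dvd w; exists (c * q1 + q2).
by rewrite mulrDr mulrCA.
Qed.

Hypothesis par_G : forall a b c, G a b c != 0 -> par c = par a (+) par b.

(** The two invariance signs of the factors and the change of the Koszul sign
    combine, by [koszul_sign_perm], to the sign of the product word. *)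
Lemma star_term_perm x y w u v s : sign_invariant x -> sign_invariant y ->
  star_term x y (wact w s) (wact u s) (wact v s)
  = (-1) ^+ inversion_sign s (par \o w) * star_term x y w u v.
Proof.
move=> x_inv y_inv; rewrite /star_term x_inv y_inv.
have -> : \prod_j G (wact u s j) (wact v s j) (wact w s j) = \prod_j G (u j) (v j) (w j).
  by rewrite [RHS](reindex_perm s); apply: eq_bigr => j _; rewrite !ffunE.
have [G0|/eqP G0] := pselect (\prod_j G (u j) (v j) (w j) = 0).
  by rewrite G0 !mulr0.
have -> : koszul_sign (par \o wact u s) (par \o wact v s)
    = koszul_sign (fun a => (par \o u) (s a)) (fun a => (par \o v) (s a)).
  by apply: eq_koszul_sign => a; rewrite /= ffunE.
have par_w : (fun a => (par \o u) a (+) (par \o v) a) =1 par \o w.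
  move=> a /=; rewrite (@par_G (u a) (v a) (w a)) //; apply: contraNneq G0 => Ga.
  by rewrite (bigD1 a) //= Ga mul0r.
rewrite koszul_sign_perm (eq_inversion_sign _ par_w).
rewrite !signr_addb.
set e1 := (-1) ^+ inversion_sign s (par \o u).
set e2 := (-1) ^+ inversion_sign s (par \o v).
have e11 : e1 * e1 = 1 by rewrite -expr2 sqrr_sign.
have e22 : e2 * e2 = 1 by rewrite -expr2 sqrr_sign.
transitivity (e1 * e1 * (e2 * e2) * ((-1) ^+ inversion_sign s (par \o w) *
  ((-1) ^+ koszul_sign (par \o u) (par \o v) *
  (x u * y v * \prod_j G (u j) (v j) (w j))))); first by ring.
by rewrite e11 e22 !mul1r.
Qed.

Lemma star_sign_invariant x y :
  sign_invariant x -> sign_invariant y -> sign_invariant (star x y).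
Proof.
move=> x_inv y_inv w s; rewrite /star (reindex_inj (@wact_inj s)) big_distrr /=.
apply: eq_bigr => u _; rewrite (reindex_inj (@wact_inj s)) big_distrr /=.
by apply: eq_bigr => v _; rewrite star_term_perm.
Qed.

End Ring.

Section Lattice.
Variables (R : idomainType) (G : L -> L -> L -> R).
Hypothesis char0 : [pchar R] =i pred0.
Hypothesis par_G : forall a b c, G a b c != 0 -> par c = par a (+) par b.
Hypothesis cl_G : forall a b c, cl c -> G a b c != 0 -> [|| cl a, cl b, par a | par b].
Hypothesis cl_par : forall c, cl c -> ~~ par c.

(** An odd letter cannot be repeated: moving the two copies next to each other
    and exchanging them changes the sign of the coefficient. *)
Lemma sign_invariant_odd_repeat (x : word -> R) (w : word) (a b : 'I_d) : sign_invariant x ->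
  a != b -> w a = w b -> par (w a) -> x w = 0.
Proof.
move=> x_inv.
wlog lt_ab : a b / (a < b)%N.
  move=> W ab wab pa; have := ab; rewrite -val_eqE neq_ltn => /orP[lt|lt]; first exact: (W a b).
  by apply: (W b a) => //; rewrite ?[b == a]eq_sym // -wab.
move=> _; have [m] := ubnP (b - a)%N; elim: m => // m IH in w b lt_ab * => lt_m wab pa.
have lt_cd : (b.-1 < d)%N by apply: leq_ltn_trans (leq_pred b) (ltn_ord b).
pose c := Ordinal lt_cd.
have cb : b = c.+1 :> nat by rewrite /= (ltn_predK lt_ab).
have [ac|ac] := eqVneq a c.
  have := x_inv w (tperm a b).
  have -> : wact w (tperm a b) = w.
    by apply/ffunP => j; rewrite ffunE; case: tpermP => // ->.
  rewrite inversion_sign_tperm /= -?wab ?pa ?andbb ?expr1 ?mulN1r; last by rewrite ac.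
  move/eqP; rewrite -addr_eq0 -mulr2n -mulr_natl mulf_eq0 => /orP[|/eqP//].
  by rewrite (negPf (natr_neq0 char0 _)).
have lt_ac : (a < c)%N by move: ac; rewrite -val_eqE /=; move: lt_ab => /=; lia.
have : x (wact w (tperm c b)) = 0.
  have wa : wact w (tperm c b) a = w a.
    by rewrite ffunE tpermD // -val_eqE /=; move: lt_ab lt_ac => /=; lia.
  apply: (IH _ c) => //; first by move: lt_m lt_ab => /=; lia.
  - by rewrite wa ffunE tpermL.
  - by rewrite wa.
by rewrite x_inv => /eqP; rewrite mulf_eq0 signr_eq0 => /eqP.
Qed.

Lemma card_young_fac (w : word) : #|young w [set j | cl (w j)]%SET| = fac w.
Proof. exact: card_young. Qed.

(** The letters of a product that are of type [cl] come from factors one of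
    which is odd or of type [cl]: a repeated pair is excluded in the first
    case and is counted by one of the two factorials in the second. *)
Lemma star_lattice (x y : word -> R) :
  eta_lattice x -> eta_lattice y -> eta_lattice (star G x y).
Proof.
move=> [x_inv x_dvd] [y_inv y_dvd]; split=> [|w]; first exact: star_sign_invariant.
pose D := [set j | cl (w j)]%SET.
(* Terms with a fixed product word [w] are summed over orbits of the Young
   subgroup of [w]; each stabiliser is a product of three Young subgroups. *)
pose to0 (uv : word * word) (g : 'S_d) := (wact uv.1 (g^-1)%g, wact uv.2 (g^-1)%g).
have to01 : to0^~ 1%g =1 id by move=> [u v]; rewrite /to0 /= invg1 !wact1.
have to0M uv : act_morph to0 uv by move=> g h; rewrite /to0 /= !wactM invMg.
pose to := TotalAction to01 to0M.
rewrite /star pair_big /= -card_young_fac.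
apply: (orbit_sum_dvd (to := to)) => [g [u v] Gg|[u v]] /=.
  have /youngP[Dg wg] := groupVr Gg.
  have wgE : wact w (g^-1)%g = w by apply/ffunP => j; rewrite ffunE wg.
  rewrite -[in LHS]wgE star_term_perm // inversion_sign_fixed ?mul1r //= => j pj.
  by apply: (out_perm Dg); rewrite inE; apply: contraL pj => /cl_par.
pose c j := (u j, v j, w j).
(* Marked places, according to whether the letter of [u], that of [v] or none
   of them is marked. *)
pose D1 := [set j | cl (w j) && cl (u j)]%SET.
pose D2 := [set j | [&& cl (w j), ~~ cl (u j) & cl (v j)]]%SET.
pose D3 := [set j | [&& cl (w j), ~~ cl (u j) & ~~ cl (v j)]]%SET.
have stabE : ('C_(young_group w D)[(u, v) | to])%g = young c D.
  apply/setP => g; rewrite inE; apply/andP/youngP => [[/youngP[Dg wg]]|[Dg cg]].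
    move/astab1P => /= [/ffunP ug /ffunP vg]; split=> // j.
    by have := ug (g j); have := vg (g j); rewrite !ffunE !permK /c => <- <-; rewrite wg.
  split; first by apply/youngP; split=> // j; have [] := cg j.
  apply/astab1P; congr pair; apply/ffunP => j; rewrite ffunE;
    by have [] := cg ((g^-1)%g j); rewrite permKV.
rewrite stabE (_ : D = D1 :|: (D2 :|: D3)); last first.
  by apply/setP => j; rewrite !inE; case: (cl (w j)); case: (cl (u j)); case: (cl (v j)).
have -> : #|young c (D1 :|: (D2 :|: D3))| = (#|young c D1| * (#|young c D2| * #|young c D3|))%N.
  rewrite !card_youngU // => a b; rewrite !inE.
    by move=> /and3P[_ _ va] /and3P[_ _ /negP vb]; apply/eqP => -[_ vab _]; case: vb; rewrite -vab.
  by move=> /andP[_ ua] /orP[] /and3P[_ /negP ub _]; apply/eqP => -[uab _ _]; case: ub; rewrite -uab.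
have /dvdnP[n1 fac1] : (#|young c D1| %| fac u)%N.
  rewrite -card_young_fac; apply: cardSg; apply/fintype.subsetP => s /youngP[Ds cs].
  apply/youngP; split=> [|j]; last by have [] := cs j.
  by apply: (fintype.subset_trans Ds); apply/fintype.subsetP => j; rewrite !inE => /andP[].
have /dvdnP[n2 fac2] : (#|young c D2| %| fac v)%N.
  rewrite -card_young_fac; apply: cardSg; apply/fintype.subsetP => s /youngP[Ds cs].
  apply/youngP; split=> [|j]; last by have [] := cs j.
  by apply: (fintype.subset_trans Ds); apply/fintype.subsetP => j; rewrite !inE => /and3P[].
have [F0|/eqP F0] := pselect (star_term G x y w u v = 0).
  by exists 0; rewrite F0 mulr0.
have x0 : x u != 0 by apply: contraNneq F0 => x0; rewrite /star_term x0 !mul0r mulr0.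
have y0 : y v != 0 by apply: contraNneq F0 => y0; rewrite /star_term y0 mulr0 mul0r mulr0.
have G0 j : G (u j) (v j) (w j) != 0.
  by apply: contraNneq F0 => G0; rewrite /star_term (bigD1 j) //= G0 mul0r !mulr0.
(* On the third part one of the two letters is odd, so it is not repeated. *)
have -> : #|young c D3| = 1%N.
  rewrite (_ : young c D3 = 1%g) ?cards1 //; apply/trivgP/fintype.subsetP => s /youngP[Ds cs].
  apply/set1P/permP => j; rewrite perm1; apply: contrapT => /eqP sj.
  have : j \in D3 by apply: contraNT sj => /(out_perm Ds) ->.
  rewrite inE => /and3P[wj /negPf uj /negPf vj]; have := cl_G wj (G0 j); rewrite uj vj /=.
  have [us vs _] := cs j.
  case/orP => pj.
    by case/eqP: x0; apply: (sign_invariant_odd_repeat x_inv sj us); rewrite us.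
  by case/eqP: y0; apply: (sign_invariant_odd_repeat y_inv sj vs); rewrite vs.
have [q1 q1E] := x_dvd u; have [q2 q2E] := y_dvd v.
rewrite /star_term q1E q2E fac1 fac2 !natrM.
exists ((-1) ^+ koszul_sign (par \o u) (par \o v) * (n1%:R * q1 * (n2%:R * q2) *
  \prod_j G (u j) (v j) (w j))).
ring.
Qed.
End Lattice.
End Star.

(** * Shortest coset representatives *)

Section ShortestRepresentatives.
Variables (d : nat) (T : eqType) (t : 'I_d -> T).

(** Every inversion of the new permutation yields one of the old permutation,
    by applying the transposition to the pair when this keeps its order; the
    pair [(i, j)] is not obtained. *)
Lemma perm_length_swap (s : 'S_d) (i j : 'I_d) :
  (i < j)%N -> (s j < s i)%N -> (perm_length (tperm i j * s)%g < perm_length s)%N.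
Proof.
move=> ij sji; set r := tperm i j.
pose h (ab : 'I_d * 'I_d) := if (r ab.1 < r ab.2)%N then (r ab.1, r ab.2) else ab.
have rr x : r (r x) = x by rewrite /r tpermK.
have key (x y : 'I_d) : (x < y)%N -> (s (r y) < s (r x))%N -> ~~ (r x < r y)%N ->
    (s y < s x)%N /\ (x, y) != (i, j).
  move=> xy; rewrite -pair_eqE /pair_eq -!val_eqE /= /r; move: xy ij sji.
  case: (tpermP i j y) => [->|->|/eqP yi /eqP yj];
  case: (tpermP i j x) => [->|->|/eqP xi /eqP xj]; try lia;
  try (rewrite -val_eqE /= in yi; rewrite -val_eqE /= in yj); try (rewrite -val_eqE /= in xi; rewrite -val_eqE /= in xj); lia.
pose S := [set jl : 'I_d * 'I_d | (jl.1 < jl.2)%N && ((r * s)%g jl.2 < (r * s)%g jl.1)%N]%SET.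
rewrite -[X in (X < _)%N]/#|S|.
have h_inj : {in S &, injective h}.
  move=> [x y] [x' y']; rewrite !inE /= !permM /h /= => /andP[xy _] /andP[xy' _].
  case: ifP => c1; case: ifP => c2 [].
  - by move=> /perm_inj -> /perm_inj ->.
  - by move=> e1 e2; move: c2; rewrite -e1 -e2 !rr xy.
  - by move=> e1 e2; move: c1; rewrite e1 e2 !rr xy'.
  - by move=> -> ->.
rewrite -(card_in_imset h_inj) /perm_length.
apply: proper_card; apply/properP; split.
  apply/fintype.subsetP => _ /imsetP[[x y] + ->]; rewrite !inE /= !permM /h /= => /andP[xy sxy].
  case: ifP => c /=; first by rewrite c.
  by rewrite xy; case: (key x y) => //; rewrite c.
exists (i, j); rewrite ?inE /= ?ij //.
apply/negP => /imsetP[[x y]]; rewrite inE /= !permM /h /= => /andP[xy sxy].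
case: ifP => c; last first.
  by case: (key x y) => // [|_ /eqP ne e]; [rewrite c | case: ne].
by case=> e1 e2; move: xy; rewrite -(rr x) -(rr y) -e1 -e2 /r tpermL tpermR; move: ij; lia.
Qed.

Definition shortest (s : 'S_d) : Prop :=
  forall r : 'S_d, (forall j, t (r j) = t j) -> (perm_length s <= perm_length (s * r)%g)%N.

(** Otherwise exchanging two equal letters gives a shorter element of the
    coset. *)
Lemma shortest_increasing s (i j : 'I_d) :
  shortest s -> (i < j)%N -> t (s i) = t (s j) -> (s i < s j)%N.
Proof.
move=> s_short ij tij; rewrite ltnNge; apply/negP => sji.
have {}sji : (s j < s i)%N.
  rewrite ltn_neqAle sji val_eqE (inj_eq perm_inj) andbT -val_eqE /=.
  by move: ij; lia.
have /s_short : forall x, t (tperm (s i) (s j) x) = t x by move=> x; case: tpermP => // ->.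
rewrite leqNgt; apply/negP; rewrite negbK; have -> : (s * tperm (s i) (s j) = tperm i j * s)%g.
  apply/permP => x; rewrite !permM.
  case: (tpermP i j) => [->|->|/eqP xi /eqP xj]; rewrite ?tpermL ?tpermR //.
  by rewrite tpermD // (inj_eq perm_inj) eq_sym.
exact: perm_length_swap.
Qed.

(** Both are increasing on the places of each letter. Their quotient preserves
    letters and order, so it fixes all places, by induction. *)
Lemma shortest_unique s1 s2 : shortest s1 -> shortest s2 ->
  (forall j, t (s1 j) = t (s2 j)) -> s1 = s2.
Proof.
move=> sh1 sh2 s12; pose r := (s2 * s1^-1)%g.
have rE j : s1 (r j) = s2 j by rewrite permM permKV.
have tr j : t (s1 (r j)) = t (s1 j) by rewrite rE s12.
have mono (i j : 'I_d) : (i < j)%N -> t (s1 i) = t (s1 j) -> (r i < r j)%N.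
  move=> ij tij; rewrite ltnNge leq_eqVlt; apply/negP => /orP[|lt].
    by rewrite val_eqE (inj_eq perm_inj) -val_eqE /=; move: ij; lia.
  have := shortest_increasing sh1 lt; rewrite !tr => /(_ (esym tij)); rewrite !rE.
  have := shortest_increasing sh2 ij; rewrite -!s12 => /(_ tij); lia.
suff r1 : r = 1%g by rewrite -[s2](mulgKV s1) -/r r1 mul1g.
suff fix_r m (j : 'I_d) : (j < m)%N -> r j = j by apply/permP => j; rewrite perm1 (fix_r j.+1).
elim: m j => // m IH j; rewrite ltnS leq_eqVlt => /orP[/eqP jm|]; last exact: IH.
have fix_lt (i : 'I_d) : (i < j)%N -> r i = i by rewrite jm; apply: IH.
have [lt|gt|/val_inj //] := ltngtP (r j) j.
  by have /perm_inj e := fix_lt _ lt; rewrite e ltnn in lt.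
pose i := (r^-1)%g j; have ri : r i = j by rewrite permKV.
have [lt|lt|/val_inj e] := ltngtP i j.
- by have /(congr1 val) /= := etrans (esym ri) (fix_lt i lt); lia.
- have := mono _ _ lt; rewrite -(tr i) ri => /(_ erefl); lia.
- by rewrite -[in LHS]e ri.
Qed.

Lemma shortest_exists (s : 'S_d) :
  exists2 r : 'S_d, shortest r & forall j, t (r j) = t (s j).
Proof.
pose P (r : 'S_d) := [forall j, t (r j) == t j].
have P1 : P 1%g by apply/forallP => j; rewrite perm1.
have [r Pr r_min] := arg_minnP (fun r => perm_length (s * r)%g) P1.
have {}Pr j : t (r j) = t j by apply/eqP; apply: (forallP Pr).
exists (s * r)%g => [r' tr'|j]; last by rewrite permM Pr.
rewrite -mulgA; apply: r_min; apply/forallP => j; apply/eqP.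
by rewrite permM tr' Pr.
Qed.

End ShortestRepresentatives.

(** * Coefficients of the elements xi and eta *)

Section Xi.
Variables (d : nat) (L : finType) (par cl : L -> bool).
Local Notation word := {ffun 'I_d -> L}.
Implicit Types (t w : word).

Definition shortestb t (s : 'S_d) : bool :=
  [forall r : 'S_d, (wact t r == t) ==> (perm_length s <= perm_length (s * r)%g)%N].

Lemma shortestP t s : reflect (shortest t s) (shortestb t s).
Proof.
apply: (iffP forallP) => [sh r tr|sh r]; last first.
  by apply/implyP => /eqP/ffunP tr; apply: sh => j; rewrite -[in RHS]tr ffunE.
by apply: implyP (sh r) _; apply/eqP/ffunP => j; rewrite ffunE.
Qed.

Definition no_odd_repeat t : bool :=
  [forall j, forall l, (j != l) && (t j == t l) ==> ~~ par (t j)].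

Lemma no_odd_repeatP t :
  reflect (forall j l, j != l -> t j = t l -> ~~ par (t j)) (no_odd_repeat t).
Proof.
apply: (iffP forallP) => [H j l jl tjl|H j].
  by have /forallP/(_ l) := H j; rewrite jl tjl eqxx.
by apply/forallP => l; apply/implyP => /andP[jl /eqP]; apply: H.
Qed.

Lemma fac_wact w s : fac cl (wact w s) = fac cl w.
Proof.
apply: eq_bigr => l _; congr (_ `!).
rewrite -[RHS](card_preimset _ (@perm_inj _ s)); apply: eq_card => j.
by rewrite !inE ffunE.
Qed.

(** A canonical word of each orbit; the default is never reached. *)
Definition orbit_rep w : word := odflt w [pick w' | [exists s, w' == wact w s]].

Lemma orbit_rep_wact w s : orbit_rep (wact w s) = orbit_rep w.
Proof.
rewrite /orbit_rep (eq_pick (Q := fun w' => [exists s, w' == wact w s])) => [|w'].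
  case: pickP => //= no; have /existsP[] := no w; by exists 1%g; rewrite wact1.
apply/existsP/existsP => -[r /eqP ->].
  by exists (r * s)%g; rewrite wactM.
by exists (r * s^-1)%g; rewrite wactM mulgKV.
Qed.

Lemma orbit_repP w : exists s, w = wact (orbit_rep w) s.
Proof.
rewrite /orbit_rep; case: pickP => /= [w' /existsP[s /eqP ->]|no].
  by exists (s^-1)%g; rewrite wactK.
by exists 1%g; rewrite wact1.
Qed.

Section Coefficients.
Variable R : comNzRingType.

(** The coefficient function of the element [xi] of the word [t]. *)
Definition xi t w : R :=
  \sum_(s | shortestb t s) (-1) ^+ inversion_sign s (par \o t) * (wact t s == w)%:R.

(** Exactly one shortest representative sends [t] to the given word, and it
    differs from [s] by an element of the stabiliser, which moves even letters
    only. *)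
Lemma xi_wact t s : no_odd_repeat t ->
  xi t (wact t s) = (-1) ^+ inversion_sign s (par \o t).
Proof.
move=> /no_odd_repeatP t_odd; have [r0 r0_sh r0s] := shortest_exists t s.
rewrite /xi (bigD1 r0) /=; last exact/shortestP.
have -> : wact t r0 = wact t s by apply/ffunP => j; rewrite !ffunE.
rewrite eqxx mulr1 big1 => [|r /andP[/shortestP r_sh]]; last first.
  move=> ne; case: eqP => [/ffunP e|]; last by rewrite mulr0.
  case/eqP: ne; apply: (shortest_unique r_sh r0_sh) => j.
  by have := e j; rewrite !ffunE r0s.
rewrite addr0; pose h := (s^-1 * r0)%g.
have th j : t (h j) = t j by rewrite permM r0s permKV.
have -> : r0 = (s * h)%g by rewrite mulKVg.
rewrite inversion_signM [inversion_sign h _]inversion_sign_fixed /= => [|j /= pj].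
  by congr (_ ^+ _); congr (nat_of_bool _); apply: eq_inversion_sign => j; rewrite /= th.
apply: contrapT => /eqP hj; have := t_odd _ _ hj (th j); by rewrite th pj.
Qed.

Lemma xi_out t w : (forall s, wact t s != w) -> xi t w = 0.
Proof. by move=> no; rewrite /xi big1 // => s _; rewrite (negPf (no s)) mulr0. Qed.

Lemma xi_sign_invariant t : no_odd_repeat t -> sign_invariant par (xi t).
Proof.
move=> t_odd w s; have [[r <-]|no] := pselect (exists r, wact t r = w).
  rewrite wactM !xi_wact // inversion_signM signr_addb mulrC; congr (_ * _).
  by congr (_ ^+ _); congr (nat_of_bool _); apply: eq_inversion_sign => j; rewrite /= ffunE.
rewrite !xi_out ?mulr0 // => r; apply/eqP => e; apply: no.
  by exists r.
by exists (s^-1 * r)%g; rewrite -wactM e wactK.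
Qed.

Lemma eta_in_lattice t : no_odd_repeat t ->
  eta_lattice par cl (fun w => (fac cl t)%:R * xi t w).
Proof.
move=> t_odd; split=> [w s|w]; first by rewrite xi_sign_invariant // mulrCA.
have [[r <-]|no] := pselect (exists r, wact t r = w).
  by exists (xi t (wact t r)); rewrite fac_wact.
by exists 0; rewrite xi_out ?mulr0 // => r; apply/eqP => e; apply: no; exists r.
Qed.

End Coefficients.

(** An invariant function is determined by its values at orbit representatives,
    and it vanishes at words with a repeated odd letter. *)
Lemma eta_lattice_decomposition (R : idomainType) (x : word -> R) (q : word -> R) :
  [pchar R] =i pred0 -> sign_invariant par x ->
  (forall w, x w = (fac cl w)%:R * q w) ->
  forall w, x w = \sum_(t | no_odd_repeat t && (orbit_rep t == t))
                     q t * ((fac cl t)%:R * xi R t w).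
Proof.
move=> char0 x_inv xq w; have [s ws] := orbit_repP w.
have rep_id : orbit_rep (orbit_rep w) = orbit_rep w by rewrite {2}ws orbit_rep_wact.
have other t : orbit_rep t == t -> t != orbit_rep w -> xi R t w = 0.
  move=> /eqP tt tw; apply: xi_out => r; apply: contraNneq tw => <-.
  by rewrite orbit_rep_wact tt.
case t0 : (no_odd_repeat (orbit_rep w)); last first.
  rewrite big1 => [|t /andP[t_odd tt]]; last first.
    rewrite other ?mulr0 //; by apply: contraFneq t0 => <-.
  move/no_odd_repeatP: t0 => t0; rewrite ws x_inv.
  suff -> : x (orbit_rep w) = 0 by rewrite mulr0.
  apply: contrapT => x0; apply: t0 => j l jl tjl; apply/negP => pj; apply: x0.
  exact: sign_invariant_odd_repeat x_inv jl tjl pj.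
rewrite (bigD1 (orbit_rep w)) ?t0 ?rep_id ?eqxx //= big1 => [|t /andP[/andP[_ tt] tw]].
  have := xi_wact R s t0; rewrite -ws => ->.
  by rewrite addr0 {1}ws x_inv xq [LHS]mulrC mulrA [q _ * _]mulrC.
by rewrite other ?mulr0.
Qed.

End Xi.

(** * Submodules, spans and base change *)

Section LinearForms.
Variables (R : nzRingType) (V : lmodType R) (f : V -> R).
Hypothesis f_lin : forall c x y, f (c *: x + y) = c * f x + f y.

Lemma form0 : f 0 = 0.
Proof. by have := f_lin (-1) 0 0; rewrite scaler0 addr0 mulN1r addNr. Qed.

Lemma formD x y : f (x + y) = f x + f y.
Proof. by have := f_lin 1 x y; rewrite scale1r mul1r. Qed.

Lemma formZ c x : f (c *: x) = c * f x.
Proof. by have := f_lin c x 0; rewrite form0 !addr0. Qed.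

Lemma form_sum (J : Type) (r : seq J) (P : pred J) (g : J -> V) :
  f (\sum_(u <- r | P u) g u) = \sum_(u <- r | P u) f (g u).
Proof. exact: (big_morph f formD form0). Qed.

End LinearForms.

Section SpanTheory.
Variables (R : nzRingType) (V : lmodType R).
Implicit Types (P Q : set V).

Lemma submodule_sum P : submodule P ->
  forall (I : Type) (s : seq I) (q : pred I) (f : I -> V),
  (forall i, q i -> P (f i)) -> P (\sum_(i <- s | q i) f i).
Proof.
move=> [P0 PL] I s q f Pf; apply: (big_ind P) => // x y Px Py.
by have := PL 1 x y Px Py; rewrite scale1r.
Qed.

Lemma submoduleZ P c x : submodule P -> P x -> P (c *: x).
Proof. by move=> [P0 PL] Px; have := PL c x 0 Px P0; rewrite addr0. Qed.

Lemma submoduleD P x y : submodule P -> P x -> P y -> P (x + y).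
Proof. by move=> [P0 PL] Px Py; have := PL 1 x y Px Py; rewrite scale1r. Qed.

Lemma submoduleB P x y : submodule P -> P x -> P y -> P (x - y).
Proof.
by move=> [P0 PL] Px Py; have := PL (-1) y x Py Px; rewrite scaleN1r addrC.
Qed.

Lemma submodule_sub_span P Q : submodule Q -> P `<=` Q -> span P `<=` Q.
Proof.
move=> Qsub PQ _ [s [Ps ->]]; rewrite big_seq; apply: submodule_sum => // p sp.
by apply: submoduleZ => //; apply: PQ; apply: Ps.
Qed.

Lemma sub_span P x : P x -> span P x.
Proof.
move=> Px; exists [:: (1, x)]; rewrite big_seq1 scale1r; split=> // p.
by rewrite inE => /eqP ->.
Qed.

Lemma span_submodule P : submodule (span P).
Proof.
split; first by exists [::]; rewrite big_nil.
move=> c x y [s [Ps ->]] [t [Pt ->]].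
exists ([seq (c * p.1, p.2) | p <- s] ++ t); split=> [p|].
  rewrite mem_cat => /orP[/mapP[q /Ps Pq ->]|/Pt] //.
rewrite big_cat big_map scaler_sumr /=; congr (_ + _).
by apply: eq_bigr => p _; rewrite scalerA.
Qed.

End SpanTheory.

(** Bundles a linear function, to which universal properties apply. *)
Lemma linear_packed (R : nzRingType) (U V : lmodType R) (f : U -> V) :
  linear f -> exists g : {linear U -> V}, f =1 g.
Proof.
move=> f_lin; pose m := GRing.isLinear.Build R U V _ f f_lin.
pose g : {linear U -> V} := HB.pack f m.
by exists g.
Qed.

Section FreeBaseChange.
Variables (k : comNzRingType) (F : fieldType) (phi : {rmorphism k -> F}).
Variables (U : lmodType k) (S : set U) (W : lmodType F) (iota : U -> W).
Hypothesis S_sub : submodule S.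
Hypothesis iota_semi : semilinear_on phi S iota.

Lemma semilinear0 : iota 0 = 0.
Proof.
have [S0 _] := S_sub; have := iota_semi 1 S0 S0.
by rewrite scaler0 addr0 rmorph1 scale1r => /eqP; rewrite -subr_eq subrr => /eqP <-.
Qed.

Lemma semilinearZ c x : S x -> iota (c *: x) = phi c *: iota x.
Proof.
move=> Sx; have [S0 _] := S_sub.
by have := iota_semi c Sx S0; rewrite semilinear0 !addr0.
Qed.

Lemma semilinear_lincomb (J : Type) (r : seq J) (p : pred J) (c : J -> k) (b : J -> U) :
  (forall j, p j -> S (b j)) ->
  iota (\sum_(j <- r | p j) c j *: b j) = \sum_(j <- r | p j) phi (c j) *: iota (b j).
Proof.
move=> Sb; elim: r => [|j r IH]; first by rewrite !big_nil semilinear0.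
rewrite !big_cons; case: ifP => // pj; rewrite iota_semi ?IH //; first exact: Sb.
by apply: submodule_sum => // i pi; apply: submoduleZ => //; apply: Sb.
Qed.

(** The coordinate map of a finite basis is semilinear, so it extends; the
    expansion in the basis holds because both sides agree on the image of
    [iota]. *)
Lemma free_base_change (J : finType) (b : J -> U) (co : J -> U -> k) :
  is_base_change phi S iota ->
  (forall j, S (b j)) ->
  (forall x, S x -> x = \sum_j co j x *: b j) ->
  (forall j c x y, S x -> S y -> co j (c *: x + y) = c * co j x + co j y) ->
  exists co' : J -> W -> F,
    [/\ forall j c x y, co' j (c *: x + y) = c * co' j x + co' j y,
        forall j x, S x -> co' j (iota x) = phi (co j x) &
        forall w, w = \sum_j co' j w *: iota (b j)].
Proof.
move=> [_ univ] Sb x_sum co_lin.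
pose V : lmodType F := {ffun J -> F^o}.
pose g (x : U) : V := [ffun j => phi (co j x)].
have g_semi : semilinear_on phi S g.
  move=> c x y Sx Sy; apply/ffunP => j; rewrite !ffunE co_lin //.
  by rewrite rmorphD rmorphM.
have [[h hg] _] := univ V g g_semi.
have co'_lin j c x y : h (c *: x + y) j = c * h x j + h y j.
  by rewrite linearP !ffunE.
exists (fun j w => h w j); split=> [//|j x Sx|w]; first by rewrite hg // ffunE.
have f_lin : linear (fun w => \sum_j (h w j : F) *: iota (b j)).
  move=> c x y; rewrite scaler_sumr -big_split; apply: eq_bigr => j _ /=.
  by rewrite co'_lin scalerDl scalerA.
have [f fE] := linear_packed f_lin.
have id_lin : linear (fun w : W => w) by [].
have [id' idE] := linear_packed id_lin.
have [_ uniq] := univ W iota iota_semi.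
rewrite [LHS]idE [RHS]fE; apply: uniq => x Sx; rewrite -idE -fE.
rewrite {1}(x_sum x Sx) semilinear_lincomb //; apply: eq_bigr => j _.
by rewrite hg // ffunE.
Qed.

End FreeBaseChange.

(** * Coordinates in a heredity algebra *)

Section ProductBasis.
Variables (k : comNzRingType) (A : algType k).
Variables (disp : Order.disp_t) (I : finPOrderType disp) (X Y : I -> {fset A}).

(** Triples, rather than the products [x * y], index the basis: that a product
    determines its factors is only a consequence of linear independence. *)
Definition bidx : finType := {i : I & (X i * Y i)%type}.

Definition lay (t : bidx) : I := tag t.
Definition bx (t : bidx) : A := val (tagged t).1.
Definition by_ (t : bidx) : A := val (tagged t).2.
Definition bprod (t : bidx) : A := bx t * by_ t.

Definition mkb i x y (hx : x \in X i) (hy : y \in Y i) : bidx :=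
  Tagged (fun i => (X i * Y i)%type) ([` hx]%fset, [` hy]%fset).

Lemma bx_in t : bx t \in X (lay t). Proof. exact: valP. Qed.
Lemma by_in t : by_ t \in Y (lay t). Proof. exact: valP. Qed.

Lemma bidx_eq t t' : lay t = lay t' -> bx t = bx t' -> by_ t = by_ t' -> t = t'.
Proof.
case: t t' => [i [x y]] [i' [x' y']]; rewrite /lay /bx /by_ /= => ii'.
by subst i' => /val_inj -> /val_inj ->.
Qed.

Lemma lincombE c : lincomb X Y c = \sum_t c (lay t) (bx t) (by_ t) *: bprod t.
Proof.
have -> : \sum_(t : bidx) c (lay t) (bx t) (by_ t) *: bprod t
    = \sum_i \sum_(p : (X i * Y i)%type) c i (val p.1) (val p.2) *: (val p.1 * val p.2).
  by rewrite (@sig_big_dep A) /=; apply: eq_bigr => -[].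
apply: eq_bigr => i _; rewrite big_seq_fsetE /=.
under eq_bigr do rewrite big_seq_fsetE /=.
by rewrite pair_bigA.
Qed.

Lemma lift_coeff (f : bidx -> k) :
  exists c, forall t, c (lay t) (bx t) (by_ t) = f t.
Proof.
exists (fun i x y => if insub x is Some x' then if insub y is Some y' then
   f (Tagged (fun i => (X i * Y i)%type) (x' : X i, y' : Y i)) else 0 else 0).
by case=> i [x y]; rewrite /lay /bx /by_ /= !valK.
Qed.

Lemma span_fset (Z : {fset A}) (v : A) : span [set` Z] v ->
  exists r : Z -> k, v = \sum_(z : Z) r z *: val z.
Proof.
move=> [s [Zs ->]]; exists (fun z => \sum_(p <- s | p.2 == val z) p.1).
under [RHS]eq_bigr do rewrite scaler_suml.
rewrite (exchange_big_dep predT) //= big_seq [RHS]big_seq; apply: eq_bigr => p sp.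
rewrite (bigD1 [` Zs p sp]%fset) //= big1 ?addr0 // => z /andP[/eqP pz].
by case/eqP; apply/val_inj; rewrite /= pz.
Qed.

End ProductBasis.

Section HeredityTheory.
Variables (k : idomainType) (A : algType k) (gr : int -> bool -> set A).
Hypothesis A_super : graded_superalgebra gr.
Variables (disp : Order.disp_t) (I : finPOrderType disp).
Variables (X Y : I -> {fset A}) (ei : I -> A).
Hypothesis her : heredity_data gr setT X Y ei.
Local Notation idx := (bidx X Y).

Lemma basis_gen a : exists f : {ffun idx -> k}, a = \sum_t f t *: bprod t.
Proof.
have [c ->] := her_basis_gen her (Logic.I : setT a); rewrite lincombE.
by exists [ffun t => c (lay t) (bx t) (by_ t)]; apply: eq_bigr => t _; rewrite ffunE.
Qed.

Definition coA (t : idx) (a : A) : k := projT1 (cid (basis_gen a)) t.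

Lemma coA_sum a : a = \sum_t coA t a *: bprod t.
Proof. by rewrite /coA; case: cid. Qed.

Lemma coA_unique (f : idx -> k) a : a = \sum_t f t *: bprod t -> forall t, coA t a = f t.
Proof.
move=> af t; have [c cE] := lift_coeff (fun t => coA t a - f t).
apply/eqP; rewrite -subr_eq0 -cE; apply/eqP.
apply: (her_basis_free her (c := c)); rewrite ?bx_in ?by_in // lincombE.
under eq_bigr do rewrite cE scalerBl.
by rewrite sumrB -coA_sum -af subrr.
Qed.

Lemma coA_bprod t t' : coA t (bprod t') = (t == t')%:R.
Proof.
apply: (coA_unique (f := fun t => (t == t')%:R)).
rewrite (bigD1 t') //= eqxx scale1r big1 ?addr0 // => u /negPf ->.
by rewrite scale0r.
Qed.

Lemma coA_linear t : linear (coA t : A -> k^o).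
Proof.
move=> c a b; apply: (coA_unique (f := fun t => c * coA t a + coA t b)).
rewrite [in LHS](coA_sum a) [in LHS](coA_sum b) scaler_sumr -big_split.
by apply: eq_bigr => u _ /=; rewrite scalerDl scalerA.
Qed.
HB.instance Definition _ t := GRing.isLinear.Build k A k^o _ (coA t) (coA_linear t).

Lemma coA0 t : coA t 0 = 0. Proof. exact: linear0. Qed.
Lemma coAD t a b : coA t (a + b) = coA t a + coA t b. Proof. exact: linearD. Qed.
Lemma coAB t a b : coA t (a - b) = coA t a - coA t b. Proof. exact: linearB. Qed.
Lemma coAZ t c a : coA t (c *: a) = c * coA t a. Proof. exact: linearZ. Qed.
Lemma coA_sumE t (J : Type) (r : seq J) (P : pred J) (f : J -> A) :
  coA t (\sum_(j <- r | P j) f j) = \sum_(j <- r | P j) coA t (f j).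
Proof. exact: raddf_sum. Qed.

(** ** Ideals attached to the order *)

(** The ideal [A^{>i}] in terms of coordinates, see [span_gt_part]. *)
Definition gt_part i a := forall t, ~~ (i < lay t)%O -> coA t a = 0.
Definition ge_part i a := forall t, ~~ (i <= lay t)%O -> coA t a = 0.

Let coA_submodule (P : pred idx) : submodule [set a | forall t, P t -> coA t a = 0].
Proof.
split=> [t _|c x y gx gy t it]; first by rewrite linear0.
by rewrite linearP /= gx // gy // scaler0 addr0.
Qed.

Lemma gt_part_submodule i : submodule (gt_part i). Proof. exact: coA_submodule. Qed.
Lemma ge_part_submodule i : submodule (ge_part i). Proof. exact: coA_submodule. Qed.

Lemma span_gt_part i a : span_gt X Y i a <-> gt_part i a.
Proof.
split.
  apply: submodule_sub_span => [|_ [j [x [y [ij Xx Yy ->]]]]].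
    exact: gt_part_submodule.
  move=> t it; rewrite -[x * y]/(bprod (mkb Xx Yy)) coA_bprod; case: eqP => // te.
  by move: it; rewrite te ij.
move=> ga; rewrite (coA_sum a); apply: submodule_sum => [|t _].
  exact: span_submodule.
have [it|it] := boolP (i < lay t)%O; last first.
  by rewrite ga // scale0r; case: (span_submodule [set b | exists (j : I) (x y : A),
    [/\ (i < j)%O, x \in X j, y \in Y j & b = x * y]]).
apply: (submoduleZ _ (span_submodule _)).
apply: sub_span; exists (lay t), (bx t), (by_ t); split=> //; [exact: bx_in|exact: by_in].
Qed.

Lemma gt_ge_part i j a : (i <= j)%O -> gt_part j a -> ge_part i a.
Proof. by move=> ij ga t it; apply: ga; apply: contra it => /ltW; apply: le_trans. Qed.

(** Descending induction on the layer: by the heredity axioms the product stays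
    in the layer modulo a combination of higher basis elements, which by
    induction generate only higher ones. *)
Lemma bprod_ideal (t : idx) b : ge_part (lay t) (b * bprod t) /\ ge_part (lay t) (bprod t * b).
Proof.
pose up (i : I) := #|[set j | (i < j)%O]%SET|.
have [m] := ubnP (up (lay t)); elim: m => // m IH in t b *; rewrite ltnS => lt_m.
have gtI j c : (lay t < j)%O || (lay t == j) -> forall w, gt_part j w ->
    gt_part j (c * w) /\ gt_part j (w * c).
  move=> tj w gw; rewrite (coA_sum w) mulr_suml mulr_sumr.
  have lt_u (u : idx) : (j < lay u)%O -> (up (lay u) < m)%N.
    move=> ju; have tu : (lay t < lay u)%O.
      by case/orP: tj => [tj|/eqP ->] //; apply: lt_trans ju.
    apply: leq_trans lt_m; apply: proper_card; apply/properP; split.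
      by apply/fintype.subsetP => x; rewrite !inE => ux; apply: lt_trans ux.
    by exists (lay u); rewrite !inE ?ltxx.
  split; apply: (@submodule_sum k A) => [|u _]; try exact: gt_part_submodule.
    have [ju|ju] := boolP (j < lay u)%O; last first.
      by rewrite gw // scale0r mulr0; case: (gt_part_submodule j).
    rewrite -scalerAr; apply: (submoduleZ _ (gt_part_submodule j)).
    move=> v jv; apply: (proj1 (IH u c (lt_u u ju)) v); apply: contra jv; exact: lt_le_trans.
  have [ju|ju] := boolP (j < lay u)%O; last first.
    by rewrite gw // scale0r mul0r; case: (gt_part_submodule j).
  rewrite -scalerAl; apply: (submoduleZ _ (gt_part_submodule j)).
  move=> v jv; apply: (proj2 (IH u c (lt_u u ju)) v); apply: contra jv; exact: lt_le_trans.
split.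
  have [v /span_fset[r vE] /span_gt_part gw] := her_left her (bx_in t) (Logic.I : setT b).
  set w := b * bx t - v in gw.
  have -> : b * bprod t = v * by_ t + w * by_ t by rewrite -mulrDl addrC subrK mulrA.
  apply: (submoduleD (ge_part_submodule (lay t))).
    rewrite vE mulr_suml; apply: (@submodule_sum k A); first exact: ge_part_submodule.
    move=> z _; rewrite -scalerAl; apply: (submoduleZ _ (ge_part_submodule (lay t))).
    move=> u tu; rewrite -[val z * _]/(bprod (mkb (valP z) (by_in t))) coA_bprod.
    by case: eqP => // ue; rewrite ue lexx in tu.
  apply: (@gt_ge_part _ (lay t)); first exact: lexx.
  have tt : (lay t < lay t)%O || (lay t == lay t) by rewrite eqxx orbT.
  exact: (gtI _ _ tt _ gw).2.
have [v /span_fset[r vE] /span_gt_part gw] := her_right her (by_in t) (Logic.I : setT b).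
set w := by_ t * b - v in gw.
have -> : bprod t * b = bx t * v + bx t * w by rewrite -mulrDr addrC subrK mulrA.
apply: (submoduleD (ge_part_submodule (lay t))).
  rewrite vE mulr_sumr; apply: (@submodule_sum k A); first exact: ge_part_submodule.
  move=> z _; rewrite -scalerAr; apply: (submoduleZ _ (ge_part_submodule (lay t))).
  move=> u tu; rewrite -[_ * val z]/(bprod (mkb (bx_in t) (valP z))) coA_bprod.
  by case: eqP => // ue; rewrite ue lexx in tu.
apply: (@gt_ge_part _ (lay t)); first exact: lexx.
have tt : (lay t < lay t)%O || (lay t == lay t) by rewrite eqxx orbT.
exact: (gtI _ _ tt _ gw).1.
Qed.

Lemma coA_bprod_mull (t : idx) b (u : idx) : coA u (b * bprod t) != 0 -> (lay t <= lay u)%O.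
Proof. by apply: contraNT => tu; rewrite (bprod_ideal t b).1. Qed.

Lemma coA_bprod_mulr (t : idx) b (u : idx) : coA u (bprod t * b) != 0 -> (lay t <= lay u)%O.
Proof. by apply: contraNT => tu; rewrite (bprod_ideal t b).2. Qed.

Lemma gt_part_ideal i a b : gt_part i a -> gt_part i (b * a) /\ gt_part i (a * b).
Proof.
move=> ga; rewrite (coA_sum a) mulr_suml mulr_sumr.
split=> t it; rewrite coA_sumE big1 // => u _.
  rewrite -scalerAr coAZ; have [iu|/ga ->] := boolP (i < lay u)%O; last by rewrite mul0r.
  rewrite (bprod_ideal u b).1 ?mulr0 //; apply: contra it; exact: lt_le_trans.
rewrite -scalerAl coAZ; have [iu|/ga ->] := boolP (i < lay u)%O; last by rewrite mul0r.
rewrite (bprod_ideal u b).2 ?mulr0 //; apply: contra it; exact: lt_le_trans.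
Qed.

(** ** The pairing on cells *)

(** The index of [e_i], which is the product of itself in [X i] and itself in
    [Y i]. *)
Definition e0 i : idx := mkb (her_init her i).1 (her_init her i).2.

Lemma eiX i : ei i \in X i. Proof. by have [] := her_init her i. Qed.

Lemma eiK i : ei i * ei i = ei i.
Proof. by have [] := her_idemX her i (eiX i). Qed.

Lemma bprod_e0 i : bprod (e0 i) = ei i. Proof. exact: eiK. Qed.

(** For [s = 1] this is the form [f_i(y, x)]; in general it is [f_i(y, s x)],
    where [s] acts on the cell module. *)
Definition beta i (y s x : A) : k := coA (e0 i) (y * s * x).

Lemma betaE i y s x : beta i y s x = coA (e0 i) (y * s * x). Proof. by []. Qed.

(** The element [y * s * x] is fixed by [e_i] on both sides. So are the basis
    elements occurring in it, and the only such element of layer [i] is [e_i]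
    itself. *)
Lemma beta_corner i x y s : x \in X i -> y \in Y i ->
  gt_part i (y * s * x - beta i y s x *: ei i).
Proof.
move=> Xx Yy; set u := y * s * x.
have uE : u = ei i * u * ei i.
  have [yE _ _] := her_idemY her i Yy; have [xE _ _] := her_idemX her i Xx.
  by rewrite /u !mulrA yE -!mulrA xE.
have cu t : coA t u != 0 -> ei i * bx t = bx t /\ by_ t * ei i = by_ t.
  move=> ct; have split (t' : idx) : ei i * bprod t' * ei i = 0 \/ (ei i * bprod t' * ei i = bprod t' /\
      (ei i * bx t' = bx t' /\ by_ t' * ei i = by_ t')).
    have [_ _ [xE|xE]] := her_idemX her i (bx_in t'); last by left; rewrite mulrA xE !mul0r.
    have [_ _ [yE|yE]] := her_idemY her i (by_in t'); last first.
      by left; rewrite -!mulrA yE !mulr0.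
    by right; split; rewrite // mulrA xE -mulrA yE.
  have := ct; rewrite uE (coA_sum u) mulr_sumr mulr_suml coA_sumE => nz.
  apply: contrapT => no; move: nz; rewrite big1 ?eqxx // => t' _.
  rewrite -scalerAr -scalerAl coAZ; case: (split t') => [->|[-> t'E]]; first by rewrite linear0 mulr0.
  rewrite coA_bprod; case: eqP => [tt'|]; last by rewrite mulr0.
  by case: no; rewrite tt'.
move=> t it; rewrite linearB linearZ /= -bprod_e0 coA_bprod.
have [->|te] := eqVneq t (e0 i); first by rewrite /beta -/u /GRing.scale /= mulr1 subrr.
rewrite scaler0 subr0; apply: contrapT => /eqP /cu [xE yE].
have it' : (i <= lay t)%O.
  rewrite -[i]/(lay (e0 i)); apply: (@coA_bprod_mulr _ (bprod t)).
  by rewrite bprod_e0 mulrA xE coA_bprod eqxx oner_eq0.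
have {it it'} ti : lay t = i.
  by apply/eqP; rewrite eq_sym; apply: contraNT it => ne; rewrite lt_neqAle ne.
case/eqP: te; apply: bidx_eq => //.
  have [_ + _] := her_idemX her (lay t) (bx_in t); rewrite ti xE.
  case: eqP => // _ b0; have := coA_bprod t t; rewrite eqxx /bprod b0 mul0r linear0.
  by move/eqP; rewrite eq_sym oner_eq0.
have [_ + _] := her_idemY her (lay t) (by_in t); rewrite ti yE.
case: eqP => // _ b0; have := coA_bprod t t; rewrite eqxx /bprod b0 mulr0 linear0.
by move/eqP; rewrite eq_sym oner_eq0.
Qed.

Lemma coA_e0_gt i a : gt_part i a -> coA (e0 i) a = 0.
Proof. by apply; rewrite ltxx. Qed.

(** Reduce the middle factor [y * s * x'] by [beta_corner]. *)
Lemma cell_product i (x y x' y' s : A) : x \in X i -> y \in Y i -> x' \in X i -> y' \in Y i ->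
  gt_part i (x * y * s * (x' * y') - beta i y s x' *: (x * y')).
Proof.
move=> Xx Yy Xx' Yy'; have g := beta_corner s Xx' Yy.
have := (gt_part_ideal y' (gt_part_ideal x g).1).2.
rewrite mulrBr mulrBl -scalerAr -scalerAl.
have [-> _ _] := her_idemX her i Xx.
by rewrite !mulrA.
Qed.

Lemma beta_left i x s : x \in X i -> exists r : X i -> k, forall y t, y \in Y i ->
  beta i y (t * s) x = \sum_(z : X i) r z * beta i y t (val z).
Proof.
move=> Xx; have [v /span_fset[r vE] /span_gt_part gw] := her_left her Xx (Logic.I : setT s).
exists r => y t Yy; rewrite /beta mulrA -[_ * s * x]mulrA -[s * x](subrK v) mulrDr linearD /=.
rewrite (coA_e0_gt (gt_part_ideal _ gw).1) add0r vE mulr_sumr coA_sumE.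
by apply: eq_bigr => z _; rewrite -scalerAr coAZ.
Qed.

Lemma beta_right i y s : y \in Y i -> exists r : Y i -> k, forall x t, x \in X i ->
  beta i y (s * t) x = \sum_(z : Y i) r z * beta i (val z) t x.
Proof.
move=> Yy; have [v /span_fset[r vE] /span_gt_part gw] := her_right her Yy (Logic.I : setT s).
exists r => x t Xx; rewrite /beta mulrA -[y * s](subrK v) -mulrA mulrDl linearD /=.
rewrite (coA_e0_gt (gt_part_ideal _ gw).2) add0r vE mulr_suml coA_sumE.
by apply: eq_bigr => z _; rewrite -scalerAl coAZ mulrA.
Qed.

Lemma beta_cell i (x y y' x' s : A) : x \in X i -> y \in Y i -> x' \in X i -> y' \in Y i ->
  beta i y' (x * y * s) x' = beta i y' 1 x * beta i y s x'.
Proof.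
move=> Xx Yy Xx' Yy'; have g := beta_corner 1 Xx Yy'.
rewrite /beta -!mulrA !mulrA; rewrite -[y' * x](subrK (beta i y' 1 x *: ei i)).
rewrite -!mulrA mulrDl coAD coA_e0_gt ?add0r; last first.
  by rewrite mulr1 in g; exact: (gt_part_ideal _ g).2.
rewrite -scalerAl coAZ; have [yE _ _] := her_idemY her i Yy.
by rewrite !mulrA yE.
Qed.

(** Multiplication only leads up in the order, and [e_i] lies in layer [i]. *)
Lemma beta_layer i y x (t : idx) : beta i y (bprod t) x != 0 -> (lay t <= i)%O.
Proof.
rewrite /beta; apply: contraNT => ti; rewrite (coA_sum (y * bprod t)) mulr_suml coA_sumE.
rewrite big1 // => u _; rewrite -scalerAl coAZ.
have [->|yu] := eqVneq (coA u (y * bprod t)) 0; first by rewrite mul0r.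
have [->|ux] := eqVneq (coA (e0 i) (bprod u * x)) 0; first by rewrite mulr0.
by case/negP: ti; apply: le_trans (coA_bprod_mull yu) (coA_bprod_mulr ux).
Qed.

End HeredityTheory.

(** * Degrees and the corner algebra *)

Section Homogeneity.
Variables (k : idomainType) (A : algType k) (gr : int -> bool -> set A).
Hypothesis A_super : graded_superalgebra gr.
Variables (disp : Order.disp_t) (I : finPOrderType disp).
Variables (X Y : I -> {fset A}) (ei : I -> A).
Hypothesis her : heredity_data gr setT X Y ei.
Local Notation idx := (bidx X Y).
Local Notation coA := (coA her).

Definition degA (a : A) : int * bool :=
  if pselect (exists p : int * bool, gr p.1 p.2 a) is left h then projT1 (cid h)
  else (0, false).

Lemma degAP a : homogeneous gr a -> gr (degA a).1 (degA a).2 a.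
Proof.
move=> [m [eps ga]]; rewrite /degA; case: pselect => [h|[]]; first by case: cid.
by exists (m, eps).
Qed.

Definition deg (t : idx) : int * bool :=
  ((degA (bx t)).1 + (degA (by_ t)).1, (degA (bx t)).2 (+) (degA (by_ t)).2).

Lemma gr_bx (t : idx) : gr (degA (bx t)).1 (degA (bx t)).2 (bx t).
Proof. by apply: degAP; have [] := her_X her (bx_in t). Qed.

Lemma gr_by (t : idx) : gr (degA (by_ t)).1 (degA (by_ t)).2 (by_ t).
Proof. by apply: degAP; have [] := her_Y her (by_in t). Qed.

Lemma gr_bprod t : gr (deg t).1 (deg t).2 (bprod t).
Proof. by apply: A_super.2; [apply: gr_bx|apply: gr_by]. Qed.

(** Sorting the expansion of [a] by degrees gives its homogeneous components,
    which are unique. *)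
Lemma coA_deg m eps a t : gr m eps a -> coA t a != 0 -> deg t = (m, eps).
Proof.
have [[gr_sub _ gr_free] _] := A_super.
move=> ga; apply: contraNeq => t_deg.
pose s := undup ((m, eps) :: [seq deg t | t <- enum idx]).
pose part D := \sum_(u | deg u == D) coA u a *: bprod u.
pose w D := part D - (if D == (m, eps) then a else 0).
have deg_s u : deg u \in s.
  by rewrite mem_undup inE map_f ?orbT // mem_enum.
have one_s D : D \in s -> count (fun D' => D == D') s = 1%N.
  move=> Ds; rewrite (eq_count (a2 := pred1 D)) => [|D' /=]; last by rewrite eq_sym.
  by rewrite count_uniq_mem ?undup_uniq // Ds.
have w0 : \sum_(D <- s) w D = 0.
  rewrite sumrB (exchange_big_dep predT) //= -big_mkcond /=.
  under eq_bigr do rewrite big_const_seq iter_addr_0 one_s ?deg_s // mulr1n.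
  rewrite big_const_seq iter_addr_0 (eq_count (a2 := fun D => (m, eps) == D)) => [|D].
    by rewrite one_s ?mulr1n -?coA_sum ?subrr // mem_undup mem_head.
  by rewrite /= eq_sym.
have w_gr D : gr D.1 D.2 (w D).
  apply: submoduleB; first exact: gr_sub.
    apply: submodule_sum => [|u /eqP <-]; first exact: gr_sub.
    by apply: submoduleZ; [apply: gr_sub|apply: gr_bprod].
  by case: eqP => [->|_] //; case: (gr_sub D.1 D.2).
have := gr_free s w (undup_uniq _) (fun D _ => w_gr D) w0 _ (deg_s t).
rewrite /w (negPf t_deg) subr0 => /(congr1 (coA t)).
rewrite coA0 coA_sumE (bigD1 t) //= coAZ coA_bprod eqxx mulr1 big1 ?addr0 => [->//|u].
by case/andP=> _ ut; rewrite coAZ coA_bprod eq_sym (negPf ut) mulr0.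
Qed.

Lemma coA_parity eps a t : parity_part gr eps a -> coA t a != 0 -> (deg t).2 = eps.
Proof.
move=> [s [s_gr ->]]; apply: contraNeq => t_eps; rewrite coA_sumE big_seq big1 // => x xs.
have [m gx] := s_gr x xs; apply: contrapT => /eqP xt.
by case/eqP: t_eps; rewrite (coA_deg gx xt).
Qed.

Lemma coA_neq0 a : a != 0 -> exists t, coA t a != 0.
Proof.
move=> a0; apply: contrapT => no; case/eqP: a0; rewrite (coA_sum her a) big1 // => t _.
by case: (eqVneq (coA t a) 0) => [->|ct]; [rewrite scale0r | case: no; exists t].
Qed.

Lemma parity_part_hom m eps a : gr m eps a -> parity_part gr eps a.
Proof.
move=> ga; exists [:: a]; rewrite big_seq1; split=> // x; rewrite inE => /eqP ->.
by exists m.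
Qed.

Lemma parity_part_neq0 m eps eps' a : gr m eps a -> a != 0 ->
  `[< parity_part gr eps' a >] = (eps' == eps).
Proof.
move=> ga a0; apply/asboolP/eqP => [pa|->]; last exact: parity_part_hom ga.
have [t ct] := coA_neq0 a0; rewrite -(coA_parity pa ct).
by rewrite (coA_parity (parity_part_hom ga) ct).
Qed.

Lemma bprod_neq0 (t : idx) : bprod t != 0.
Proof.
by apply/eqP => b0; have /eqP := coA_bprod her t t; rewrite b0 coA0 eqxx eq_sym oner_eq0.
Qed.

Lemma bx_neq0 (t : idx) : bx t != 0.
Proof. by apply: contraNneq (bprod_neq0 t); rewrite /bprod => ->; rewrite mul0r. Qed.

Lemma by_neq0 (t : idx) : by_ t != 0.
Proof. by apply: contraNneq (bprod_neq0 t); rewrite /bprod => ->; rewrite mulr0. Qed.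

Lemma is_odd_bprod (t : idx) : is_odd gr (bprod t) = (deg t).2.
Proof. by rewrite /is_odd (parity_part_neq0 _ (gr_bprod t) (bprod_neq0 t)); case: (deg t).2. Qed.

Lemma is_even_bprod (t : idx) : is_even gr (bprod t) = ~~ (deg t).2.
Proof. by rewrite /is_even (parity_part_neq0 _ (gr_bprod t) (bprod_neq0 t)); case: (deg t).2. Qed.

Lemma is_odd_bx (t : idx) : is_odd gr (bx t) = (degA (bx t)).2.
Proof. by rewrite /is_odd (parity_part_neq0 _ (gr_bx t) (bx_neq0 t)); case: (_.2). Qed.

Lemma is_even_bx (t : idx) : is_even gr (bx t) = ~~ (degA (bx t)).2.
Proof. by rewrite /is_even (parity_part_neq0 _ (gr_bx t) (bx_neq0 t)); case: (_.2). Qed.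

Lemma is_odd_by (t : idx) : is_odd gr (by_ t) = (degA (by_ t)).2.
Proof. by rewrite /is_odd (parity_part_neq0 _ (gr_by t) (by_neq0 t)); case: (_.2). Qed.

Lemma is_even_by (t : idx) : is_even gr (by_ t) = ~~ (degA (by_ t)).2.
Proof. by rewrite /is_even (parity_part_neq0 _ (gr_by t) (by_neq0 t)); case: (_.2). Qed.

Lemma coA_deg_mul t u v : coA v (bprod t * bprod u) != 0 ->
  deg v = ((deg t).1 + (deg u).1, (deg t).2 (+) (deg u).2).
Proof. by apply: coA_deg; apply: A_super.2; apply: gr_bprod. Qed.

(** The even basis elements are of two kinds: the products of two even factors,
    which span the subalgebra [aa], and the products of two odd factors, whose
    multiplicities enter the factorials of the elements eta. *)
Definition even_even (t : idx) := ~~ (degA (bx t)).2 && ~~ (degA (by_ t)).2.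
Definition odd_odd (t : idx) := (degA (bx t)).2 && (degA (by_ t)).2.

(** Expansions of elements of [aa] only involve products of two even factors. *)
Lemma coA_even_even aa : conforming gr aa X Y ei ->
  forall t u v, even_even t -> even_even u -> coA v (bprod t * bprod u) != 0 -> even_even v.
Proof.
move=> [[_ aa_mul] aa_even aa_her] t u v.
have in_aa w : even_even w -> aa (bprod w).
  move=> /andP[ex ey].
  have Ex : bx w \in even_fset gr X (lay w) by rewrite !inE /= bx_in is_even_bx.
  have Ey : by_ w \in even_fset gr Y (lay w) by rewrite !inE /= by_in is_even_by.
  by apply: aa_mul; [have [] := her_X aa_her Ex | have [] := her_Y aa_her Ey].
move=> et eu; have [c cE] := her_basis_gen aa_her (aa_mul _ _ (in_aa _ et) (in_aa _ eu)).
pose c' i x y := if is_even gr x && is_even gr y then c i x y else 0.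
have -> : coA v (bprod t * bprod u) = c' (lay v) (bx v) (by_ v).
  apply: (@coA_unique _ _ _ _ _ _ _ _ her (fun w => c' (lay w) (bx w) (by_ w))); rewrite cE -lincombE.
  apply: eq_bigr => i _; rewrite -big_fset_condE big_mkcond; apply: eq_bigr => x _.
  rewrite -big_fset_condE big_mkcond; case: ifP => ex.
    by apply: eq_bigr => y _; rewrite /c' ex; case: ifP => //; rewrite scale0r.
  by rewrite big1 // => y _; rewrite /c' ex scale0r.
by rewrite /c' is_even_bx is_even_by /even_even; case: ifP => //; rewrite eqxx.
Qed.

(** ** The corner cut out by an adapted idempotent *)
Variables (e : A) (Xb Yb : I -> {fset A}).
Hypothesis e_adapted : adapted gr X Y e Xb Yb.

Definition inb (t : idx) : bool := (bx t \in Xb (lay t)) && (by_ t \in Yb (lay t)).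

Lemma corner_bprod t : e * bprod t * e = if inb t then bprod t else 0.
Proof.
have [_ _ _ eX eY] := e_adapted.
rewrite /bprod mulrA -mulrA (eX _ _ (bx_in t)) (eY _ _ (by_in t)) /inb.
by do 2!case: ifP => //; rewrite ?mulr0 ?mul0r.
Qed.

Lemma cornerP a : corner e a <-> e * a * e = a.
Proof.
have [_ ee _ _ _] := e_adapted; split=> [[b _ <-]|<-]; last by exists a.
by rewrite !mulrA ee -!mulrA ee.
Qed.

Lemma corner_coA a t : corner e a -> coA t a != 0 -> inb t.
Proof.
move=> /cornerP ae; apply: contraNT => tb; rewrite -ae (coA_sum her a) mulr_sumr mulr_suml.
rewrite coA_sumE big1 // => u _; rewrite -scalerAr -scalerAl coAZ corner_bprod.
case: ifP => ub; last by rewrite coA0 mulr0.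
by rewrite coA_bprod; case: eqP tb => [->|]; rewrite ?ub // mulr0.
Qed.

Lemma bprod_corner t : inb t -> corner e (bprod t).
Proof. by move=> tb; apply/cornerP; rewrite corner_bprod tb. Qed.

Lemma corner_submodule : submodule (corner e).
Proof.
split; first by apply/cornerP; rewrite mulr0 mul0r.
move=> c x y /cornerP xe /cornerP ye; apply/cornerP.
by rewrite mulrDr mulrDl -scalerAr -scalerAl xe ye.
Qed.

Lemma corner_mul a b : corner e a -> corner e b -> corner e (a * b).
Proof.
have [_ ee _ _ _] := e_adapted.
move=> /cornerP ae /cornerP be; apply/cornerP.
by rewrite -{1}ae -{1}be !mulrA ee -{2}be -{2}ae -!mulrA ee.
Qed.

Lemma corner_e : corner e e.
Proof. by have [_ ee _ _ _] := e_adapted; apply/cornerP; rewrite !ee. Qed.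

Definition cidx : finType := {t : idx | inb t}.

Lemma corner_sum a : corner e a -> a = \sum_(t : cidx) coA (val t) a *: bprod (val t).
Proof.
move=> ea; rewrite {1}(coA_sum her a) (bigID inb) /= [X in _ + X]big1 ?addr0 => [|t tb].
  rewrite (reindex_omap (val : cidx -> idx) insub) => [|t tb]; last by rewrite insubT.
  by apply: eq_bigl => t; rewrite (valP t) valK eqxx.
have [->|ct] := eqVneq (coA t a) 0; first by rewrite scale0r.
by rewrite (corner_coA ea ct) in tb.
Qed.

Lemma bprod_cidx (t : cidx) : corner e (bprod (val t)).
Proof. exact/bprod_corner/valP. Qed.

End Homogeneity.

(** * The simple modules of the extended heredity algebra *)

Section ExtendedAlgebra.
Variables (k : idomainType) (A : algType k) (gr : int -> bool -> set A).
Hypothesis A_super : graded_superalgebra gr.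
Variables (disp : Order.disp_t) (I : finPOrderType disp).
Variables (X Y : I -> {fset A}) (ei : I -> A).
Hypothesis her : heredity_data gr setT X Y ei.
Variables (F : fieldType) (phi : {rmorphism k -> F}) (AF : algType F) (iotaA : A -> AF).
Hypothesis AF_ext : is_algebra_base_change phi setT iotaA.
Local Notation idx := (bidx X Y).
Local Notation beta := (beta her).

Let setT_sub : submodule (setT : set A). Proof. by []. Qed.
Let iotaM a b : iotaA (a * b) = iotaA a * iotaA b. Proof. exact: AF_ext.2. Qed.
Let semi : semilinear_on phi setT iotaA. Proof. by case: AF_ext => -[]. Qed.

Let coF_ex : exists co' : idx -> AF -> F,
  [/\ forall j c x y, co' j (c *: x + y) = c * co' j x + co' j y,
      forall j x, setT x -> co' j (iotaA x) = phi (coA her j x) &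
      forall w, w = \sum_j co' j w *: iotaA (bprod j)].
Proof.
apply: (free_base_change setT_sub semi AF_ext.1) => // [x _|j c x y _ _].
  exact: coA_sum.
by rewrite coAD coAZ.
Qed.

Let coF := projT1 (cid coF_ex).
Let coF_lin j c x y : coF j (c *: x + y) = c * coF j x + coF j y.
Proof. by rewrite /coF; case: cid => ? []. Qed.
Let coF_iota j x : coF j (iotaA x) = phi (coA her j x).
Proof. by rewrite /coF; case: cid => ? [? + ?] /=; apply. Qed.
Let coF_sum w : w = \sum_j coF j w *: iotaA (bprod j).
Proof. by rewrite /coF; case: cid => ? [? ?] /=; apply. Qed.

Let coF0 j : coF j 0 = 0.
Proof. exact: (form0 (coF_lin j)). Qed.
Let coFD j x y : coF j (x + y) = coF j x + coF j y.
Proof. exact: (formD (coF_lin j)). Qed.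
Let coFZ j c x : coF j (c *: x) = c * coF j x.
Proof. exact: (formZ (coF_lin j)). Qed.

(** The pairing [beta], extended to scalars in [F]. *)
Let g i y x (s : AF) : F := coF (e0 her i) (iotaA y * s * iotaA x).

Let g_iota i y x s : g i y x (iotaA s) = phi (beta i y s x).
Proof. by rewrite /g -!iotaM coF_iota. Qed.

Let gZ i y x c s : g i y x (c *: s) = c * g i y x s.
Proof. by rewrite /g -scalerAr -scalerAl coFZ. Qed.

Let gD i y x s t : g i y x (s + t) = g i y x s + g i y x t.
Proof. by rewrite /g mulrDr mulrDl coFD. Qed.

Let g0 i y x : g i y x 0 = 0.
Proof. by rewrite /g mulr0 mul0r coF0. Qed.

Let g_sumE i y x (J : Type) (r : seq J) (P : pred J) (f : J -> AF) :
  g i y x (\sum_(u <- r | P u) f u) = \sum_(u <- r | P u) g i y x (f u).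
Proof. exact: (big_morph (g i y x) (gD i y x) (g0 i y x)). Qed.

Let g_cell i x y y' x' s : x \in X i -> y \in Y i -> x' \in X i -> y' \in Y i ->
  g i y' x' (iotaA (x * y) * s) = phi (beta i y' 1 x) * g i y x' s.
Proof.
move=> Xx Yy Xx' Yy'; rewrite (coF_sum s) mulr_sumr !g_sumE mulr_sumr.
apply: eq_bigr => t _; rewrite -scalerAr !gZ -iotaM !g_iota beta_cell // rmorphM.
by rewrite mulrCA.
Qed.

Let g_right i y b : y \in Y i -> exists r : Y i -> F, forall x s, x \in X i ->
  g i y x (b * s) = \sum_(z : Y i) r z * g i (val z) x s.
Proof.
move=> Yy; have r_ex (t : idx) : exists r : Y i -> k, forall x s, x \in X i ->
    beta i y (bprod t * s) x = \sum_(z : Y i) r z * beta i (val z) s x.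
  by have [r rE] := beta_right her (bprod t) Yy; exists r => x s; apply: rE.
pose r t := projT1 (cid (r_ex t)).
have rE (t : idx) x s : x \in X i -> beta i y (bprod t * s) x = \sum_(z : Y i) r t z * beta i (val z) s x.
  by rewrite /r; case: cid => ? /=; apply.
exists (fun z => \sum_t coF t b * phi (r t z)) => x s Xx.
rewrite {1}(coF_sum b) mulr_suml g_sumE; under [RHS]eq_bigr do rewrite mulr_suml.
rewrite [RHS]exchange_big; apply: eq_bigr => t _ /=.
rewrite -scalerAl gZ; under [RHS]eq_bigr do rewrite -mulrA.
rewrite -mulr_sumr; congr (_ * _).
rewrite (coF_sum s) mulr_sumr g_sumE; under [RHS]eq_bigr do rewrite g_sumE mulr_sumr.
rewrite [RHS]exchange_big; apply: eq_bigr => u _ /=.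
rewrite -scalerAr gZ -iotaM g_iota rE // rmorph_sum mulr_sumr; apply: eq_bigr => z _.
by rewrite gZ g_iota rmorphM mulrCA.
Qed.

(** [K] is the annihilator of the image of [v_x] in [L(i)]. For [s] outside [K]
    some [g i y x s] is invertible, and then a multiple of [x * y * s] is
    congruent to [1] modulo [K]. *)
Let annihilator_maximal i x : x \in X i ->
  let K := [set s : AF | forall y, y \in Y i -> g i y x s = 0] in
  ~ K 1 -> maximal_left_ideal K.
Proof.
move=> Xx K K1; split=> //.
  split; first split=> [y _|c s t Ks Kt y Yy]; first exact: g0.
    by rewrite gD gZ Ks // Kt // mulr0 addr0.
  move=> a s Ks y Yy; have [r ->] := g_right a Yy; last by [].
  by rewrite big1 // => z _; rewrite Ks ?mulr0 //; apply: valP.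
move=> K' [K'sub K'mul] KK' K'1 s K's y Yy; apply: contrapT => /eqP gs; apply: K'1.
rewrite -[1](subrK ((g i y x s)^-1 *: (iotaA (x * y) * s))).
apply: (submoduleD K'sub); last by apply: submoduleZ => //; apply: K'mul.
apply: KK' => y' Yy'; rewrite gD -scaleN1r !gZ g_cell //.
rewrite mulN1r [_^-1 * _]mulrCA mulVf // mulr1 -g_iota.
suff -> : g i y' x (iotaA 1) = g i y' x 1 by rewrite subrr.
by rewrite /g -[iotaA y' * iotaA 1]iotaM mulr1 mulr1.
Qed.

(** Odd elements lie in the Jacobson radical, hence in the annihilators of the
    generators of the simple modules. *)
Lemma odd_beta_eq0 i x y m a :
  parity_part (gr_ext gr setT iotaA) true `<=` @jacobson F AF ->
  gr m true a -> x \in X i -> y \in Y i -> phi (beta i y a x) = 0.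
Proof.
move=> odd_rad ga Xx Yy; rewrite -g_iota.
have aJ : @jacobson F AF (iotaA a).
  apply: odd_rad; exists [:: iotaA a]; rewrite big_seq1; split=> // z.
  by rewrite inE => /eqP ->; exists m; apply: sub_span; exists a.
pose K := [set s : AF | forall y, y \in Y i -> g i y x s = 0].
have [K1|K1] := pselect (K 1); last exact: aJ K (annihilator_maximal Xx K1) y Yy.
have [r rE] := g_right (iotaA a) Yy; rewrite -[iotaA a]mulr1 rE // big1 // => z _.
by rewrite K1 ?mulr0 //; apply: valP.
Qed.

Variables (e : A) (Xb Yb : I -> {fset A}).
Hypothesis e_adapted : adapted gr X Y e Xb Yb.

(** If the form vanished on the corner, every vector of [e Delta(i)] would be
    orthogonal to [Y i], and [e L(i)] would be zero. *)
Lemma Ibar_beta i : i \in Ibar phi iotaA X Y ei e ->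
  exists x y, [/\ x \in Xb i, y \in Yb i & phi (beta i y 1 x) != 0].
Proof.
have [_ ee eS eX eY] := e_adapted.
rewrite inE => /asboolP[v [[a va] nrad]]; apply: contrapT => no; apply: nrad.
have G0 x y : x \in Xb i -> y \in Yb i -> phi (beta i y 1 x) = 0.
  by move=> xb yb; apply: contrapT => /eqP nz; apply: no; exists x, y.
have eix := eiX her i.
(* An element of [Delta(i)] is [a * e_i]; expand [e * a * e_i] in [X i]. *)
have r_ex (t : idx) : exists2 w, span [set` X i] w & span_gt X Y i (e * bprod t * ei i - w).
  by have [w sw gw] := her_left her eix (Logic.I : setT (e * bprod t)); exists w.
have r_ex' (t : idx) : exists r : X i -> k, span_gt X Y i (e * bprod t * ei i - \sum_z r z *: val z).
  by have [w /span_fset[r ->] gw] := r_ex t; exists r.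
pose r t := projT1 (cid (r_ex' t)).
have rE (t : idx) : span_gt X Y i (e * bprod t * ei i - \sum_z r t z *: val z).
  by rewrite /r; case: cid.
pose c (x : A) : F := if insub x is Some z then \sum_t coF t a * phi (r t z) else 0.
have cE (z : X i) : c (val z) = \sum_t coF t a * phi (r t z) by rewrite /c valK.
have sg_sub : submodule (span_gt_ext iotaA X Y i) by exact: span_submodule.
have gt_ext w : span_gt X Y i w -> span_gt_ext iotaA X Y i (iotaA w).
  by move=> gw; apply: sub_span; exists w.
have ext_e w : span_gt_ext iotaA X Y i w -> span_gt_ext iotaA X Y i (iotaA e * w).
  have Q_sub : submodule [set w | span_gt_ext iotaA X Y i (iotaA e * w)].
    split; first by rewrite /= mulr0; have [] := sg_sub.
    move=> c' w1 w2 /= gw1 gw2; rewrite mulrDr -scalerAr.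
    by apply: (submoduleD sg_sub) => //; apply: submoduleZ.
  apply: (submodule_sub_span Q_sub) => _ [w1 gw1 <-] /=; rewrite -iotaM; apply: gt_ext.
  have /(span_gt_part her)/(gt_part_ideal e)[g1 _] := gw1.
  exact/(span_gt_part her).
exists c; split.
  rewrite -[v](subrK (a * iotaA (ei i))) mulrDr -addrA.
  apply: (submoduleD sg_sub); first exact: ext_e.
  have -> : iotaA e * (a * iotaA (ei i)) = \sum_t coF t a *: iotaA (e * bprod t * ei i).
    rewrite {1}(coF_sum a) mulr_suml mulr_sumr; apply: eq_bigr => t _.
    by rewrite -scalerAl -scalerAr mulrA !iotaM.
  have -> : \sum_(x <- X i) c x *: iotaA x
      = \sum_t coF t a *: iotaA (\sum_z r t z *: val z).
    rewrite big_seq_fsetE /=; under eq_bigr do rewrite cE scaler_suml.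
    rewrite exchange_big; apply: eq_bigr => t _ /=.
    rewrite (semilinear_lincomb setT_sub semi) // scaler_sumr.
    by apply: eq_bigr => z _; rewrite scalerA.
  rewrite -sumrB; apply: submodule_sum => [//|t _]; rewrite -scalerBr; apply: submoduleZ => //.
  suff -> : iotaA (e * bprod t * ei i) - iotaA (\sum_z r t z *: val z)
      = iotaA (e * bprod t * ei i - \sum_z r t z *: val z) by apply: gt_ext.
  rewrite -[in RHS]scaleN1r [in RHS]addrC semi // rmorphN rmorph1 scaleN1r addrC //.
move=> y Yy; exists (fun x => beta i y 1 x); split=> [x Xx|].
  by apply/(span_gt_part her); have := beta_corner her 1 Xx Yy; rewrite mulr1.
rewrite big_seq_fsetE /=; under eq_bigr do rewrite cE mulr_suml.
rewrite exchange_big big1 // => t _ /=.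
under eq_bigr do rewrite -mulrA -rmorphM.
rewrite -mulr_sumr -rmorph_sum.
have -> : \sum_z r t z * beta i y 1 (val z) = beta i y (e * bprod t) (ei i).
  have := rE t; move=> /(span_gt_part her)/(gt_part_ideal y)[+ _].
  move=> /(coA_e0_gt)/eqP; rewrite mulrBr coAB subr_eq0 mulrA => /eqP.
  rewrite -[y * (_ * _) * _]mulrA mulrA !betaE => ->.
  rewrite mulr_sumr coA_sumE; apply: eq_bigr => z _.
  by rewrite -scalerAr coAZ !betaE mulr1.
have [yb|yb] := boolP (y \in Yb i); last first.
  by rewrite !betaE mulrA (eY _ _ Yy) (negPf yb) !mul0r coA0 rmorph0 mulr0.
have [r' ->] := beta_left her (bprod t) eix; last by [].
rewrite rmorph_sum big1 ?mulr0 // => z _; rewrite rmorphM.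
have ze : e * val z = if val z \in Xb i then val z else 0 := eX _ _ (valP z).
rewrite !betaE -mulrA ze; case: ifP => zb; last by rewrite mulr0 coA0 rmorph0 mulr0.
by have := G0 _ _ zb yb; rewrite !betaE mulr1 => ->; rewrite mulr0.
Qed.

End ExtendedAlgebra.

(** * The corner algebra over a field *)

Section CornerAlgebra.
Variables (k : idomainType) (A : algType k) (gr : int -> bool -> set A).
Hypothesis A_super : graded_superalgebra gr.
Variables (disp : Order.disp_t) (I : finPOrderType disp).
Variables (X Y : I -> {fset A}) (ei : I -> A).
Hypothesis her : heredity_data gr setT X Y ei.
Variables (e : A) (Xb Yb : I -> {fset A}).
Hypothesis e_adapted : adapted gr X Y e Xb Yb.
Variables (F : fieldType) (phi : {rmorphism k -> F}) (C : algType F) (iota : A -> C).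
Hypothesis C_ext : is_algebra_base_change phi (corner e) iota.
Local Notation beta := (beta her).
Local Notation cidx := (cidx X Y Xb Yb).

Let S_sub : submodule (corner e) := corner_submodule e_adapted.
Let semi : semilinear_on phi (corner e) iota. Proof. by case: C_ext => -[]. Qed.

Lemma iotaM_corner a b : corner e a -> corner e b -> iota (a * b) = iota a * iota b.
Proof. exact: C_ext.2. Qed.

Definition bC (t : cidx) : C := iota (bprod (val t)).

Lemma cd_exists : exists co' : cidx -> C -> F,
  [/\ forall j c x y, co' j (c *: x + y) = c * co' j x + co' j y,
      forall j x, corner e x -> co' j (iota x) = phi (coA her (val j) x) &
      forall w, w = \sum_j co' j w *: bC j].
Proof.
apply: (free_base_change S_sub semi C_ext.1) => [t|x|j c x y _ _].
- exact: (bprod_cidx e_adapted).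
- exact: corner_sum.
- by rewrite coAD coAZ.
Qed.

Definition cd := projT1 (cid cd_exists).
Lemma cd_lin j c x y : cd j (c *: x + y) = c * cd j x + cd j y.
Proof. by rewrite /cd; case: cid => ? []. Qed.
Lemma cd_iota j x : corner e x -> cd j (iota x) = phi (coA her (val j) x).
Proof. by rewrite /cd; case: cid => ? [? + ?] /=; apply. Qed.
Lemma cd_sum w : w = \sum_j cd j w *: bC j.
Proof. by rewrite /cd; case: cid => ? [? ?] /=; apply. Qed.

Lemma cd0 j : cd j 0 = 0.
Proof. exact: (form0 (cd_lin j)). Qed.
Lemma cdD j x y : cd j (x + y) = cd j x + cd j y.
Proof. exact: (formD (cd_lin j)). Qed.
Lemma cdZ j c x : cd j (c *: x) = c * cd j x.
Proof. exact: (formZ (cd_lin j)). Qed.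
Lemma cd_sumE j (J : Type) (r : seq J) (P : pred J) (f : J -> C) :
  cd j (\sum_(u <- r | P u) f u) = \sum_(u <- r | P u) cd j (f u).
Proof. exact: (form_sum (cd_lin j)). Qed.

Lemma cd_bC t u : cd t (bC u) = (t == u)%:R.
Proof.
rewrite /bC cd_iota ?coA_bprod ?rmorph_nat //; exact: (bprod_cidx e_adapted).
Qed.

Lemma iota_e : iota e = 1.
Proof.
rewrite -[LHS]mulr1 [in LHS](cd_sum 1) [RHS]cd_sum mulr_sumr; apply: eq_bigr => t _.
rewrite -scalerAr -iotaM_corner; [|exact: (corner_e e_adapted)|exact: (bprod_cidx e_adapted)].
congr (_ *: iota _); have [_ ee _ _ _] := e_adapted.
by have /(cornerP e_adapted) <- := bprod_cidx e_adapted t; rewrite !mulrA ee.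
Qed.

(** ** The Gram matrices of the cells *)

(** The form [beta] on the corner, extended to scalars in [F]. *)
Definition Hf i y x (c : C) : F := \sum_t cd t c * phi (beta i y (bprod (val t)) x).

Lemma Hf_lin i y x c a b : Hf i y x (c *: a + b) = c * Hf i y x a + Hf i y x b.
Proof.
rewrite /Hf mulr_sumr -big_split; apply: eq_bigr => t _ /=.
by rewrite cd_lin mulrDl mulrA.
Qed.
Lemma HfZ i y x c a : Hf i y x (c *: a) = c * Hf i y x a.
Proof. exact: (formZ (Hf_lin i y x)). Qed.
Lemma Hf_sumE i y x (J : Type) (r : seq J) (P : pred J) (f : J -> C) :
  Hf i y x (\sum_(u <- r | P u) f u) = \sum_(u <- r | P u) Hf i y x (f u).
Proof. exact: (form_sum (Hf_lin i y x)). Qed.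

Lemma Hf_bC i y x t : Hf i y x (bC t) = phi (beta i y (bprod (val t)) x).
Proof.
rewrite /Hf (bigD1 t) //= cd_bC eqxx mul1r big1 ?addr0 // => u ut.
by rewrite cd_bC (negPf ut) mul0r.
Qed.

Lemma Hf_iota i y x s : corner e s -> Hf i y x (iota s) = phi (beta i y s x).
Proof.
move=> cs; rewrite {2}(corner_sum her e_adapted cs) betaE mulr_sumr mulr_suml coA_sumE rmorph_sum.
by apply: eq_bigr => t _; rewrite cd_iota // -scalerAr -scalerAl coAZ rmorphM -betaE.
Qed.

Lemma Xb_sub i x : x \in Xb i -> x \in X i.
Proof. by have [_ _ /(_ i)[sX _] _ _] := e_adapted; apply: fsubsetP. Qed.
Lemma Yb_sub i y : y \in Yb i -> y \in Y i.
Proof. by have [_ _ /(_ i)[_ sY] _ _] := e_adapted; apply: fsubsetP. Qed.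

Lemma Xb_e i x : x \in Xb i -> e * x = x.
Proof. by have [_ _ _ eX _] := e_adapted => xb; rewrite (eX i) ?xb // Xb_sub. Qed.

Lemma Hf1 i y x : x \in Xb i -> Hf i y x 1 = phi (beta i y 1 x).
Proof.
move=> xb; rewrite -iota_e Hf_iota; last exact: (corner_e e_adapted).
by rewrite !betaE mulr1 -mulrA (Xb_e xb).
Qed.

Lemma sum_fset_sub (R : nmodType) (Z Z' : {fset A}) (f : A -> R) :
  (Z' `<=` Z)%fset -> (forall z, z \in Z -> z \notin Z' -> f z = 0) ->
  \sum_(z : Z) f (val z) = \sum_(z : Z') f (val z).
Proof.
move=> sub f0; rewrite -!(big_seq_fsetE _ _ predT) /=; symmetry.
exact: big_fset_incl.
Qed.

(** Modulo higher layers [s * x] is a combination of elements of [X i], and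
    those outside [Xb i] are killed by the corner. *)
Lemma Hf_left i x s : x \in Xb i -> exists r : A -> F, forall y t, y \in Yb i ->
  Hf i y x (t * s) = \sum_(z : Xb i) r (val z) * Hf i y (val z) t.
Proof.
move=> xb.
have r_ex (u : cidx) : exists r : A -> k, forall y t, y \in Yb i -> corner e t ->
    beta i y (t * bprod (val u)) x = \sum_(z : Xb i) r (val z) * beta i y t (val z).
  have [r rE] := beta_left her (bprod (val u)) (Xb_sub xb).
  exists (fun a => if insub a is Some z then r z else 0) => y t yb ct.
  rewrite rE ?Yb_sub //.
  rewrite -(@sum_fset_sub k (X i) (Xb i) (fun z => (if insub z is Some z' then r z' else 0) * beta i y t z)).
  - by apply: eq_bigr => z _; rewrite valK.
  - by have [_ _ /(_ i)[]] := e_adapted.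
  move=> z zX zb; have /(cornerP e_adapted) <- := ct.
  have [_ _ _ eX _] := e_adapted.
  by rewrite betaE -!mulrA (eX _ _ zX) (negPf zb) !mulr0 coA0 mulr0.
pose r u := projT1 (cid (r_ex u)).
have rE u y t : y \in Yb i -> corner e t -> beta i y (t * bprod (val u)) x
    = \sum_(z : Xb i) r u (val z) * beta i y t (val z).
  by rewrite /r; case: cid => ? /= E; apply: E.
exists (fun a => \sum_u cd u s * phi (r u a)) => y t yb.
rewrite [in LHS](cd_sum s) mulr_sumr Hf_sumE; under [RHS]eq_bigr do rewrite mulr_suml.
rewrite [RHS]exchange_big; apply: eq_bigr => u _ /=.
rewrite -scalerAr HfZ; under [RHS]eq_bigr do rewrite -mulrA.
rewrite -mulr_sumr; congr (_ * _).
rewrite [in LHS](cd_sum t) mulr_suml Hf_sumE.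
under [RHS]eq_bigr do rewrite [in X in _ * X](cd_sum t) Hf_sumE mulr_sumr.
rewrite [RHS]exchange_big; apply: eq_bigr => v _ /=.
have cv := bprod_cidx e_adapted v; have cu := bprod_cidx e_adapted u.
rewrite -scalerAl HfZ /bC -iotaM_corner // Hf_iota; last exact: (corner_mul e_adapted).
rewrite rE // rmorph_sum mulr_sumr; apply: eq_bigr => z _.
by rewrite HfZ Hf_iota // rmorphM mulrCA.
Qed.

Lemma Hf_right i y s : y \in Yb i -> exists r : A -> F, forall x t, x \in Xb i ->
  Hf i y x (s * t) = \sum_(z : Yb i) r (val z) * Hf i (val z) x t.
Proof.
move=> yb.
have r_ex (u : cidx) : exists r : A -> k, forall x t, x \in Xb i -> corner e t ->
    beta i y (bprod (val u) * t) x = \sum_(z : Yb i) r (val z) * beta i (val z) t x.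
  have [r rE] := beta_right her (bprod (val u)) (Yb_sub yb).
  exists (fun a => if insub a is Some z then r z else 0) => x t xb ct.
  rewrite rE ?Xb_sub //.
  rewrite -(@sum_fset_sub k (Y i) (Yb i) (fun z => (if insub z is Some z' then r z' else 0) * beta i z t x)).
  - by apply: eq_bigr => z _; rewrite valK.
  - by have [_ _ /(_ i)[]] := e_adapted.
  move=> z zX zb; have /(cornerP e_adapted) <- := ct.
  have [_ _ _ _ eY] := e_adapted.
  by rewrite betaE !mulrA (eY _ _ zX) (negPf zb) !mul0r coA0 mulr0.
pose r u := projT1 (cid (r_ex u)).
have rE u x t : x \in Xb i -> corner e t -> beta i y (bprod (val u) * t) x
    = \sum_(z : Yb i) r u (val z) * beta i (val z) t x.
  by rewrite /r; case: cid => ? /= E; apply: E.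
exists (fun a => \sum_u cd u s * phi (r u a)) => x t xb.
rewrite [in LHS](cd_sum s) mulr_suml Hf_sumE; under [RHS]eq_bigr do rewrite mulr_suml.
rewrite [RHS]exchange_big; apply: eq_bigr => u _ /=.
rewrite -scalerAl HfZ; under [RHS]eq_bigr do rewrite -mulrA.
rewrite -mulr_sumr; congr (_ * _).
rewrite [in LHS](cd_sum t) mulr_sumr Hf_sumE.
under [RHS]eq_bigr do rewrite [in X in _ * X](cd_sum t) Hf_sumE mulr_sumr.
rewrite [RHS]exchange_big; apply: eq_bigr => v _ /=.
have cv := bprod_cidx e_adapted v; have cu := bprod_cidx e_adapted u.
rewrite -scalerAr HfZ /bC -iotaM_corner // Hf_iota; last exact: (corner_mul e_adapted).
rewrite rE // rmorph_sum mulr_sumr; apply: eq_bigr => z _.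
by rewrite HfZ Hf_iota // rmorphM mulrCA.
Qed.

Local Notation nX i := #|{: Xb i}|.
Local Notation nY i := #|{: Yb i}|.

Definition Hm i (c : C) : 'M[F]_(nY i, nX i) :=
  \matrix_(p, q) Hf i (val (enum_val p)) (val (enum_val q)) c.

Lemma sum_enum_val (R : nmodType) (T : finType) (f : T -> R) :
  \sum_(z : T) f z = \sum_(q < #|{: T}|) f (enum_val q).
Proof. by rewrite (reindex _ (onW_bij _ (@enum_val_bij T))). Qed.

Lemma Hm_left i s : exists R, forall t, Hm i (t * s) = Hm i t *m R.
Proof.
have /choice[r rE] (q : 'I_(nX i)) : exists r : A -> F, forall y t, y \in Yb i ->
    Hf i y (val (enum_val q)) (t * s) = \sum_(z : Xb i) r (val z) * Hf i y (val z) t.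
  by apply: Hf_left; apply: valP.
exists (\matrix_(p, q) r q (val (enum_val p))) => t; apply/matrixP => p q; rewrite !mxE.
rewrite rE; last exact: valP.
by rewrite sum_enum_val; apply: eq_bigr => z _; rewrite !mxE mulrC.
Qed.

Lemma Hm_right i s : exists R, forall t, Hm i (s * t) = R *m Hm i t.
Proof.
have /choice[r rE] (p : 'I_(nY i)) : exists r : A -> F, forall x t, x \in Xb i ->
    Hf i (val (enum_val p)) x (s * t) = \sum_(z : Yb i) r (val z) * Hf i (val z) x t.
  by apply: Hf_right; apply: valP.
exists (\matrix_(p, q) r p (val (enum_val q))) => t; apply/matrixP => p q; rewrite !mxE.
rewrite rE; last exact: valP.
by rewrite sum_enum_val; apply: eq_bigr => z _; rewrite !mxE.
Qed.

Definition Gm i := Hm i 1.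
(** Locked, lest conversion unfold the Gaussian elimination. *)
Definition Ub i := locked (col_base (Gm i)).
Definition Vb i := locked (row_base (Gm i)).
Definition Ui i := locked (pinvmx (col_base (Gm i))).
Definition Vi i := locked (pinvmx (row_base (Gm i))).
Local Notation U := Ub.
Local Notation V := Vb.

(** The action on [e L(i)], which is the quotient of the truncated cell module
    by the radical of the form. The rank factorisation [U i *m V i] of the Gram
    matrix identifies this quotient with the image of [V i]. *)
Definition lam i (c : C) : 'M[F]_(\rank (Gm i)) :=
  Ui i *m Hm i c *m Vi i.

Let UK i : Ui i *m U i = 1%:M. Proof. by rewrite /Ui /U -!lock mulVpmx // col_base_full. Qed.
Let VK i : V i *m Vi i = 1%:M. Proof. by rewrite /V /Vi -!lock mulmxVp // row_base_free. Qed.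
Let GE i : Gm i = U i *m V i. Proof. by rewrite /U /V -!lock mulmx_base. Qed.

(** The left and right radicals of the Gram matrix lie in those of the form of
    any [c]. *)
Lemma HmE i c : Hm i c = U i *m lam i c *m V i.
Proof.
have [R RE] := Hm_left i c; have [R' R'E] := Hm_right i c.
have E1 : Hm i c = U i *m V i *m R by rewrite -GE -RE mul1r.
have E2 : Hm i c = R' *m U i *m V i by rewrite -mulmxA -GE -R'E mulr1.
have e1 : U i *m (Ui i *m Hm i c) = Hm i c.
  by rewrite E1 -!mulmxA (mulmxA (Ui i) (U i)) UK mul1mx.
have e2 : Hm i c *m (Vi i *m V i) = Hm i c.
  by rewrite E2 -!mulmxA (mulmxA (V i) (Vi i)) VK mul1mx.
transitivity (U i *m (Ui i *m (Hm i c *m (Vi i *m V i)))).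
  by rewrite e2 e1.
by rewrite /lam !mulmxA.
Qed.

Lemma lamM i a b : lam i (a * b) = lam i a *m lam i b.
Proof.
have [R RE] := Hm_right i a.
have la : lam i a = Ui i *m R *m U i.
  have Ha : Hm i a = R *m (U i *m V i) by rewrite -GE -RE mulr1.
  by rewrite /lam Ha -!mulmxA VK mulmx1.
by rewrite {1}/lam RE HmE la !mulmxA -[_ *m V i *m _]mulmxA VK mulmx1.
Qed.

Lemma lam1 i : lam i 1 = 1%:M.
Proof.
have H1 : Hm i 1 = U i *m V i by rewrite -GE.
by rewrite /lam H1 mulmxA UK mul1mx VK.
Qed.

Lemma Hm_linear i c a b : Hm i (c *: a + b) = c *: Hm i a + Hm i b.
Proof. by apply/matrixP => p q; rewrite !mxE Hf_lin. Qed.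

Lemma lam_linear i c a b : lam i (c *: a + b) = c *: lam i a + lam i b.
Proof. by rewrite /lam Hm_linear mulmxDr mulmxDl -scalemxAr -scalemxAl. Qed.

Lemma lam0 i : lam i 0 = 0.
Proof. by have := lam_linear i (-1) 0 0; rewrite scaler0 addr0 scaleN1r addNr. Qed.
Lemma lamD i a b : lam i (a + b) = lam i a + lam i b.
Proof. by have := lam_linear i 1 a b; rewrite !scale1r. Qed.
Lemma lam_sumE i (J : Type) (r : seq J) (P : pred J) (f : J -> C) :
  lam i (\sum_(u <- r | P u) f u) = \sum_(u <- r | P u) lam i (f u).
Proof. exact: (big_morph (lam i) (lamD i) (lam0 i)). Qed.

Lemma lam_eq0 i c : (forall x y, x \in Xb i -> y \in Yb i -> Hf i y x c = 0) -> lam i c = 0.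
Proof.
move=> h0; rewrite /lam (_ : Hm i c = 0) ?mulmx0 ?mul0mx //.
by apply/matrixP => p q; rewrite !mxE h0 //; apply: valP.
Qed.

Lemma lam_eq0_Hf i c : lam i c = 0 -> forall x y, x \in Xb i -> y \in Yb i -> Hf i y x c = 0.
Proof.
move=> l0 x y xb yb; have := HmE i c; rewrite l0 mulmx0 mul0mx.
move/matrixP/(_ (enum_rank [` yb]%fset) (enum_rank [` xb]%fset)).
by rewrite !mxE !enum_rankK.
Qed.

(** ** The matrix units *)

Definition mkc i x y (hx : x \in Xb i) (hy : y \in Yb i) : cidx :=
  exist _ (mkb (Xb_sub hx) (Yb_sub hy)) (introT andP (conj hx hy)).

Definition cell i (al : 'M[F]_(nX i, nY i)) : C :=
  \sum_q \sum_p al q p *: bC (mkc (valP (enum_val q)) (valP (enum_val p))).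

Lemma Hm_cell i al : Hm i (cell al) = Gm i *m al *m Gm i.
Proof.
apply/matrixP => p q; rewrite !mxE /cell Hf_sumE.
under [RHS]eq_bigr do rewrite !mxE mulr_suml.
rewrite [RHS]exchange_big; apply: eq_bigr => q' _ /=.
rewrite Hf_sumE; apply: eq_bigr => p' _; rewrite HfZ Hf_bC.
rewrite -[bprod _]mulr1 mxE.
have xq : val (enum_val q) \in Xb i by apply: valP.
have xq' : val (enum_val q') \in Xb i by apply: valP.
have yp : val (enum_val p) \in Yb i by apply: valP.
have yp' : val (enum_val p') \in Yb i by apply: valP.
rewrite beta_cell ?(Xb_sub xq) ?(Yb_sub yp) ?(Xb_sub xq') ?(Yb_sub yp') //.
by rewrite rmorphM -!Hf1 // mulrA [al _ _ * _]mulrC.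
Qed.

(** The forms of the elements of the cell are the matrices [G *m al *m G], and
    these are all the [U *m E *m V]. *)
Lemma lam_cell_surj i (E : 'M_(\rank (Gm i))) : exists al, lam i (@cell i al) = E.
Proof.
exists (Vi i *m E *m Ui i).
rewrite /lam Hm_cell; set al := _ *m Ui i.
have -> : Gm i *m al *m Gm i = U i *m (V i *m al *m U i) *m V i.
  by rewrite -[U i *m _ *m V i]mulmxA -![_ *m U i *m V i]mulmxA -GE !mulmxA -GE.
rewrite mulmxA -[_ *m V i *m _]mulmxA VK mulmx1 mulmxA UK mul1mx /al.
by rewrite !mulmxA VK mul1mx -mulmxA UK mulmx1.
Qed.

Lemma lam_cell_layer i j al : ~~ (i <= j)%O -> lam j (@cell i al) = 0.
Proof.
move=> ij; apply: lam_eq0 => x y xb yb; rewrite /cell Hf_sumE big1 // => q _.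
rewrite Hf_sumE big1 // => p _; rewrite HfZ Hf_bC.
set t := val _; have [->|h] := eqVneq (beta j y (bprod t) x) 0; first by rewrite rmorph0 mulr0.
by have := beta_layer h; rewrite (negPf ij).
Qed.

Definition height (i : I) := #|[set j | (j < i)%O]%SET|.

Lemma height_lt i j : (i < j)%O -> (height i < height j)%N.
Proof.
move=> ij; apply: proper_card; apply/properP; split.
  by apply/fintype.subsetP => x; rewrite !inE => xi; apply: lt_trans ij.
by exists i; rewrite !inE ?ltxx.
Qed.

Lemma height_bound i : (height i < #|I|)%N.
Proof.
rewrite -cardsT; apply: proper_card; apply/properP; split; first exact/finset.subsetT.
by exists i; rewrite !inE ?ltxx.
Qed.

(** The cells of a layer act on the lower layers by zero, so prescribed values
    can be reached one layer after the other. *)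
Lemma lam_surj (E : forall i, 'M[F]_(\rank (Gm i))) : exists c, forall i, lam i c = E i.
Proof.
suff [c cE] : exists c, forall i, (height i < #|I|)%N -> lam i c = E i.
  by exists c => i; apply/cE/height_bound.
elim: #|I| => [|m [c cE]]; first by exists 0.
have /choice[al alE] (i : I) : exists c', lam i c' = E i - lam i c /\
    forall j, ~~ (i <= j)%O -> lam j c' = 0.
  have [b bE] := lam_cell_surj (E i - lam i c); exists (cell b); split=> // j.
  exact: lam_cell_layer.
exists (c + \sum_(i | height i == m) al i) => j jm.
rewrite lamD lam_sumE; have [jm'|jm'] := eqVneq (height j) m.
  rewrite (bigD1 j) ?jm' //= (alE j).1 big1 ?addr0 ?subrKC // => i /andP[/eqP im ij].
  apply: (alE i).2; apply/negP; rewrite le_eqVlt (negPf ij) => /height_lt.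
  by rewrite im jm' ltnn.
rewrite big1 ?addr0 => [|i /eqP im].
  by apply: cE; rewrite ltn_neqAle jm' -ltnS.
apply: (alE i).2; apply/negP; rewrite le_eqVlt => /orP[/eqP ij|/height_lt].
  by rewrite -ij im eqxx in jm'.
by rewrite im => mj; move: jm; rewrite ltnS leqNgt mj.
Qed.

(** ** The semisimple quotient of the corner *)

Definition Qt : finType := {i : I & 'I_(\rank (Gm i))}.
Definition mkQ i (u : 'I_(\rank (Gm i))) : Qt := Tagged (fun i => 'I_(\rank (Gm i))) u.
Definition col (p : Qt) : I := tag p.

(** The direct sum of the modules [e L(i)] as one block diagonal matrix
    representation; the colour of a basis vector is its block. *)
Definition rho (c : C) (p q : Qt) : F :=
  if tag p == tag q then lam (tag p) c (tagged p) (tagged_as p q) else 0.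

Lemma rho_same i (u v : 'I_(\rank (Gm i))) c :
  rho c (mkQ u) (mkQ v) = lam i c u v.
Proof. by rewrite /rho /= eqxx tagged_asE. Qed.

Lemma rho_col c p q : rho c p q != 0 -> col p = col q.
Proof.
by move=> r0; apply: contrapT => /eqP/negPf ne; move: r0; rewrite /rho ne eqxx.
Qed.

Lemma rho_lin c a b p q : rho (c *: a + b) p q = c * rho a p q + rho b p q.
Proof.
rewrite /rho; case: eqP => _; last by rewrite mulr0 addr0.
by rewrite lam_linear !mxE.
Qed.

Lemma sum_Qt (f : Qt -> F) :
  \sum_s f s = \sum_(i : I) \sum_(u < \rank (Gm i)) f (mkQ u).
Proof. by rewrite (@sig_big_dep F) /=; apply: eq_bigr => -[]. Qed.

Lemma rhoM a b p q : rho (a * b) p q = \sum_s rho a p s * rho b s q.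
Proof.
case: p q => [i u] [j v]; rewrite sum_Qt (bigD1 i) //= [X in _ + X]big1 ?addr0 => [|l li].
  rewrite [rho (a * b) _ _]/rho /=; case: eqP => [ij|/eqP ij].
    subst j; rewrite tagged_asE lamM mxE; apply: eq_bigr => s _.
    by rewrite !rho_same.
  by rewrite big1 // => s _; rewrite [rho b _ _]/rho /= (negPf ij) mulr0.
by rewrite big1 // => s _; rewrite [rho a _ _]/rho /= eq_sym (negPf li) mul0r.
Qed.

Lemma rho1 p q : rho 1 p q = (p == q)%:R.
Proof.
case: p q => [i u] [j v]; rewrite /rho /=; case: eqP => [ij|/eqP ij].
  by subst j; rewrite tagged_asE lam1 mxE eq_Tagged.
by rewrite (_ : (_ == _) = false) //; apply/negP => /eqP[]; move/eqP; rewrite (negPf ij).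
Qed.

Lemma rho_unit p q : col p = col q ->
  exists s, forall p' q', rho s p' q' = (p' == p)%:R * (q' == q)%:R.
Proof.
case: p q => [i u] [j v]; rewrite /col /= => ij; subst j.
have [s sE] := lam_surj (fun l => \matrix_(u', v')
  ((mkQ u' == mkQ u)%:R *
   (mkQ v' == mkQ v)%:R)).
exists s => -[i' u'] [j' v']; have [ij|/eqP ij] := eqVneq i' j'.
  by subst j'; rewrite rho_same sE mxE.
rewrite /rho /=; case: eqP => // _.
case: eqP => [[e1 _]|]; last by rewrite mul0r.
case: eqP => [[e2 _]|]; last by rewrite mulr0.
by case: ij; rewrite e1 e2.
Qed.

Lemma rho_eq0 c : (forall i x y, x \in Xb i -> y \in Yb i -> Hf i y x c = 0) ->
  forall p q, rho c p q = 0.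
Proof.
move=> h0 [i u] [j v]; rewrite /rho /=; case: eqP => // _.
by rewrite lam_eq0 ?mxE //; apply: h0.
Qed.

Lemma rho_eq0_Hf c : (forall p q, rho c p q = 0) ->
  forall i x y, x \in Xb i -> y \in Yb i -> Hf i y x c = 0.
Proof.
move=> r0 i; apply: lam_eq0_Hf; apply/matrixP => u v; rewrite [RHS]mxE -rho_same.
exact: r0.
Qed.

(** ** Nilpotency of the radical *)

Definition deep (m : nat) (c : C) := forall t : cidx, (height (lay (val t)) < m)%N -> cd t c = 0.

Lemma cd_mul_layer t u v (c : C) : cd u (bC t * c * bC v) != 0 ->
  (lay (val t) <= lay (val u))%O /\ (lay (val v) <= lay (val u))%O.
Proof.
rewrite [in X in X -> _](cd_sum c) mulr_sumr mulr_suml cd_sumE => nz.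
have [w cw] : exists w, cd u (bC t * bC w * bC v) != 0.
  apply: contrapT => no; case/eqP: nz; rewrite big1 // => w _.
  rewrite -scalerAr -scalerAl cdZ; have [->|h] := eqVneq (cd u (bC t * bC w * bC v)) 0.
    by rewrite mulr0.
  by case: no; exists w.
have ct := bprod_cidx e_adapted t; have cv := bprod_cidx e_adapted v.
have cw' := bprod_cidx e_adapted w.
move: cw; rewrite /bC -!iotaM_corner //; last exact: (corner_mul e_adapted).
rewrite cd_iota; last by apply: (corner_mul e_adapted) => //; apply: (corner_mul e_adapted).
have [->|nz' _] := eqVneq (coA her (val u) (bprod (val t) * bprod (val w) * bprod (val v))) 0.
  by rewrite rmorph0 eqxx.
split; last exact: coA_bprod_mull nz'.
by move: nz'; rewrite -mulrA; apply: coA_bprod_mulr.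
Qed.

(** Modulo higher layers the product reduces to the form of the middle factor. *)
Lemma cd_cell t u v c : lay (val t) = lay (val u) -> lay (val v) = lay (val u) ->
  Hf (lay (val u)) (by_ (val t)) (bx (val v)) c = 0 -> cd u (bC t * c * bC v) = 0.
Proof.
set i := lay (val u) => tu vu H0.
have Xt : bx (val t) \in X i by rewrite -tu bx_in.
have Yt : by_ (val t) \in Y i by rewrite -tu by_in.
have Xv : bx (val v) \in X i by rewrite -vu bx_in.
have Yv : by_ (val v) \in Y i by rewrite -vu by_in.
suff -> : cd u (bC t * c * bC v) = Hf i (by_ (val t)) (bx (val v)) c *
    phi (coA her (val u) (bx (val t) * by_ (val v))) by rewrite H0 mul0r.
rewrite [in LHS](cd_sum c) mulr_sumr mulr_suml cd_sumE /Hf mulr_suml.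
apply: eq_bigr => w _; rewrite -scalerAr -scalerAl cdZ -mulrA; congr (_ * _).
have ct := bprod_cidx e_adapted t; have cv := bprod_cidx e_adapted v.
have cw' := bprod_cidx e_adapted w.
rewrite /bC -!iotaM_corner //; last exact: (corner_mul e_adapted).
rewrite cd_iota; last by apply: (corner_mul e_adapted) => //; apply: (corner_mul e_adapted).
rewrite -rmorphM -coAZ; congr (phi _).
have := cell_product her (bprod (val w)) Xt Yt Xv Yv.
by move/(_ (val u)); rewrite -/i ltxx coAB => /(_ isT)/eqP; rewrite subr_eq0 => /eqP.
Qed.

(** In the lowest layer that may occur the product is computed by the forms of
    [b], and they vanish. *)
Lemma deep_step m a b c : deep m a -> deep m c -> (forall p q, rho b p q = 0) ->
  deep m.+1 (a * b * c).
Proof.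
move=> am cm /rho_eq0_Hf b0 u; rewrite ltnS => um.
rewrite (cd_sum a) !mulr_suml cd_sumE big1 // => t _; rewrite (cd_sum c) mulr_sumr cd_sumE.
rewrite big1 // => v _; rewrite -scalerAr -!scalerAl !cdZ.
have [t_m|t_m] := ltnP (height (lay (val t))) m; first by rewrite am // mul0r mulr0.
have [v_m|v_m] := ltnP (height (lay (val v))) m; first by rewrite cm // mul0r.
have [->|nz] := eqVneq (cd u (bC t * b * bC v)) 0; first by rewrite !mulr0.
have [tu vu] := cd_mul_layer nz.
have eq_lay i : (i <= lay (val u))%O -> (m <= height i)%N -> i = lay (val u).
  rewrite le_eqVlt => /orP[/eqP //|/height_lt lt] mi.
  by move: (leq_ltn_trans mi lt); rewrite ltnNge um.
have {tu}tu := eq_lay _ tu t_m; have {vu}vu := eq_lay _ vu v_m.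
have Ybt : by_ (val t) \in Yb (lay (val u)) by rewrite -tu; have /andP[] := valP t.
have Xbv : bx (val v) \in Xb (lay (val u)) by rewrite -vu; have /andP[] := valP v.
by rewrite (cd_cell tu vu) ?mulr0 //; apply: b0.
Qed.

Lemma deep_bound c : deep #|I| c -> c = 0.
Proof.
move=> cm; rewrite (cd_sum c) big1 // => t _.
by rewrite cm ?scale0r //; apply: height_bound.
Qed.

(** Put one factor between two products that are deep already: [deep_step]
    gains one layer. *)
Lemma rho_kernel_nilpotent : exists M, forall s : seq C,
  (forall x, x \in s -> forall p q, rho x p q = 0) -> (M <= size s)%N -> \prod_(x <- s) x = 0.
Proof.
suff deep_prod m : exists M, forall s : seq C,
    (forall x, x \in s -> forall p q, rho x p q = 0) -> (M <= size s)%N -> deep m (\prod_(x <- s) x).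
  have [M ME] := deep_prod #|I|; exists M => s s0 sM; apply: deep_bound; exact: ME.
elim: m => [|m [M IH]]; first by exists 0%N.
exists (M + M.+1)%N => s s0 sM.
rewrite -(cat_take_drop M s) big_cat /=.
have sz : (M < size s)%N by apply: leq_trans sM; rewrite addnS ltnS leq_addr.
have : size (drop M s) = (size s - M)%N by rewrite size_drop.
have sub x : x \in drop M s -> forall p q, rho x p q = 0 by move=> /mem_drop; apply: s0.
case: (drop M s) sub => [|b r] sub sizeE; first by move: sizeE sz => /=; lia.
rewrite big_cons mulrA; apply: deep_step.
- apply: IH => [x /mem_take|]; first exact: s0.
  by rewrite size_takel // ltnW.
- apply: IH => [x xr|]; first by apply: sub; rewrite inE xr orbT.
  by move: sizeE sM => /=; lia.
- by apply: sub; rewrite mem_head.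
Qed.

Section Extension.
Variables (AF : algType F) (iotaA : A -> AF).
Hypothesis AF_ext : is_algebra_base_change phi setT iotaA.

Lemma rho_odd_bC : parity_part (gr_ext gr setT iotaA) true `<=` @jacobson F AF ->
  forall t : cidx, (deg gr (val t)).2 -> forall p q, rho (bC t) p q = 0.
Proof.
move=> odd_rad t t_odd; apply: rho_eq0 => i x y xb yb; rewrite Hf_bC.
have := gr_bprod A_super her (val t); rewrite t_odd => ga.
exact: (odd_beta_eq0 her AF_ext odd_rad ga (Xb_sub xb) (Yb_sub yb)).
Qed.

Lemma two_colours : (1 < #|Ibar phi iotaA X Y ei e|)%N ->
  exists p q : Qt, col p != col q.
Proof.
have rank_gt0 i : i \in Ibar phi iotaA X Y ei e -> (0 < \rank (Gm i))%N.
  move=> /(Ibar_beta her AF_ext e_adapted)[x [y [xb yb nz]]].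
  rewrite lt0n mxrank_eq0; apply: contraNneq nz => G0.
  have /matrixP/(_ (enum_rank [` yb]%fset) (enum_rank [` xb]%fset)) := G0.
  by rewrite !mxE !enum_rankK /= Hf1 // => ->.
case/card_gt1P => i [j [/rank_gt0 i0 /rank_gt0 j0 ij]].
by exists (mkQ (Ordinal i0)), (mkQ (Ordinal j0)).
Qed.

End Extension.

(** ** Central idempotents of the corner *)

Hypothesis C_indec : indecomposable (gr_ext gr (corner e) iota).
Hypothesis rho_odd : forall t : cidx, (deg gr (val t)).2 -> forall p q, rho (bC t) p q = 0.

Local Notation dg t := (deg gr (val (t : cidx))).

Definition central (c : C) : Prop := forall a, c * a = a * c.

Lemma centralP c : (forall u, c * bC u = bC u * c) -> central c.
Proof.
move=> cu a; rewrite (cd_sum a) mulr_sumr mulr_suml; apply: eq_bigr => u _.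
by rewrite -scalerAr -scalerAl cu.
Qed.

Lemma rho0 p q : rho 0 p q = 0.
Proof. exact: (form0 (f := fun c => rho c p q) (fun c a b => rho_lin c a b p q)). Qed.
Lemma rhoD a b p q : rho (a + b) p q = rho a p q + rho b p q.
Proof. exact: (formD (f := fun c => rho c p q) (fun c a b => rho_lin c a b p q)). Qed.
Lemma rhoZ c a p q : rho (c *: a) p q = c * rho a p q.
Proof. exact: (formZ (f := fun c => rho c p q) (fun c a b => rho_lin c a b p q)). Qed.
Lemma rhoB a b p q : rho (a - b) p q = rho a p q - rho b p q.
Proof. by rewrite rhoD -scaleN1r rhoZ mulN1r. Qed.
Lemma rho_sumE p q (J : Type) (r : seq J) (P : pred J) (f : J -> C) :
  rho (\sum_(u <- r | P u) f u) p q = \sum_(u <- r | P u) rho (f u) p q.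
Proof. exact: (form_sum (f := fun c => rho c p q) (fun c a b => rho_lin c a b p q)). Qed.

(** Schur: a central element commutes with all the matrix units. *)
Lemma rho_central c : central c ->
  (forall p q, p != q -> rho c p q = 0) /\ (forall p q, col p = col q -> rho c p p = rho c q q).
Proof.
move=> cc; have key p q p' q' : col p = col q ->
    rho c p' p * (q' == q)%:R = (p' == p)%:R * rho c q q'.
  move=> pq; have [s sE] := rho_unit pq; have := congr1 (fun a => rho a p' q') (cc s).
  rewrite !rhoM (bigD1 p) //= sE eqxx mul1r big1 ?addr0 => [->|r rp]; last first.
    by rewrite sE (negPf rp) mul0r mulr0.
  rewrite (bigD1 q) //= sE eqxx mulr1 big1 ?addr0 // => r rq.
  by rewrite sE (negPf rq) mulr0 mul0r.
split=> [p q pq|p q pq]; last by have := key p q p q pq; rewrite !eqxx mulr1 mul1r.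
by have := key q q p q erefl; rewrite eqxx mulr1 (negPf pq) mul0r.
Qed.

Lemma rho_centralM a b p : central a -> rho (a * b) p p = rho a p p * rho b p p.
Proof.
move=> /rho_central[ca _]; rewrite rhoM (bigD1 p) //= big1 ?addr0 // => q qp.
by rewrite ca ?mul0r // eq_sym.
Qed.

Lemma central1 : central 1. Proof. by move=> a; rewrite mul1r mulr1. Qed.
Lemma centralM a b : central a -> central b -> central (a * b).
Proof. by move=> ca cb x; rewrite -mulrA cb mulrA ca mulrA. Qed.
Lemma centralB a b : central a -> central b -> central (a - b).
Proof. by move=> ca cb x; rewrite mulrBl mulrBr ca cb. Qed.
Lemma centralX a m : central a -> central (a ^+ m).
Proof. by move=> ca; elim: m => [|m IH]; rewrite ?exprS; [apply: central1|apply: centralM]. Qed.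

Lemma rho_centralX a m p : central a -> rho (a ^+ m) p p = rho a p p ^+ m.
Proof.
move=> ca; elim: m => [|m IH]; first by rewrite !expr0 rho1 eqxx.
by rewrite !exprS rho_centralM // IH.
Qed.

Lemma rho_central_nilpotent c m : central c -> c ^+ m = 0 -> forall p q, rho c p q = 0.
Proof.
move=> cc cm p q; have [->|pq] := eqVneq p q; last by have [-> ] := rho_central cc.
have := rho_centralX m q cc; rewrite cm rho0 => /esym/eqP; rewrite expf_eq0.
by case/andP => _ /eqP.
Qed.

Definition degD (D D' : int * bool) : int * bool := (D.1 + D'.1, D.2 (+) D'.2).

Lemma cd_bCM_deg t u v : cd v (bC t * bC u) != 0 -> dg v = degD (dg t) (dg u).
Proof.
have ct := bprod_cidx e_adapted t; have cu := bprod_cidx e_adapted u.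
rewrite /bC -iotaM_corner // cd_iota; last exact: (corner_mul e_adapted).
have [->|nz _] := eqVneq (coA her (val v) (bprod (val t) * bprod (val u))) 0.
  by rewrite rmorph0 eqxx.
exact: (coA_deg_mul A_super nz).
Qed.

Definition component D (c : C) : C := \sum_(t | dg t == D) cd t c *: bC t.

Lemma degD_injl D D' D'' : (degD D D'' == degD D' D'') = (D == D').
Proof.
case: D D' D'' => [m a] [m' a'] [m'' a'']; rewrite /degD /= -!pair_eqE /pair_eq /=.
by rewrite (inj_eq (addIr _)) (inj_eq (can_inj (addbK _))).
Qed.

Lemma degDC D D' : degD D D' = degD D' D.
Proof. by rewrite /degD addrC addbC. Qed.

Lemma cd_component_mul D c u v :
  cd v (component D c * bC u) = (dg v == degD D (dg u))%:R * cd v (c * bC u).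
Proof.
rewrite [in RHS](cd_sum c) !mulr_suml !cd_sumE mulr_sumr big_mkcond.
apply: eq_bigr => t _ /=; rewrite -scalerAl cdZ.
have [->|nz] := eqVneq (cd v (bC t * bC u)) 0; first by rewrite !mulr0 if_same.
by rewrite (cd_bCM_deg nz) degD_injl; case: ifP; rewrite ?mul1r ?mul0r.
Qed.

Lemma cd_mul_component D c u v :
  cd v (bC u * component D c) = (dg v == degD D (dg u))%:R * cd v (bC u * c).
Proof.
rewrite [in RHS](cd_sum c) !mulr_sumr !cd_sumE mulr_sumr big_mkcond.
apply: eq_bigr => t _ /=; rewrite -scalerAr cdZ.
have [->|nz] := eqVneq (cd v (bC u * bC t)) 0; first by rewrite !mulr0 if_same.
by rewrite (cd_bCM_deg nz) degDC degD_injl; case: ifP; rewrite ?mul1r ?mul0r.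
Qed.

(** Multiplication by a homogeneous basis element shifts degrees injectively,
    so centrality can be checked one component at a time. *)
Lemma component_central D c : central c -> central (component D c).
Proof.
move=> cc; apply: centralP => u; rewrite [LHS]cd_sum [RHS]cd_sum; apply: eq_bigr => v _.
by rewrite cd_component_mul cd_mul_component cc.
Qed.

Lemma cd_component D c v : cd v (component D c) != 0 -> dg v = D.
Proof.
rewrite cd_sumE; apply: contraNeq => vD; rewrite big1 // => t /eqP tD.
by rewrite cdZ cd_bC; case: eqP => [vt|_]; rewrite ?mulr0 // vt tD eqxx in vD *.
Qed.

Lemma cd_neq0_mul a b v : cd v (a * b) != 0 ->
  exists t u, [/\ cd t a != 0, cd u b != 0 & dg v = degD (dg t) (dg u)].
Proof.
move=> nz; apply: contrapT => no; case/eqP: nz.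
rewrite (cd_sum a) mulr_suml cd_sumE big1 // => t _.
rewrite (cd_sum b) mulr_sumr cd_sumE big1 // => u _.
rewrite -scalerAr -scalerAl !cdZ.
have [->|ta] := eqVneq (cd t a) 0; first by rewrite mul0r mulr0.
have [->|ub] := eqVneq (cd u b) 0; first by rewrite mul0r.
have [->|/cd_bCM_deg nz] := eqVneq (cd v (bC t * bC u)) 0; first by rewrite !mulr0.
by case: no; exists t, u.
Qed.

Lemma deg_one v : cd v 1 != 0 -> dg v = (0, false).
Proof.
have [[m [eps ge]] ee _ _ _] := e_adapted.
rewrite -iota_e cd_iota; last exact: (corner_e e_adapted).
have [->|nz _] := eqVneq (coA her (val v) e) 0; first by rewrite rmorph0 eqxx.
have d1 := coA_deg A_super ge nz.
have gee : gr (m + m) (eps (+) eps) e by rewrite -[e]ee; apply: A_super.2.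
have := coA_deg A_super gee nz; rewrite d1 => -[/eqP m0 e0]; rewrite addbb in e0.
by move: m0; rewrite eq_sym -subr_eq0 addrK => /eqP ->; rewrite e0.
Qed.

(** Only finitely many degrees occur. *)
Lemma component_nilpotent D c : D.1 != 0 -> exists m, component D c ^+ m = 0.
Proof.
move=> D0; pose x := component D c.
have degX m v : cd v (x ^+ m) != 0 -> (dg v).1 = D.1 *+ m.
  elim: m v => [|m IH] v; first by rewrite expr0 => /deg_one ->.
  rewrite exprS => /cd_neq0_mul[t [u [/cd_component tD /IH uD ->]]].
  by rewrite tD mulrS -uD.
pose N := (\sum_(t : cidx) `|(dg t).1|)%N.
exists N.+1; rewrite (cd_sum (_ ^+ _)) big1 // => v _.
have [->|/degX] := eqVneq (cd v (x ^+ N.+1)) 0; first by rewrite scale0r.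
move/(congr1 absz); rewrite -mulr_natr abszM => vN.
have : (`|(dg v).1| <= N)%N by rewrite /N (bigD1 v) //= leq_addr.
rewrite vN; have : (0 < `|D.1|)%N by rewrite lt0n absz_eq0.
by rewrite natz absz_nat; nia.
Qed.

(** The components of nonzero integral degree are central and nilpotent, and
    the odd component of degree zero acts by zero. *)
Lemma rho_component0 c : central c -> forall p q, rho c p q = rho (component (0, false) c) p q.
Proof.
move=> cc p q; pose s := undup [seq dg t | t <- enum [pred t : cidx | dg t != (0, false)]].
have s0 D : D \in s -> D != (0, false).
  by rewrite mem_undup => /mapP[t]; rewrite mem_enum inE => t0 ->.
have cE : c = component (0, false) c + \sum_(D <- s) component D c.
  rewrite {1}(cd_sum c) (bigID (fun t => dg t == (0, false))) /=; congr (_ + _).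
  rewrite [RHS]big_seq (exchange_big_dep (fun t => dg t != (0, false))) /= => [|D t /s0]; last first.
    by move=> D0 /eqP ->.
  apply: eq_bigr => t t0; have ts : dg t \in s.
    by rewrite mem_undup; apply/mapP; exists t; rewrite ?mem_enum ?inE.
  rewrite (eq_bigl (fun D => (D \in s) && (D == dg t))) => [|D]; last by rewrite eq_sym.
  by rewrite -big_seq_cond -big_filter filter_pred1_uniq ?undup_uniq // big_seq1.
rewrite {1}cE rhoD rho_sumE big_seq big1 ?addr0 // => D /s0 D0.
have [m0|m0] := eqVneq D.1 0; last first.
  have [m xm] := component_nilpotent c m0.
  exact: (rho_central_nilpotent (component_central D cc) xm).
rewrite rho_sumE big1 // => t /eqP tD; rewrite rhoZ rho_odd ?mulr0 // tD.
by move: D0; case: D m0 {tD} => [m []] //= ->; rewrite eqxx.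
Qed.

(** With [N = M + 1], the polynomial [f = 1 - (1 - X ^ N) ^ N] is divisible by
    [X ^ N] and [1 - f] is divisible by [(1 - X) ^ N]; so [f * (1 - f)] is
    divisible by [(X ^ 2 - X) ^ M]. *)
Lemma idempotent_lift (c : C) M : (c ^+ 2 - c) ^+ M = 0 ->
  let f := 1 - (1 - c ^+ M.+1) ^+ M.+1 in f * f = f.
Proof.
move=> cM f.
pose pf : {poly F} := 1 - (1 - 'X ^+ M.+1) ^+ M.+1.
have fE : f = horner_alg c pf.
  by rewrite /pf rmorphB rmorph1 rmorphXn rmorphB rmorph1 rmorphXn /= horner_algX.
have [g gE] : exists g, pf * (1 - pf) = ('X ^+ 2 - 'X) ^+ M * g.
  pose y : {poly F} := 1 - 'X ^+ M.+1.
  have e1 : pf = 'X ^+ M.+1 * \sum_(i < M.+1) y ^+ i.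
    rewrite -[pf]opprK opprB subrX1 -mulNr; congr (_ * _).
    by rewrite /y addrAC subrr add0r opprK.
  have e2 : 1 - pf = (1 - 'X) ^+ M.+1 * (\sum_(i < M.+1) 'X ^+ i) ^+ M.+1.
    rewrite /pf opprB addrCA subrr addr0 -exprMn; congr (_ ^+ _).
    by rewrite -opprB subrX1 -mulNr opprB.
  exists ((-1) ^+ M * ('X * (1 - 'X)) * ((\sum_(i < M.+1) y ^+ i) * (\sum_(i < M.+1) 'X ^+ i) ^+ M.+1)).
  have -> : ('X ^+ 2 - 'X : {poly F}) = (-1) * ('X * (1 - 'X)) by ring.
  rewrite e2 e1 !exprS -!mulrA (exprMn _ (-1)) (exprMn _ 'X).
  have s1 : (-1 : {poly F}) ^+ M * (-1) ^+ M = 1 by rewrite -exprMn mulrNN mulr1 expr1n.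
  set a := 'X ^+ M; set b := (1 - 'X) ^+ M; set s := (-1) ^+ M in s1 *.
  set h1 := \sum_(i < M.+1) _; set h2 := \sum_(i < M.+1) _.
  transitivity (s * s * (a * b * ('X * (1 - 'X) * (h1 * (h2 * h2 ^+ M))))).
    by rewrite s1 mul1r; ring.
  by ring.
clearbody pf; have : horner_alg c (pf * (1 - pf)) = 0.
  by rewrite gE rmorphM rmorphXn rmorphB rmorphXn /= horner_algX cM mul0r.
rewrite rmorphM rmorphB rmorph1 /= -fE mulrBr mulr1 => /eqP.
by rewrite subr_eq0 => /eqP.
Qed.

(** A central element that is idempotent modulo the radical acts as [0] or [1]
    on all the simple modules: the even part of degree [0] already has the same
    action, and lifts to a homogeneous central idempotent. *)
Lemma central_idempotent_rho c : central c -> (forall p q, rho (c * c - c) p q = 0) ->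
  (forall p q, rho c p q = 0) \/ (forall p q, rho c p q = (p == q)%:R).
Proof.
move=> cc cidem; pose c0 := component (0, false) c.
have c0c : central c0 := component_central _ cc.
have rE := rho_component0 cc; rewrite -/c0 in rE.
have r01 p : rho c p p = 0 \/ rho c p p = 1.
  have /eqP := cidem p p; rewrite rhoB rho_centralM // -{3}[rho c p p]mulr1 -mulrBr mulf_eq0.
  by rewrite subr_eq0 => /orP[]/eqP; [left|right].
have ker0 p q : rho (c0 ^+ 2 - c0) p q = 0.
  have cc2 : central (c0 ^+ 2 - c0) by apply: centralB => //; apply: centralX.
  have [->|pq] := eqVneq p q; last by have [->] := rho_central cc2.
  rewrite rhoB rho_centralX // -rE expr2.
  by case: (r01 q) => ->; rewrite ?mulr0 ?mulr1 subrr.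
have [M nil] := rho_kernel_nilpotent.
have c0M : (c0 ^+ 2 - c0) ^+ M = 0.
  have := nil (nseq M (c0 ^+ 2 - c0)); rewrite size_nseq leqnn big_nseq iter_mulr_1.
  by apply=> // x; rewrite mem_nseq => /andP[_ /eqP ->].
pose f := 1 - (1 - c0 ^+ M.+1) ^+ M.+1.
have ff : f * f = f := idempotent_lift c0M.
have cf : central f.
  by apply: centralB; [|apply/centralX/centralB; [|apply: centralX]] => //; apply: central1.
have rf p q : rho c p q = rho f p q.
  have [->|pq] := eqVneq p q; last first.
    by have [h _] := rho_central cc; have [h' _] := rho_central cf; rewrite h // h'.
  have c1 := central1; have cX := centralX M.+1 c0c.
  rewrite rhoB rho_centralX ?rhoB ?rho_centralX -?rE ?rho1 ?eqxx //; last exact: centralB.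
  by case: (r01 q) => ->; rewrite ?expr0n ?subr0 ?expr1n ?subrr ?expr0n /= ?subr0.
have hom_mul a b : (forall v, cd v a != 0 -> dg v = (0, false)) ->
    (forall v, cd v b != 0 -> dg v = (0, false)) -> forall v, cd v (a * b) != 0 -> dg v = (0, false).
  by move=> ha hb v /cd_neq0_mul[t [u [/ha -> /hb -> ->]]].
have hom_exp a m : (forall v, cd v a != 0 -> dg v = (0, false)) ->
    forall v, cd v (a ^+ m) != 0 -> dg v = (0, false).
  by move=> ha; elim: m => [|m IH]; [exact: deg_one|rewrite exprS; apply: hom_mul].
have hom_sub a : (forall v, cd v a != 0 -> dg v = (0, false)) ->
    forall v, cd v (1 - a) != 0 -> dg v = (0, false).
  move=> ha v; rewrite cdD -scaleN1r cdZ.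
  have [->|/ha //] := eqVneq (cd v a) 0; rewrite mulr0 addr0; exact: deg_one.
have hf : forall v, cd v f != 0 -> dg v = (0, false).
  by apply/hom_sub/hom_exp/hom_sub/hom_exp => v /cd_component.
have gr_mul a t : (forall v, cd v a != 0 -> dg v = (0, false)) ->
    gr_ext gr (corner e) iota (dg t).1 (dg t).2 (a * bC t).
  move=> ha; rewrite [a * bC t]cd_sum; apply: submodule_sum => [|v _]; first exact: span_submodule.
  have [->|/cd_neq0_mul[w [u [/ha wD]]]] := eqVneq (cd v (a * bC t)) 0.
    by rewrite scale0r; have [] := span_submodule [set iota x | x in corner e `&` gr (dg t).1 (dg t).2].
  rewrite cd_bC; case: (eqVneq u t) => [->|]; rewrite ?eqxx // => _ vD.
  apply: submoduleZ; first exact: span_submodule.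
  apply: sub_span; exists (bprod (val v)) => //; split; first exact: (bprod_cidx e_adapted).
  have -> : dg t = dg v by rewrite vD wD /degD add0r addFb; case: (dg t).
  exact: (gr_bprod A_super her).
have ideal a : central a -> a * a = a -> (forall v, cd v a != 0 -> dg v = (0, false)) ->
    homogeneous_ideal (gr_ext gr (corner e) iota) [set x | a * x = x].
  move=> ca aa ha; split; first split.
  - by split=> [|l x y /= xx yy]; rewrite /= ?mulr0 // mulrDr -scalerAr xx yy.
  - by move=> b x /= xx; rewrite mulrA ca -mulrA xx mulrA xx.
  move=> x /= xx; exists [seq cd t x *: (a * bC t) | t <- enum cidx]; split=> [_ /mapP[t _ ->]|].
    split; last by rewrite /= -scalerAr mulrA aa.
    by exists (dg t).1, (dg t).2; apply: submoduleZ; [exact: span_submodule|exact: gr_mul].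
  rewrite big_map big_enum /= -{1}xx {1}(cd_sum x) mulr_sumr.
  by apply: eq_bigr => t _; rewrite scalerAr.
have f01 : f = 0 \/ 1 - f = 0.
  apply: contrapT => no; apply: C_indec; exists [set x | f * x = x], [set x | (1 - f) * x = x].
  have f'f' : (1 - f) * (1 - f) = 1 - f.
    by rewrite mulrBr mulr1 mulrBl mul1r ff subrr subr0.
  split.
  - split; apply: ideal => //; first by apply: centralB => //; exact: central1.
    exact: hom_sub.
  - split; [exists f|exists (1 - f)] => //; apply/eqP => z0; apply: no; [by left|by right].
  - by move=> x /= fx; rewrite mulrBl mul1r fx subrr.
  - move=> a; exists (f * a), ((1 - f) * a); split; rewrite /= ?mulrA ?ff ?f'f' //.
    by rewrite -mulrDl addrC subrK mul1r.
case: f01 => [f0|/eqP]; [left|rewrite subr_eq0 => /eqP f1; right] => p q; rewrite rf.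
  by rewrite f0 rho0.
by rewrite -f1 rho1.
Qed.

End CornerAlgebra.

(** * The tensor power and the span of the elements eta *)

Section TensorPower.
Variables (k : idomainType) (A : algType k) (gr : int -> bool -> set A).
Hypothesis A_super : graded_superalgebra gr.
Variables (disp : Order.disp_t) (I : finPOrderType disp).
Variables (X Y : I -> {fset A}) (ei : I -> A).
Hypothesis her : heredity_data gr setT X Y ei.
Variables (e : A) (Xb Yb : I -> {fset A}).
Hypothesis e_adapted : adapted gr X Y e Xb Yb.
Variables (n d : nat) (TP : algType k) (tau : {ffun 'I_d -> 'M[A]_n} -> TP).
Hypothesis TP_tensor : is_tensor_power gr e tau.
Local Notation cidx := (cidx X Y Xb Yb).

Definition letter : finType := (cidx * 'I_n * 'I_n)%type.
Local Notation word := {ffun 'I_d -> letter}.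

Definition lpar (l : letter) : bool := (deg gr (val l.1.1)).2.
Definition lcl (l : letter) : bool := odd_odd gr (val l.1.1).
Definition lmat (l : letter) : 'M[A]_n := bprod (val l.1.1) *: delta_mx l.1.2 l.2.
Definition tw (w : word) : TP := tau [ffun j => lmat (w j)].
Definition coM (l : letter) (u : 'M[A]_n) : k := coA her (val l.1.1) (u l.1.2 l.2).

(** The structure constants of the matrix algebra over the corner. *)
Definition Gk (l1 l2 l3 : letter) : k :=
  ((l1.2 == l2.1.2) && (l3.1.2 == l1.1.2) && (l3.2 == l2.2))%:R *
  coA her (val l3.1.1) (bprod (val l1.1.1) * bprod (val l2.1.1)).

Lemma coM_lmat l l' : coM l (lmat l') = (l == l')%:R.
Proof.
rewrite /coM /lmat !mxE.
case: l l' => [[t r] s] [[t' r'] s'] /=; rewrite -!pair_eqE /pair_eq /= -!pair_eqE /pair_eq /=.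
case: (r == r'); case: (s == s'); rewrite ?mulr1 ?mulr0 ?coA0 ?andbF ?andbT //.
by rewrite coA_bprod.
Qed.

Lemma matC_lmat l : matC e (lmat l).
Proof.
have sub := corner_submodule e_adapted.
move=> r s; rewrite !mxE; case: (_ && _); rewrite ?mulr1 ?mulr0; last by case: sub.
exact: (bprod_cidx e_adapted).
Qed.

Lemma matC_sum u : matC e u -> u = \sum_l (coM l u)%:A *: lmat l.
Proof.
move=> uC; apply/matrixP => r s; rewrite summxE.
rewrite -(pair_bigA _ (fun (tr : cidx * 'I_n) s' => ((coM (tr, s') u)%:A *: lmat (tr, s')) r s)) /=.
rewrite -(pair_bigA _ (fun (t : cidx) r' => \sum_s' ((coM (t, r', s') u)%:A *: lmat (t, r', s')) r s)) /=.
rewrite {1}(corner_sum her e_adapted (uC r s)); apply: eq_bigr => t _.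
rewrite (bigD1 r) //= [X in _ = _ + X]big1 ?addr0 => [|r' r'r]; last first.
  by rewrite big1 // => s' _; rewrite !mxE eq_sym (negPf r'r) /= !mulr0.
rewrite (bigD1 s) //= [X in _ = _ + X]big1 ?addr0 => [|s' s's]; last first.
  by rewrite !mxE eqxx eq_sym (negPf s's) /= !mulr0.
by rewrite !mxE !eqxx /= mulr1 mulr_algl.
Qed.

Lemma matC_submodule c (x y : 'M[A]_n) : matC e x -> matC e y -> matC e (c%:A *: x + y).
Proof.
move=> xC yC r s; rewrite !mxE mulr_algl; have [_ sub] := corner_submodule e_adapted.
exact: sub.
Qed.

Lemma matC0 : matC e (0 : 'M[A]_n).
Proof. by move=> r s; rewrite mxE; case: (corner_submodule e_adapted). Qed.

Lemma coM_lin l c x y : coM l (c%:A *: x + y) = c * coM l x + coM l y.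
Proof. by rewrite /coM !mxE mulr_algl coAD coAZ. Qed.

Section Multilinear.
Variables (V : lmodType k) (g : {ffun 'I_d -> 'M[A]_n} -> V).
Hypothesis g_lin : multilinear e g.

Lemma multilinear0 u l : tupC e u -> g (upd u l 0) = 0.
Proof.
move=> uC; have := g_lin l (-1) uC matC0 matC0.
by rewrite scaler0 addr0 scaleN1r addNr.
Qed.

Lemma multilinear_sum u l (J : Type) (r : seq J) (c : J -> k) (x : J -> 'M[A]_n) :
  tupC e u -> (forall j, matC e (x j)) ->
  g (upd u l (\sum_(j <- r) (c j)%:A *: x j)) = \sum_(j <- r) c j *: g (upd u l (x j)).
Proof.
move=> uC xC; elim: r => [|j r IH]; first by rewrite !big_nil multilinear0.
rewrite !big_cons g_lin ?IH //; elim: r {IH} => [|j' r IH]; first by rewrite big_nil; apply: matC0.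
by rewrite big_cons; apply: matC_submodule.
Qed.

(** The arguments are expanded one by one; [w0] records those that are basis
    elements already. *)
Lemma multilinear_expand u : tupC e u ->
  g u = \sum_(w : word) (\prod_j coM (w j) (u j)) *: g [ffun j => lmat (w j)].
Proof.
suff gen m : (m <= d)%N -> forall v (w0 : 'I_d -> letter), tupC e v ->
    (forall j : 'I_d, (m <= j)%N -> v j = lmat (w0 j)) ->
    g v = \sum_(w : word) (\prod_j coM (w j) (v j)) *: g [ffun j => lmat (w j)].
  (* Without letters the matrix algebra is zero; then [w0] exists only if
     [d = 0]. *)
  move=> uC; have [l0|no] := pselect (inhabited letter); last first.
    have [d0|] := eqVneq d 0%N.
      have jF (j : 'I_d) : False by have := ltn_ord j; rewrite {2}d0.
      by apply: (gen d (leqnn d) u (fun j => False_rect _ (jF j)) uC) => j; case: (jF j).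
    rewrite -lt0n => d0; have u0 : u (Ordinal d0) = 0.
      rewrite [LHS]matC_sum ?big1 // => l; by case: no.
    have -> : u = upd u (Ordinal d0) 0.
      by apply/ffunP => j; rewrite ffunE; case: eqP => [->|].
    rewrite multilinear0 // big1 // => w _; by case: no; constructor; exact: (w (Ordinal d0)).
  case: l0 => l0; apply: (gen d (leqnn d) u (fun _ => l0) uC) => j.
  by rewrite leqNgt ltn_ord.
elim: m => [_|m IH lt_md] v w0 vC vE.
  rewrite (bigD1 [ffun j => w0 j]) //= [X in _ + X]big1 ?addr0 => [|w w_w0].
    rewrite big1 ?scale1r; last by move=> j _; rewrite ffunE vE // coM_lmat eqxx.
    by congr (g _); apply/ffunP => j; rewrite !ffunE vE.
  have [j] := neq_ffun w_w0; rewrite ffunE => wj.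
  by rewrite (bigD1 j) //= vE // coM_lmat (negPf wj) mul0r scale0r.
pose l := Ordinal lt_md.
have vl : v = upd v l (\sum_a (coM a (v l))%:A *: lmat a).
  by apply/ffunP => j; rewrite ffunE; case: eqP => [->|//]; apply: matC_sum.
rewrite {1}vl multilinear_sum // => [|a]; last exact: matC_lmat.
have updC a : tupC e (upd v l (lmat a)).
  by move=> j; rewrite ffunE; case: ifP => _ //; apply: matC_lmat.
have step a : g (upd v l (lmat a)) =
    \sum_(w : word) (\prod_j coM (w j) (upd v l (lmat a) j)) *: g [ffun j => lmat (w j)].
  apply: (IH (ltnW lt_md) _ (fun j => if j == l then a else w0 j)) => // j mj.
  rewrite ffunE; case: eqP => // /eqP jl; apply: vE; rewrite ltn_neqAle mj andbT.
  by apply: contraNneq jl => mj'; apply/eqP/val_inj.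
under eq_bigr do rewrite step scaler_sumr.
rewrite exchange_big; apply: eq_bigr => w _ /=.
under eq_bigr do rewrite scalerA.
rewrite -scaler_suml; congr (_ *: _).
rewrite (bigD1 (w l)) //= [X in _ + X]big1 ?addr0 => [|a al]; last first.
  by rewrite (bigD1 l) //= ffunE eqxx coM_lmat eq_sym (negPf al) mul0r mulr0.
rewrite (bigD1 l) //= ffunE eqxx coM_lmat eqxx mul1r [RHS](bigD1 l) //=.
by congr (_ * _); apply: eq_bigr => j /negPf jl; rewrite ffunE jl.
Qed.

End Multilinear.

Let coord (u : {ffun 'I_d -> 'M[A]_n}) : {ffun word -> k^o} :=
  [ffun w : word => \prod_j coM (w j) (u j)].

Let coord_multilinear : multilinear e coord.
Proof.
move=> u l c x y uC xC yC; apply/ffunP => w; rewrite !ffunE.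
rewrite (bigD1 l) //= [in X in _ = c *: X + _](bigD1 l) //= [in X in _ = _ + X](bigD1 l) //=.
rewrite !ffunE eqxx coM_lin mulrDl /GRing.scale /= mulrA.
by congr (_ * _ + _ * _); apply: eq_bigr => j /negPf jl; rewrite !ffunE jl.
Qed.

Lemma cfk_exists : exists h : {linear TP -> {ffun word -> k^o}},
  forall u, tupC e u -> h (tau u) = coord u.
Proof. by case: TP_tensor => _ univ _; case: (univ _ _ coord_multilinear). Qed.

(** The coefficients of an element in the basis of words. *)
Definition cfk (x : TP) : word -> k := projT1 (cid cfk_exists) x.

Lemma cfk_tau u w : tupC e u -> cfk (tau u) w = \prod_j coM (w j) (u j).
Proof. by move=> uC; rewrite /cfk; case: cid => h /= ->; rewrite ?ffunE. Qed.

Lemma cfk_lin w c x y : cfk (c *: x + y) w = c * cfk x w + cfk y w.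
Proof. by rewrite /cfk linearP !ffunE. Qed.
Lemma cfk0 w : cfk 0 w = 0.
Proof. exact: (form0 (f := fun x => cfk x w) (cfk_lin w)). Qed.
Lemma cfkZ w c x : cfk (c *: x) w = c * cfk x w.
Proof. exact: (formZ (f := fun x => cfk x w) (cfk_lin w)). Qed.
Lemma cfk_sumE w (J : Type) (r : seq J) (P : pred J) (f : J -> TP) :
  cfk (\sum_(u <- r | P u) f u) w = \sum_(u <- r | P u) cfk (f u) w.
Proof. exact: (form_sum (f := fun x => cfk x w) (cfk_lin w)). Qed.

Lemma tupC_word (w : word) : tupC e [ffun j => lmat (w j)].
Proof. by move=> j; rewrite ffunE; apply: matC_lmat. Qed.

Lemma cfk_tw w w' : cfk (tw w) w' = (w' == w)%:R.
Proof.
rewrite /tw cfk_tau; last exact: tupC_word.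
have [->|ne] := eqVneq w' w.
  by rewrite big1 // => j _; rewrite ffunE coM_lmat eqxx.
have [j wj] := neq_ffun ne.
by rewrite (bigD1 j) //= ffunE coM_lmat (negPf wj) mul0r.
Qed.

(** Both sides are linear and agree on pure tensors. *)
Lemma cfk_sum x : x = \sum_w cfk x w *: tw w.
Proof.
case: TP_tensor => tau_lin univ _.
have f_lin : linear (fun x => \sum_w cfk x w *: tw w).
  move=> c y z; rewrite scaler_sumr -big_split; apply: eq_bigr => w _ /=.
  by rewrite cfk_lin scalerDl scalerA.
have [f fE] := linear_packed f_lin.
have id_lin : linear (fun x : TP => x) by [].
have [f' f'E] := linear_packed id_lin.
have [_ uniq] := univ TP tau tau_lin.
rewrite [LHS]f'E [RHS]fE; apply: uniq => u uC; rewrite -fE -f'E.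
rewrite (multilinear_expand tau_lin uC); apply: eq_bigr => w _.
by rewrite cfk_sumE; congr (_ *: _); rewrite -cfk_tau // -cfk_sumE -(multilinear_expand tau_lin uC).
Qed.

Lemma cfk_inj x y : cfk x =1 cfk y -> x = y.
Proof. by move=> xy; rewrite (cfk_sum x) (cfk_sum y); apply: eq_bigr => w _; rewrite xy. Qed.

Lemma coM_mul l1 l2 l3 : coM l3 (lmat l1 *m lmat l2) = Gk l1 l2 l3.
Proof.
rewrite /coM /lmat /Gk mxE (bigD1 l1.2) //= !mxE eqxx andbT big1 ?addr0 => [|m ml]; last first.
  by rewrite !mxE (negPf ml) andbF !mulr0 mul0r.
case: (l3.1.2 == l1.1.2); case: (l1.2 == l2.1.2); case: (l3.2 == l2.2);
  by rewrite /= ?mulr0 ?mul0r ?mulr1 ?mul1r ?coA0.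
Qed.

Lemma cfkM x y w : cfk (x * y) w = star lpar Gk (cfk x) (cfk y) w.
Proof.
case: TP_tensor => _ _ tauM.
rewrite {1}(cfk_sum x) {1}(cfk_sum y) mulr_suml cfk_sumE; apply: eq_bigr => u _.
rewrite mulr_sumr cfk_sumE; apply: eq_bigr => v _.
rewrite -scalerAr -scalerAl !cfkZ /star_term.
have gr_word (w0 : word) (j : 'I_d) : exists m, matC_gr gr e m (lpar (w0 j)) ([ffun j => lmat (w0 j)] j).
  exists (deg gr (val (w0 j).1.1)).1; rewrite ffunE; split; first exact: matC_lmat.
  move=> r s; rewrite !mxE; case: (_ && _); rewrite ?mulr1 ?mulr0.
    exact: (gr_bprod A_super her).
  by case: A_super => -[sub _ _] _; case: (sub (deg gr (val (w0 j).1.1)).1 (lpar (w0 j))).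
rewrite (tauM _ _ _ _ (gr_word u) (gr_word v)) cfkZ cfk_tau; last first.
  move=> j; rewrite !ffunE => r s; rewrite mxE; apply: submodule_sum => [|m _].
    exact: (corner_submodule e_adapted).
  by apply: (corner_mul e_adapted); apply: matC_lmat.
have -> : \prod_j coM (w j) ([ffun j => [ffun j0 => lmat (u j0)] j *m [ffun j0 => lmat (v j0)] j] j)
    = \prod_j Gk (u j) (v j) (w j).
  by apply: eq_bigr => j _; rewrite !ffunE coM_mul.
have sgE : (-1) ^+ #|[set lj : 'I_d * 'I_d | [&& (lj.1 < lj.2)%N, lpar (u lj.2) & lpar (v lj.1)]]%SET|
    = (-1) ^+ koszul_sign (lpar \o u) (lpar \o v) :> k.
  rewrite -signr_odd; congr (_ ^+ _); congr (nat_of_bool _).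
  exact: (odd_koszul_parity (fun j => lpar (u j)) (fun j => lpar (v j))).
rewrite sgE; move: (cfk x u) (cfk y v) (\prod_(j < d) _) => a b c.
by move: ((-1) ^+ koszul_sign _ _) => s0; ring.
Qed.

(** ** The span of the elements eta as a lattice of coefficients *)

Local Notation val_word := (fun t : word =>
  [ffun j => (bprod (val (t j).1.1), (t j).1.2, (t j).2)] : triples A n d).

Lemma bprod_inj : injective (fun t : cidx => bprod (val t)).
Proof.
move=> t t' /(congr1 (coA her (val t))); rewrite !coA_bprod eqxx.
by case: eqP => [/val_inj //|_ /eqP]; rewrite oner_eq0.
Qed.

Lemma mem_products (Z W : I -> {fset A}) b :
  reflect (exists i x y, [/\ x \in Z i, y \in W i & b = x * y]) (b \in products Z W).
Proof.
rewrite /products; apply: (iffP (bigfcupP _ _ _ _)) => [[i _ /imfset2P[x xZ [y yW ->]]]|].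
  by exists i, x, y.
case=> i [x [y [xZ yW ->]]]; exists i; rewrite ?mem_index_enum //.
by apply/imfset2P; exists x => //; exists y.
Qed.

Lemma mem_BbarP b : reflect (exists t : cidx, b = bprod (val t)) (b \in Bbar Xb Yb).
Proof.
apply: (iffP (mem_products Xb Yb b)) => [[i [x [y [xb yb ->]]]]|[t ->]].
  have [_ _ sub _ _] := e_adapted; have [sX sY] := sub i.
  have tb : inb Xb Yb (mkb (fsubsetP sX _ xb) (fsubsetP sY _ yb)) by apply/andP; split.
  by exists (Sub _ tb); rewrite SubK.
by exists (lay (val t)), (bx (val t)), (by_ (val t)); have /andP[] := valP t; split.
Qed.

Lemma val_letter_eq (t : word) j l :
  ((val_word t) j == (bprod (val l.1.1), l.1.2, l.2)) = (t j == l).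
Proof.
rewrite ffunE; case: (t j) l => [[b r] s] [[b' r'] s'] /=; rewrite -!pair_eqE /pair_eq /=.
by rewrite -!pair_eqE /pair_eq /= (inj_eq bprod_inj).
Qed.

Lemma val_word_eq (t : word) i j : ((val_word t) i == (val_word t) j) = (t i == t j).
Proof. by rewrite [X in _ == X]ffunE val_letter_eq. Qed.

Lemma TriP (s : triples A n d) :
  Tri gr Xb Yb s <-> exists2 t : word, no_odd_repeat lpar t & s = val_word t.
Proof.
split=> [[s_b s_odd]|[t /no_odd_repeatP t_odd ->]]; last first.
  split=> [j|j l jl]; first by rewrite ffunE; apply/mem_BbarP; exists (t j).1.1.
  move/eqP; rewrite val_word_eq => /eqP tjl; rewrite ffunE (is_even_bprod A_super her).
  exact: t_odd jl tjl.
have /choice[b bE] j : exists t : cidx, (s j).1.1 = bprod (val t) by apply/mem_BbarP.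
pose t : word := [ffun j => (b j, (s j).1.2, (s j).2)].
have sE : s = val_word t.
  by apply/ffunP => j; rewrite !ffunE /= -bE; case: (s j) => [[]].
exists t => //; apply/no_odd_repeatP => j l jl tjl.
have := s_odd j l jl; rewrite sE => h; have /h : val_word t j = val_word t l.
  by apply/eqP; rewrite val_word_eq tjl.
by rewrite ffunE (is_even_bprod A_super her).
Qed.

Lemma shortest_rep_val (t : word) s : shortest_rep (val_word t) s = shortestb t s.
Proof.
apply: eq_forallb => r; congr (_ ==> _); rewrite inE.
apply/forallP/eqP => [tr|/ffunP tr j]; last by rewrite val_word_eq -[X in _ == X]tr ffunE.
by apply/ffunP => j; rewrite ffunE; apply/eqP; rewrite -val_word_eq tr.
Qed.

Lemma cfk_xi (t w : word) : cfk (xi_elt gr tau (val_word t)) w = xi lpar k t w.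
Proof.
rewrite /xi_elt cfk_sumE /xi; apply: eq_big => [s|s _]; first exact: shortest_rep_val.
rewrite /pure_act cfkZ; congr (_ * _).
  rewrite -signr_odd /odd_inversions; congr (_ ^+ _); congr (nat_of_bool _).
  rewrite -(odd_inversions_parity s (lpar \o t)); congr odd; apply: eq_card => -[i j].
  by rewrite !inE /= !ffunE !(is_odd_bprod A_super her).
have -> : tau [ffun j => (val_word t (s j)).1.1 *: delta_mx (val_word t (s j)).1.2 (val_word t (s j)).2]
    = tw (wact t s) by congr (tau _); apply/ffunP => j; rewrite !ffunE.
by rewrite cfk_tw eq_sym.
Qed.

Lemma eta_factor_val (t : word) : eta_factor gr Xb Yb (val_word t) = fac lcl t.
Proof.
rewrite /eta_factor /fac.
pose f b := (\prod_(r < n) \prod_(s < n) (#|[set j : 'I_d | val_word t j == (b, r, s)]%SET|)`!)%N.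
transitivity (\prod_(c : cidx | odd_odd gr (val c)) f (bprod (val c)))%N; last first.
  rewrite /f pair_big_dep pair_big_dep /=; apply: eq_big => [[[c r] s]|[[c r] s] _] /=.
    by rewrite !andbT.
  by congr (_`!); apply: eq_card => j; rewrite !inE -(val_letter_eq t j (c, r, s)).
rewrite -[RHS]big_filter -(big_map (fun c : cidx => bprod (val c)) predT f).
apply: perm_big; apply: uniq_perm; first exact: fset_uniq.
  by rewrite map_inj_uniq; [apply/filter_uniq/index_enum_uniq|exact: bprod_inj].
move=> b; apply/mem_products/mapP => [[i [x [y [xb yb ->]]]]|[c]]; last first.
  rewrite mem_filter mem_index_enum andbT => /andP[ox oy] ->.
  have /andP[xb yb] := valP c.
  exists (lay (val c)), (bx (val c)), (by_ (val c)); split=> //.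
    by rewrite !inE /= xb (is_odd_bx A_super her).
  by rewrite !inE /= yb (is_odd_by A_super her).
move: xb yb; rewrite !inE /= => /andP[xb xo] /andP[yb yo].
have /mem_BbarP[c cE] : x * y \in Bbar Xb Yb by apply/mem_products; exists i, x, y.
have [_ _ sub _ _] := e_adapted; have [sX sY] := sub i.
have cE' : val c = mkb (fsubsetP sX _ xb) (fsubsetP sY _ yb).
  have := congr1 (coA her (val c)) cE; rewrite -[x * y]/(bprod (mkb (fsubsetP sX _ xb) (fsubsetP sY _ yb))).
  rewrite !coA_bprod eqxx; case: eqP => // _ /esym/eqP; by rewrite oner_eq0.
exists c; last by rewrite cE.
rewrite mem_filter mem_index_enum andbT /odd_odd -(is_odd_bx A_super her) -(is_odd_by A_super her).
by rewrite cE' /=; apply/andP.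
Qed.

Lemma cfk_eta (t w : word) :
  cfk (eta_elt gr Xb Yb tau (val_word t)) w = (fac lcl t)%:R * xi lpar k t w.
Proof. by rewrite /eta_elt cfkZ eta_factor_val cfk_xi. Qed.

Hypothesis char0 : [pchar k] =i pred0.

Lemma T_alg_eta (t : word) : no_odd_repeat lpar t ->
  T_alg gr Xb Yb tau (eta_elt gr Xb Yb tau (val_word t)).
Proof. by move=> t_odd; apply: sub_span; exists (val_word t) => //; apply/TriP; exists t. Qed.

Lemma T_alg_decomposition x (q : word -> k) : sign_invariant lpar (cfk x) ->
  (forall w, cfk x w = (fac lcl w)%:R * q w) ->
  x = \sum_(t | no_odd_repeat lpar t && (orbit_rep t == t)) q t *: eta_elt gr Xb Yb tau (val_word t).
Proof.
move=> x_inv xq; apply: cfk_inj => w.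
rewrite (eta_lattice_decomposition char0 x_inv xq) cfk_sumE.
by apply: eq_bigr => t _; rewrite cfkZ cfk_eta.
Qed.

(** In this form the algebra can be handled without its spanning set: products
    and divisibility are visible in the coefficients. *)
Lemma T_algP x : T_alg gr Xb Yb tau x <-> eta_lattice lpar lcl (cfk x).
Proof.
split=> [|[x_inv /choice[q xq]]]; last first.
  rewrite (T_alg_decomposition x_inv xq); apply: submodule_sum => [|t /andP[t_odd _]].
    exact: span_submodule.
  by apply: submoduleZ; [exact: span_submodule|exact: T_alg_eta].
have sub : submodule [set x | eta_lattice lpar lcl (cfk x)].
  split; first by rewrite /= (funext cfk0); apply: eta_lattice0.
  move=> c y z yT zT; rewrite /= (funext (fun w => cfk_lin w c y z)).
  exact: eta_lattice_lin.
apply: (submodule_sub_span sub) => _ [_ /TriP[t t_odd ->] ->] /=.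
have [h1 h2] := eta_in_lattice lcl k t_odd; split=> [w s|w]; last by rewrite cfk_eta; apply: h2.
by rewrite !cfk_eta h1.
Qed.

End TensorPower.

(** * Extension of scalars of the lattice *)

Section ExtendedLattice.
Variables (k : idomainType) (F : fieldType) (phi : {rmorphism k -> F}).
Hypothesis char0 : [pchar k] =i pred0.
Variables (d : nat) (L : finType) (par cl : L -> bool) (Gk : L -> L -> L -> k).
Hypothesis par_G : forall a b c, Gk a b c != 0 -> par c = par a (+) par b.
Hypothesis cl_G : forall a b c, cl c -> Gk a b c != 0 -> [|| cl a, cl b, par a | par b].
Hypothesis cl_par : forall c, cl c -> ~~ par c.
Local Notation word := {ffun 'I_d -> L}.

Variables (TP : algType k) (cfk : TP -> word -> k).
Hypothesis cfk_lin : forall w c x y, cfk (c *: x + y) w = c * cfk x w + cfk y w.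
Hypothesis cfk_inj : forall x y, cfk x =1 cfk y -> x = y.
Hypothesis cfkM : forall x y w, cfk (x * y) w = star par Gk (cfk x) (cfk y) w.
Variable xel : word -> TP.
Hypothesis xelE : forall t, cfk (xel t) =1 xi par k t.
Variable T : set TP.
Hypothesis T_P : forall x, T x <-> eta_lattice par cl (cfk x).
Variables (TF : algType F) (iota : TP -> TF).
Hypothesis T_ext : is_algebra_base_change phi T iota.

Let cfk0 w : cfk 0 w = 0.
Proof. exact: (form0 (f := fun x => cfk x w) (cfk_lin w)). Qed.
Let cfkZ w c x : cfk (c *: x) w = c * cfk x w.
Proof. exact: (formZ (f := fun x => cfk x w) (cfk_lin w)). Qed.
Let cfk_sumE w (J : Type) (r : seq J) (P : pred J) (f : J -> TP) :
  cfk (\sum_(u <- r | P u) f u) w = \sum_(u <- r | P u) cfk (f u) w.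
Proof. exact: (form_sum (f := fun x => cfk x w) (cfk_lin w)). Qed.

Lemma T_submodule : submodule T.
Proof.
split; first by apply/T_P; rewrite (funext cfk0); apply: eta_lattice0.
move=> c y z /T_P yT /T_P zT; apply/T_P; rewrite (funext (fun w => cfk_lin w c y z)).
exact: eta_lattice_lin.
Qed.

Lemma T_mul x y : T x -> T y -> T (x * y).
Proof.
move=> /T_P Tx /T_P Ty; apply/T_P; rewrite (funext (cfkM x y)).
exact: star_lattice.
Qed.

Let iotaM x y : T x -> T y -> iota (x * y) = iota x * iota y. Proof. exact: T_ext.2. Qed.
Let semi : semilinear_on phi T iota. Proof. by case: T_ext => -[]. Qed.

Lemma fac_gt0 (w : word) : (0 < fac cl w)%N.
Proof. by apply: prodn_gt0 => l; apply: fact_gt0. Qed.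

Lemma fac_neq0 (w : word) : (fac cl w)%:R != 0 :> k.
Proof. exact/natr_neq0/fac_gt0. Qed.

Definition eta (t : word) : TP := (fac cl t)%:R *: xel t.

Lemma T_eta t : no_odd_repeat par t -> T (eta t).
Proof.
move=> t_odd; apply/T_P; have [h1 h2] := eta_in_lattice cl k t_odd.
by split=> [w s|w]; rewrite /eta !cfkZ !xelE; [apply: h1|apply: h2].
Qed.

(** The coordinates of an element of [T] are its coefficients divided by the
    factorials. *)
Definition quot (w : word) (x : TP) : k :=
  if pselect (exists q, cfk x w = (fac cl w)%:R * q) is left h then projT1 (cid h) else 0.

Lemma quotE w x : T x -> cfk x w = (fac cl w)%:R * quot w x.
Proof. by move=> /T_P[_ /(_ w) h]; rewrite /quot; case: pselect => // h'; case: cid. Qed.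

Definition eidx : finType := {t : word | no_odd_repeat par t && (orbit_rep t == t)}.

Lemma eidx_odd (t : eidx) : no_odd_repeat par (val t).
Proof. by have /andP[] := valP t. Qed.

Lemma T_sum x : T x -> x = \sum_(t : eidx) quot (val t) x *: eta (val t).
Proof.
move=> Tx; apply: cfk_inj => w; have /T_P[x_inv _] := Tx.
rewrite (eta_lattice_decomposition char0 x_inv (fun w => quotE w Tx)) cfk_sumE.
rewrite (reindex_omap (val : eidx -> word) insub) => [|t tb]; last by rewrite insubT.
apply: eq_big => [t|t _]; first by rewrite (valP t) valK eqxx.
by rewrite !cfkZ xelE.
Qed.

Lemma co_exists : exists co' : eidx -> TF -> F,
  [/\ forall j c x y, co' j (c *: x + y) = c * co' j x + co' j y,
      forall j x, T x -> co' j (iota x) = phi (quot (val j) x) &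
      forall y, y = \sum_j co' j y *: iota (eta (val j))].
Proof.
apply: (free_base_change T_submodule semi T_ext.1) => [t|x|j c x y Tx Ty].
- exact/T_eta/eidx_odd.
- exact: T_sum.
apply: (mulfI (fac_neq0 (val j))); rewrite mulrDr mulrCA -!quotE //.
by case: T_submodule => _; apply.
Qed.

Let co := projT1 (cid co_exists).
Let co_lin j c x y : co j (c *: x + y) = c * co j x + co j y.
Proof. by rewrite /co; case: cid => ? []. Qed.
Let co_iota j x : T x -> co j (iota x) = phi (quot (val j) x).
Proof. by rewrite /co; case: cid => ? [? + ?] /=; apply. Qed.
Let co_sum y : y = \sum_j co j y *: iota (eta (val j)).
Proof. by rewrite /co; case: cid => ? [? ?] /=; apply. Qed.

Definition cf (y : TF) (w : word) : F := \sum_j co j y * phi (cfk (eta (val j)) w).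

Lemma cf_lin c x y w : cf (c *: x + y) w = c * cf x w + cf y w.
Proof.
rewrite /cf mulr_sumr -big_split; apply: eq_bigr => j _ /=.
by rewrite co_lin mulrDl mulrA.
Qed.

Lemma cf_iota x w : T x -> cf (iota x) w = phi (cfk x w).
Proof.
move=> Tx; rewrite [in RHS](T_sum Tx) cfk_sumE rmorph_sum; apply: eq_bigr => j _.
by rewrite co_iota // [in RHS]cfkZ rmorphM.
Qed.

Let cf0 w : cf 0 w = 0.
Proof. exact: (form0 (f := fun x => cf x w) (fun c x y => cf_lin c x y w)). Qed.
Let cfZ w c x : cf (c *: x) w = c * cf x w.
Proof. exact: (formZ (f := fun x => cf x w) (fun c x y => cf_lin c x y w)). Qed.
Let cf_sumE w (J : Type) (r : seq J) (P : pred J) (f : J -> TF) :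
  cf (\sum_(u <- r | P u) f u) w = \sum_(u <- r | P u) cf (f u) w.
Proof. exact: (form_sum (f := fun x => cf x w) (fun c x y => cf_lin c x y w)). Qed.

Local Notation GF := (fun a b c => phi (Gk a b c)).

Lemma cfM x y w : cf (x * y) w = star par GF (cf x) (cf y) w.
Proof.
rewrite [in LHS](co_sum x) [in LHS](co_sum y) mulr_suml cf_sumE.
transitivity (\sum_i \sum_j (co i x * co j y) *
    star par GF (fun w => phi (cfk (eta (val i)) w)) (fun w => phi (cfk (eta (val j)) w)) w).
  apply: eq_bigr => i _; rewrite mulr_sumr cf_sumE; apply: eq_bigr => j _.
  have Ti := T_eta (eidx_odd i); have Tj := T_eta (eidx_odd j).
  rewrite -scalerAr -scalerAl !cfZ -iotaM // cf_iota; last exact: T_mul.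
  rewrite cfkM; transitivity (co i x * co j y *
      phi (star par Gk (cfk (eta (val i))) (cfk (eta (val j))) w)).
    by move: (phi _) (co i x) (co j y) => *; ring.
  congr (_ * _).
  rewrite /star rmorph_sum; apply: eq_bigr => u _; rewrite rmorph_sum; apply: eq_bigr => v _.
  by rewrite /star_term !rmorphM rmorph_prod rmorph_sign.
rewrite /star; under eq_bigr do under eq_bigr do rewrite mulr_sumr.
under eq_bigr do rewrite exchange_big.
rewrite exchange_big; apply: eq_bigr => u _ /=.
under eq_bigr do under eq_bigr do rewrite mulr_sumr.
under eq_bigr do rewrite exchange_big.
rewrite exchange_big; apply: eq_bigr => v _ /=.
rewrite /star_term /cf big_distrlr /= mulr_suml mulr_sumr; apply: eq_bigr => i _.
rewrite mulr_suml mulr_sumr; apply: eq_bigr => j _.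
move: ((-1) ^+ _) (phi _) (phi _) (\prod_j _) (co i x) (co j y) => *; ring.
Qed.

(** The coefficients of an element all vanish when its coordinates are supported
    on words whose factorials vanish in [F]. Products of [m] such elements come
    from [p ^ m] times invariant tensors, and a fixed multiple of every invariant
    tensor lies in [T]: so these elements are nilpotent. *)
Definition big_fac : nat := (\prod_(l | cl l) d`!)%N.

Lemma fac_dvd (w : word) : (fac cl w %| big_fac)%N.
Proof.
apply: (big_ind2 (fun a b => a %| b)%N) => // [a b a' b'|l _]; first exact: dvdn_mul.
have : (#|[set j | w j == l]%SET| <= d)%N by rewrite -[X in (_ <= X)%N]card_ord max_card.
move: #|_| => m md; rewrite -(bin_fact md) mulnCA; exact: dvdn_mulr.
Qed.

Lemma invariant_multiple s : sign_invariant par (cfk s) -> T (big_fac%:R *: s).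
Proof.
move=> s_inv; apply/T_P; split=> [w g|w]; first by rewrite !cfkZ s_inv mulrCA.
rewrite cfkZ; have /dvdnP[q ->] := fac_dvd w; exists (q%:R * cfk s w).
by rewrite natrM mulrA [q%:R * _]mulrC.
Qed.

Definition p_deep (p a : nat) : set TF := span [set y | exists x s,
  [/\ T x, sign_invariant par (cfk s), x = (p ^ a)%:R *: s & y = iota x]].

Lemma p_deepM p a b x y : p_deep p a x -> p_deep p b y -> p_deep p (a + b) (x * y).
Proof.
move=> [s [sE ->]] [t [tE ->]]; rewrite mulr_suml big_seq.
apply: submodule_sum => [|u us]; first exact: span_submodule.
rewrite mulr_sumr big_seq; apply: submodule_sum => [|v vt]; first exact: span_submodule.
have [x1 [s1 [T1 inv1 e1 ->]]] := sE u us; have [x2 [s2 [T2 inv2 e2 ->]]] := tE v vt.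
rewrite -scalerAl -scalerAr; do 2!(apply: submoduleZ; first exact: span_submodule).
apply: sub_span; exists (x1 * x2), (s1 * s2); split; [exact: T_mul| | |by rewrite iotaM].
  have inv12 := star_sign_invariant par_G inv1 inv2.
  by move=> w g; rewrite !cfkM; apply: inv12.
by rewrite e1 e2 -scalerAl -scalerAr scalerA -natrM expnD.
Qed.

(** Write [big_fac = p ^ a * q] with [q] prime to [p]. Then [q * p ^ (a + 1)]
    times an invariant tensor is [p] times an element of [T], and [q] is
    invertible in [F]. *)
Lemma p_deep_bound p : p \in [pchar F] -> p_deep p (logn p big_fac).+1 `<=` [set 0].
Proof.
move=> pF; have p_pr := pcharf_prime pF; set a := logn p big_fac.
have zero_sub : submodule ([set 0] : set TF).
  by split=> // c x y -> ->; rewrite scaler0 addr0.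
apply: (submodule_sub_span zero_sub) => _ [x [s [Tx s_inv xE ->]]] /=.
have D_gt0 : (0 < big_fac)%N by apply: prodn_gt0 => l; apply: fact_gt0.
have [q q_p DE] := pfactor_coprime p_pr D_gt0.
have q0 : phi q%:R != 0.
  rewrite rmorph_nat -(dvdn_pcharf pF); move: q_p; by rewrite prime_coprime.
apply/eqP; rewrite -(inj_eq (can_inj (scalerK q0))) scaler0.
rewrite -(semilinearZ T_submodule semi q%:R Tx) xE.
have -> : q%:R *: ((p ^ a.+1)%:R *: s) = p%:R *: (big_fac%:R *: s).
  by rewrite !scalerA -!natrM; congr (_%:R *: _); rewrite [in RHS]DE expnS -/a; lia.
rewrite (semilinearZ T_submodule semi) ?rmorph_nat ?(pcharf0 pF) ?scale0r //.
exact: invariant_multiple.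
Qed.

Lemma xi_rep (j j' : eidx) : xi par k (val j) (val j') = (j == j')%:R.
Proof.
have [<-|jj'] := eqVneq j j'.
  rewrite -[X in xi _ _ _ X](wact1 (val j)) xi_wact; last exact: eidx_odd.
  by rewrite inversion_sign_fixed // => a _; rewrite perm1.
apply: xi_out => s; apply: contraNneq jj' => e; apply/eqP/val_inj.
have /andP[_ /eqP r] := valP j; have /andP[_ /eqP r'] := valP j'.
by rewrite -r -r' -e orbit_rep_wact.
Qed.

(** An idempotent is the product of any number of copies of itself. *)
Lemma cf_detects y : y * y = y -> (forall w, cf y w = 0) -> y = 0.
Proof.
move=> yy y0; have coE j : co j y * (fac cl (val j))%:R = 0.
  have := y0 (val j); rewrite /cf (bigD1 j) //= big1 ?addr0 => [|i ij].
    by rewrite /eta cfkZ xelE xi_rep eqxx mulr1 rmorph_nat.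
  by rewrite /eta cfkZ xelE xi_rep (negPf ij) mulr0 rmorph0 mulr0.
have [[j0 fj0]|no] := pselect (exists j : eidx, (fac cl (val j))%:R = 0 :> F); last first.
  rewrite (co_sum y) big1 // => j _; have /eqP := coE j; rewrite mulf_eq0 => /orP[/eqP ->|/eqP h].
    by rewrite scale0r.
  by case: no; exists j.
have [p pF] : exists p, p \in [pchar F].
  have /(natf0_pchar (fac_gt0 _)) [p] : (fac cl (val j0))%:R == 0 :> F by rewrite fj0.
  by exists p.
have y1 : p_deep p 1 y.
  rewrite (co_sum y); apply: submodule_sum => [|j _]; first exact: span_submodule.
  have /eqP := coE j; rewrite mulf_eq0 => /orP[/eqP ->|].
    by rewrite scale0r; case: (span_submodule [set y | exists x s,
      [/\ T x, sign_invariant par (cfk s), x = (p ^ 1)%:R *: s & y = iota x]]).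
  rewrite -(dvdn_pcharf pF) => /dvdnP[m mE].
  apply: submoduleZ; first exact: span_submodule.
  apply: sub_span; exists (eta (val j)), (m%:R *: xel (val j)); split=> //.
  - exact/T_eta/eidx_odd.
  - by move=> w s; rewrite !cfkZ !xelE (xi_sign_invariant _ (eidx_odd j)) mulrCA.
  - by rewrite /eta mE expn1 scalerA -natrM mulnC.
have ym m : p_deep p m.+1 y.
  by elim: m => // m IH; rewrite -yy -add1n; apply: p_deepM.
exact: p_deep_bound pF _ (ym _).
Qed.

Lemma extended_coefficients : exists cf : TF -> word -> F,
  [/\ forall c x y w, cf (c *: x + y) w = c * cf x w + cf y w,
      forall x w, T x -> cf (iota x) w = phi (cfk x w),
      forall x y w, cf (x * y) w = star par (fun a b c => phi (Gk a b c)) (cf x) (cf y) w &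
      forall y, y * y = y -> (forall w, cf y w = 0) -> y = 0].
Proof.
by exists cf; split; [exact: cf_lin|exact: cf_iota|exact: cfM|exact: cf_detects].
Qed.

End ExtendedLattice.

(** * Central idempotents *)

(** The algebra [C] enters through a homogeneous basis [bC] with coordinates
    [cd] and a block diagonal matrix representation [rho] with blocks given by
    [col]. *)
Section CentralIdempotents.
Variables (F : fieldType) (C : algType F) (B : finType).
Variables (bC : B -> C) (cd : B -> C -> F) (par : B -> bool).
Hypothesis cd_lin : forall j c x y, cd j (c *: x + y) = c * cd j x + cd j y.
Hypothesis cd_sum : forall w, w = \sum_j cd j w *: bC j.
Hypothesis cd_bC : forall t u, cd t (bC u) = (t == u)%:R.
Hypothesis par_mul : forall t u v, cd v (bC t * bC u) != 0 -> par v = par t (+) par u.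

Variables (J : eqType) (Q : finType) (col : Q -> J) (rho : C -> Q -> Q -> F).
Hypothesis rho_lin : forall c a b p q, rho (c *: a + b) p q = c * rho a p q + rho b p q.
Hypothesis rhoM : forall a b p q, rho (a * b) p q = \sum_s rho a p s * rho b s q.
Hypothesis rho1 : forall p q, rho 1 p q = (p == q)%:R.
Hypothesis rho_col : forall c p q, rho c p q != 0 -> col p = col q.
Hypothesis rho_unit : forall p q, col p = col q ->
  exists s, forall p' q', rho s p' q' = (p' == p)%:R * (q' == q)%:R.
Hypothesis rho_odd : forall t, par t -> forall p q, rho (bC t) p q = 0.
Hypothesis rho_nilpotent : exists M, forall s : seq C,
  (forall x, x \in s -> forall p q, rho x p q = 0) -> (M <= size s)%N -> \prod_(x <- s) x = 0.
Hypothesis rho_idempotent : forall c : C, (forall a, c * a = a * c) ->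
  (forall p q, rho (c * c - c) p q = 0) ->
  (forall p q, rho c p q = 0) \/ (forall p q, rho c p q = (p == q)%:R).
Hypothesis two_col : exists p q : Q, col p != col q.

Let cd0 j : cd j 0 = 0.
Proof. exact: (form0 (cd_lin j)). Qed.
Let cdD j x y : cd j (x + y) = cd j x + cd j y.
Proof. exact: (formD (cd_lin j)). Qed.
Let cdZ j c x : cd j (c *: x) = c * cd j x.
Proof. exact: (formZ (cd_lin j)). Qed.
Let cd_sumE j (K : Type) (r : seq K) (P : pred K) (f : K -> C) :
  cd j (\sum_(u <- r | P u) f u) = \sum_(u <- r | P u) cd j (f u).
Proof. exact: (form_sum (cd_lin j)). Qed.
Let cd_inj x y : (forall j, cd j x = cd j y) -> x = y.
Proof. by move=> xy; rewrite (cd_sum x) (cd_sum y); apply: eq_bigr => j _; rewrite xy. Qed.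

Let rho0 p q : rho 0 p q = 0.
Proof. exact: (form0 (f := fun c => rho c p q) (fun c a b => rho_lin c a b p q)). Qed.
Let rhoD a b p q : rho (a + b) p q = rho a p q + rho b p q.
Proof. exact: (formD (f := fun c => rho c p q) (fun c a b => rho_lin c a b p q)). Qed.
Let rhoZ c a p q : rho (c *: a) p q = c * rho a p q.
Proof. exact: (formZ (f := fun c => rho c p q) (fun c a b => rho_lin c a b p q)). Qed.
Let rhoB a b p q : rho (a - b) p q = rho a p q - rho b p q.
Proof. by rewrite rhoD -scaleN1r rhoZ mulN1r. Qed.
Let rho_sumE p q (K : Type) (r : seq K) (P : pred K) (f : K -> C) :
  rho (\sum_(u <- r | P u) f u) p q = \sum_(u <- r | P u) rho (f u) p q.
Proof. exact: (form_sum (f := fun c => rho c p q) (fun c a b => rho_lin c a b p q)). Qed.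

(** An element annihilated by the radical on both sides lies in the radical:
    otherwise it generates a block that is a full matrix algebra, and there
    are several blocks. *)
Lemma socle_in_radical u :
  (forall a, (forall p q, rho a p q = 0) -> a * u = 0 /\ u * a = 0) ->
  forall p q, rho u p q = 0.
Proof.
move=> u_ann p q; apply: contrapT => /eqP nz; have pq := rho_col nz.
have /choice[s1 s1E] (a : Q) : exists s, col a = col p ->
    forall p' q', rho s p' q' = (p' == a)%:R * (q' == p)%:R.
  have [ap|ap] := eqVneq (col a) (col p); last by exists 0 => e; rewrite e eqxx in ap.
  by have [s sE] := rho_unit ap; exists s.
have /choice[s2 s2E] (a : Q) : exists s, col a = col p ->
    forall p' q', rho s p' q' = (p' == q)%:R * (q' == a)%:R.
  have [ap|ap] := eqVneq (col a) (col p); last by exists 0 => e; rewrite e eqxx in ap.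
  have qa : col q = col a by rewrite -pq ap.
  by have [s sE] := rho_unit qa; exists s.
(* [s] acts as the identity on the block of [p] and by zero elsewhere; being a
   combination of multiples of [u], it is annihilated by the radical too. *)
pose s := \sum_(a | col a == col p) (rho u p q)^-1 *: (s1 a * u * s2 a).
have sE p' q' : rho s p' q' = ((col p' == col p) && (p' == q'))%:R.
  rewrite rho_sumE; have key a : col a == col p ->
      rho ((rho u p q)^-1 *: (s1 a * u * s2 a)) p' q' = (p' == a)%:R * (q' == a)%:R.
    move=> /eqP ap; rewrite rhoZ rhoM (bigD1 q) //= big1 ?addr0 => [|b bq]; last first.
      by rewrite s2E // (negPf bq) mul0r mulr0.
    rewrite s2E // eqxx mul1r rhoM (bigD1 p) //= big1 ?addr0 => [|b bp]; last first.
      by rewrite s1E // (negPf bp) mulr0 mul0r.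
    by rewrite s1E // eqxx mulr1 -mulrA mulrCA mulKf.
  under eq_bigr => a ap do rewrite key //.
  have [p'p|p'p] := boolP (col p' == col p); last first.
    rewrite big1 // => a ap; case: eqP => [p'a|]; last by rewrite mul0r.
    by rewrite p'a ap in p'p.
  rewrite (bigD1 p') //= eqxx mul1r big1 ?addr0 1?eq_sym // => a /andP[_ /negPf ap'].
  by rewrite eq_sym ap' mul0r.
have s_ann a : (forall p q, rho a p q = 0) -> a * s = 0 /\ s * a = 0.
  move=> a0; rewrite mulr_sumr mulr_suml; split; apply: big1 => b _.
    rewrite -scalerAr !mulrA; have as0 p' q' : rho (a * s1 b) p' q' = 0.
      by rewrite rhoM big1 // => c _; rewrite a0 mul0r.
    by rewrite (u_ann _ as0).1 mul0r scaler0.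
  rewrite -scalerAl -!mulrA; have sa0 p' q' : rho (s2 b * a) p' q' = 0.
    by rewrite rhoM big1 // => c _; rewrite a0 mulr0.
  by rewrite (u_ann _ sa0).2 mulr0 scaler0.
have ssE p' q' : rho (s * s) p' q' = rho s p' q'.
  rewrite rhoM (bigD1 p') //= big1 ?addr0 => [|c cp]; last first.
    by rewrite sE [p' == c]eq_sym (negPf cp) andbF mul0r.
  by rewrite !sE eqxx andbT; case: (_ == col p); rewrite ?mul1r ?mul0r.
have sss : s * s * s = s * s.
  apply/eqP; rewrite -subr_eq0 -mulrA -mulrBr; apply/eqP/(s_ann _ _).2 => p' q'.
  by rewrite rhoB ssE subrr.
(* Annihilated by the radical, the square of [s] is a central idempotent. *)
pose f := s * s.
have ff : f * f = f by rewrite /f mulrA sss sss.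
have fE p' q' : rho f p' q' = ((col p' == col p) && (p' == q'))%:R by rewrite ssE sE.
have f_ann a : (forall p q, rho a p q = 0) -> a * f = 0 /\ f * a = 0.
  by move=> a0; rewrite /f mulrA (s_ann _ a0).1 -mulrA (s_ann _ a0).2 mul0r mulr0.
have fc a : f * a = a * f.
  have comm0 p' q' : rho (f * a - a * f) p' q' = 0.
    rewrite rhoB !rhoM (bigD1 p') //= big1 ?addr0 => [|c cp]; last first.
      by rewrite fE [p' == c]eq_sym (negPf cp) andbF mul0r.
    rewrite (bigD1 q') //= big1 ?addr0 => [|c cq]; last by rewrite fE (negPf cq) andbF mulr0.
    rewrite !fE !eqxx !andbT; have [->|/rho_col ->] := eqVneq (rho a p' q') 0; first by rewrite mulr0 mul0r subrr.
    by rewrite mulrC subrr.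
  have [e1 e2] := f_ann _ comm0.
  move/eqP: e2; rewrite mulrBr mulrA ff mulrA subr_eq0 => /eqP ->.
  by move/eqP: e1; rewrite mulrBl -[a * f * f]mulrA ff subr_eq0 => /eqP.
have idem0 p' q' : rho (f * f - f) p' q' = 0 by rewrite ff subrr.
have [f0|f1] := rho_idempotent fc idem0.
  by have := fE p p; rewrite f0 !eqxx => /esym/eqP; rewrite oner_eq0.
have [p1 [p2 p12]] := two_col.
have all_col p' : col p' = col p.
  apply/eqP; have := fE p' p'; rewrite f1 !eqxx andbT.
  by case: (_ == _) => // /eqP; rewrite oner_eq0.
by rewrite !all_col eqxx in p12.
Qed.

Variables (n d : nat) (le_dn : (d <= n)%N).
Local Notation letter := (B * 'I_n * 'I_n)%type.
Local Notation word := {ffun 'I_d -> letter}.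
Local Notation fB := {ffun 'I_d -> B}.
Local Notation fN := {ffun 'I_d -> 'I_n}.
Local Notation fQ := {ffun 'I_d -> Q}.

Let lpar (l : letter) := par l.1.1.
Definition GF (l1 l2 l3 : letter) : F :=
  ((l1.2 == l2.1.2) && (l3.1.2 == l1.1.2) && (l3.2 == l2.2))%:R * cd l3.1.1 (bC l1.1.1 * bC l2.1.1).

Definition mkw (b : fB) (R S : fN) : word := [ffun j => (b j, R j, S j)].
(** The coefficients of [x] in the matrix positions [(R j, S j)], as those of
    an element of the tensor power of [C]. *)
Definition restr (x : word -> F) (R S : fN) (b : fB) : F := x (mkw b R S).

Lemma sum_word (V : nmodType) (f : word -> V) :
  \sum_w f w = \sum_b \sum_R \sum_S f (mkw b R S).
Proof.
rewrite pair_bigA pair_bigA /=.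
pose h (p : fB * fN * fN) := mkw p.1.1 p.1.2 p.2.
rewrite (reindex h) //; exists (fun w : word => ([ffun j => (w j).1.1], [ffun j => (w j).1.2], [ffun j => (w j).2])).
  by move=> [[b R] S] _; congr (_, _, _); apply/ffunP => j; rewrite /h /= !ffunE.
by move=> w _; apply/ffunP => j; rewrite /h /= !ffunE; case: (w j) => [[]].
Qed.

Definition bterm (x y : fB -> F) (b b1 b2 : fB) : F :=
  (-1) ^+ koszul_sign (par \o b1) (par \o b2) *
  (x b1 * y b2 * \prod_j cd (b j) (bC (b1 j) * bC (b2 j))).
(** The multiplication of the super tensor power of [C]. *)
Definition bstar (x y : fB -> F) (b : fB) : F := \sum_b1 \sum_b2 bterm x y b b1 b2.

Lemma prod_GF b b1 b2 R R1 T1 R2 S2 S :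
  \prod_j GF (mkw b1 R1 T1 j) (mkw b2 R2 S2 j) (mkw b R S j)
  = ([&& R2 == T1, R1 == R & S2 == S])%:R * \prod_j cd (b j) (bC (b1 j) * bC (b2 j)).
Proof.
rewrite /GF; under eq_bigr do rewrite !ffunE /=.
rewrite big_split /=; congr (_ * _).
have [/and3P[/eqP -> /eqP -> /eqP ->]|] := boolP [&& _, _ & _].
  by rewrite big1 // => j _; rewrite !eqxx.
by rewrite !negb_and => /or3P[] /neq_ffun[j Uj]; rewrite (bigD1 j) //=;
  rewrite ?[T1 j == _]eq_sym ?[R j == _]eq_sym ?[S j == _]eq_sym (negPf Uj) ?andbF /= mul0r.
Qed.

Lemma star_restr x y R S b : restr (star lpar GF x y) R S b
  = \sum_T bstar (restr x R T) (restr y T S) b.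
Proof.
rewrite /restr /star sum_word.
transitivity (\sum_b1 \sum_T \sum_b2 bterm (restr x R T) (restr y T S) b b1 b2); last first.
  by rewrite exchange_big.
apply: eq_bigr => b1 _; rewrite (bigD1 R) //= [X in _ + X]big1 ?addr0 => [|R1 R1R]; last first.
  apply: big1 => T _; apply: big1 => w _; rewrite /star_term [w](_ : _ = mkw [ffun j => (w j).1.1] [ffun j => (w j).1.2] [ffun j => (w j).2]); last first.
    by apply/ffunP => j; rewrite !ffunE; case: (w j) => [[]].
  by rewrite prod_GF (negPf R1R) andbF mul0r !mulr0.
apply: eq_bigr => T _; rewrite sum_word; apply: eq_bigr => b2 _.
rewrite (bigD1 T) //= [X in _ + X]big1 ?addr0 => [|R2 R2T]; last first.
  by apply: big1 => S2 _; rewrite /star_term prod_GF (negPf R2T) mul0r !mulr0.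
rewrite (bigD1 S) //= [X in _ + X]big1 ?addr0 => [|S2 S2S]; last first.
  by rewrite /star_term prod_GF (negPf S2S) !andbF mul0r !mulr0.
rewrite /star_term prod_GF !eqxx mul1r /bterm /restr; congr (_ ^+ _ * _); congr (nat_of_bool _).
by apply: eq_koszul_sign => j; rewrite /= /lpar ffunE.
Qed.

(** The action on a tensor product of modules of which the one in slot [r] is
    regular and the other ones are semisimple. Odd elements act by zero on the
    latter, so that no Koszul signs survive. *)
Section Slot.
Variable r : 'I_d.

Definition kk (j : 'I_d) (c : C) (p q : Q) : F := if j == r then (p == q)%:R else rho c p q.

Lemma kkM j a b p q : kk j (a * b) p q = \sum_s kk j a p s * kk j b s q.
Proof.
rewrite /kk; case: eqP => // _; rewrite (bigD1 p) //= eqxx mul1r big1 ?addr0 // => s sp.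
by rewrite eq_sym (negPf sp) mul0r.
Qed.

(** The matrix entries of the action. An entry is an element of [C], which acts
    in the regular slot; that slot has no matrix indices of its own, and [kk]
    forces the indices there to agree. *)
Definition en (a : fB -> F) (p q : fQ) : C :=
  \sum_b (a b * \prod_j kk j (bC (b j)) (p j) (q j)) *: bC (b r).

Lemma en_sum (K : finType) (P : pred K) (f : K -> fB -> F) p q :
  en (fun b => \sum_(u | P u) f u b) p q = \sum_(u | P u) en (f u) p q.
Proof.
rewrite /en exchange_big; apply: eq_bigr => b _ /=.
by rewrite mulr_suml scaler_suml.
Qed.

Lemma enZ c (a : fB -> F) p q : en (fun b => c * a b) p q = c *: en a p q.
Proof. by rewrite /en scaler_sumr; apply: eq_bigr => b _; rewrite scalerA mulrA. Qed.

Lemma eq_en (a a' : fB -> F) p q : a =1 a' -> en a p q = en a' p q.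
Proof. by move=> aa; apply: eq_bigr => b _; rewrite aa. Qed.

(** Distributing the expansions of all the slots. *)
Lemma en_distr (a : 'I_d -> C) (p q : fQ) :
  \sum_(b : fB) ((\prod_j cd (b j) (a j)) * \prod_j kk j (bC (b j)) (p j) (q j)) *: bC (b r)
  = (\prod_j kk j (a j) (p j) (q j)) *: a r.
Proof.
apply: cd_inj => c; rewrite cd_sumE cdZ.
pose h j t := cd t (a j) * (kk j (bC t) (p j) (q j) * (if j == r then (c == t)%:R else 1)).
transitivity (\sum_(b : fB) \prod_j h j (b j)).
  apply: eq_bigr => b _; rewrite cdZ cd_bC /h !big_split /= -mulrA; congr (_ * (_ * _)).
  by rewrite (bigD1 r) //= eqxx big1 ?mulr1 // => j /negPf ->.
rewrite -(bigA_distr_bigA h) (bigD1 r) //= [in RHS](bigD1 r) //= [RHS]mulrAC; congr (_ * _).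
  rewrite /h /kk eqxx (bigD1 c) //= eqxx mulr1 big1 ?addr0 1?mulrC // => t tc.
  by rewrite [c == t]eq_sym (negPf tc) !mulr0.
apply: eq_bigr => j /negPf jr; rewrite /h /kk jr {2}(cd_sum (a j)) rho_sumE.
by apply: eq_bigr => t _; rewrite rhoZ mulr1.
Qed.

(** A Koszul sign requires odd factors in two different slots, and one of them
    acts by zero. *)
Lemma en_bstar x y p q : en (bstar x y) p q = \sum_s en x p s * en y s q.
Proof.
transitivity (\sum_b1 \sum_b2 (x b1 * y b2 * \prod_j kk j (bC (b1 j) * bC (b2 j)) (p j) (q j))
    *: (bC (b1 r) * bC (b2 r))).
  rewrite /bstar en_sum; apply: eq_bigr => b1 _; rewrite en_sum; apply: eq_bigr => b2 _.
  transitivity (((-1) ^+ koszul_sign (par \o b1) (par \o b2) * (x b1 * y b2)) *: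
     ((\prod_j kk j (bC (b1 j) * bC (b2 j)) (p j) (q j)) *: (bC (b1 r) * bC (b2 r)))).
    rewrite -(en_distr (fun j => bC (b1 j) * bC (b2 j))) scaler_sumr.
    by apply: eq_bigr => b _; rewrite scalerA /bterm !mulrA.
  rewrite scalerA; case k1 : (koszul_sign _ _); last by rewrite mul1r.
  have [i [j [ij /= pj pi]]] := koszul_sign_witness k1.
  have kk0 l (t u : B) : l != r -> par t || par u -> forall p q, kk l (bC t * bC u) p q = 0.
    move=> /negPf lr tu p' q'; rewrite /kk lr rhoM big1 // => s _.
    by case/orP: tu => /rho_odd ->; rewrite ?mul0r ?mulr0.
  suff -> : \prod_j kk j (bC (b1 j) * bC (b2 j)) (p j) (q j) = 0 by rewrite !mulr0 !scale0r.
  have [ir|ir] := eqVneq i r.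
    by rewrite (bigD1 j) //= kk0 ?mul0r -?ir ?pj // eq_sym.
  by rewrite (bigD1 i) //= kk0 ?mul0r // pi orbT.
symmetry; rewrite /en; under eq_bigr do rewrite mulr_suml.
rewrite exchange_big; apply: eq_bigr => b1 _ /=.
under eq_bigr do rewrite mulr_sumr.
rewrite exchange_big; apply: eq_bigr => b2 _ /=.
transitivity (\sum_(s : fQ) (x b1 * y b2 * \prod_j (kk j (bC (b1 j)) (p j) (s j) * kk j (bC (b2 j)) (s j) (q j)))
    *: (bC (b1 r) * bC (b2 r))).
  apply: eq_bigr => s _; rewrite -scalerAl -scalerAr scalerA big_split /=; congr (_ *: _).
  by rewrite mulrACA.
rewrite -scaler_suml -mulr_sumr; congr ((_ * _) *: _).
rewrite -(bigA_distr_bigA (fun j s => kk j (bC (b1 j)) (p j) s * kk j (bC (b2 j)) s (q j))).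
by apply: eq_bigr => j _; rewrite kkM.
Qed.

End Slot.

(** The action with all the slots semisimple. *)
Definition sm (a : fB -> F) (p q : fQ) : F := \sum_b a b * \prod_j rho (bC (b j)) (p j) (q j).

Definition setq (p : fQ) (r : 'I_d) (m : Q) : fQ := [ffun j => if j == r then m else p j].

Lemma setq_id p r : setq p r (p r) = p.
Proof. by apply/ffunP => j; rewrite ffunE; case: eqP => // ->. Qed.

Lemma rho_en r a p q m m' :
  rho (en r a p q) m m' = (p r == q r)%:R * sm a (setq p r m) (setq q r m').
Proof.
rewrite /en rho_sumE /sm mulr_sumr; apply: eq_bigr => b _; rewrite rhoZ [RHS]mulrCA -mulrA.
congr (_ * _); rewrite (bigD1 r) //= [in RHS](bigD1 r) //= !ffunE !eqxx {1}/kk eqxx -mulrA.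
congr (_ * _); rewrite mulrC; congr (_ * _).
by apply: eq_bigr => j /negPf jr; rewrite /kk jr !ffunE jr.
Qed.

Lemma sm_en r a p q : sm a p q = rho (en r a p (setq q r (p r))) (p r) (q r).
Proof.
have e1 : setq q r (p r) r = p r by rewrite ffunE eqxx.
rewrite rho_en e1 eqxx mul1r setq_id; congr (sm a p _).
by apply/ffunP => j; rewrite !ffunE; case: eqP => // ->.
Qed.

Variables (TF : algType F) (cf : TF -> word -> F).
Hypothesis cf_lin : forall c x y w, cf (c *: x + y) w = c * cf x w + cf y w.
Hypothesis cfM : forall x y w, cf (x * y) w = star lpar GF (cf x) (cf y) w.

Definition om : fN := [ffun j => widen_ord le_dn j].

Hypothesis orbit_sums : forall (b : fB) (R : fN), exists x : TF, forall w,
  cf x w = \sum_(s : 'S_d) (-1) ^+ inversion_sign s (par \o b) * (wact (mkw b R om) s == w)%:R.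
Hypothesis cf_detects : forall y, y * y = y -> (forall w, cf y w = 0) -> y = 0.

Lemma om_perm (s : 'S_d) : (wact om s == om) = (s == 1%g).
Proof.
apply/eqP/eqP => [/ffunP e|->]; last exact: wact1.
apply/permP => j; have := e j; rewrite !ffunE perm1 => /(congr1 val) /= sj; exact: val_inj.
Qed.

Let cf0 w : cf 0 w = 0.
Proof. exact: (form0 (f := fun x => cf x w) (fun c x y => cf_lin c x y w)). Qed.
Let cfZ c x w : cf (c *: x) w = c * cf x w.
Proof. exact: (formZ (f := fun x => cf x w) (fun c x y => cf_lin c x y w)). Qed.
Let cf_sumE w (K : Type) (r : seq K) (P : pred K) (f : K -> TF) :
  cf (\sum_(u <- r | P u) f u) w = \sum_(u <- r | P u) cf (f u) w.
Proof. exact: (form_sum (f := fun x => cf x w) (fun c x y => cf_lin c x y w)). Qed.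

Lemma en_mul r x y R' S p q : en r (restr (cf (x * y)) R' S) p q
  = \sum_T \sum_s en r (restr (cf x) R' T) p s * en r (restr (cf y) T S) s q.
Proof.
transitivity (en r (fun b => \sum_T bstar (restr (cf x) R' T) (restr (cf y) T S) b) p q).
  by apply: eq_en => b; rewrite -star_restr /restr cfM.
by rewrite en_sum; apply: eq_bigr => T _; apply: en_bstar.
Qed.

(** The entries of the pure tensor with factors [a (s j)]. *)
Definition kx r (a : 'I_d -> C) (s : 'S_d) (p q : fQ) : C :=
  (\prod_j kk r j (a (s j)) (p j) (q j)) *: a (s r).

Lemma en_point r b0 p q :
  en r (fun b => (b0 == b)%:R) p q = (\prod_j kk r j (bC (b0 j)) (p j) (q j)) *: bC (b0 r).
Proof.
rewrite /en (bigD1 b0) //= eqxx mul1r [X in _ + X]big1 ?addr0 // => b bb.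
by rewrite eq_sym (negPf bb) mul0r scale0r.
Qed.

(** As in [en_bstar], a nontrivial sign comes with an odd factor in a
    semisimple slot. *)
Lemma sign_kx r (b : fB) (s : 'S_d) p q :
  (-1) ^+ inversion_sign s (par \o b) *: kx r (bC \o b) s p q = kx r (bC \o b) s p q.
Proof.
case k1 : (inversion_sign _ _); last by rewrite scale1r.
have [i [j [ij /= pj pi]]] := inversion_sign_witness k1.
suff -> : kx r (bC \o b) s p q = 0 by rewrite scaler0.
have kk0 l : par (b l) -> (s^-1)%g l != r -> kx r (bC \o b) s p q = 0.
  move=> pl /negPf lr; rewrite /kx (bigD1 ((s^-1)%g l)) //= /kk lr permKV.
  by rewrite rho_odd // mul0r scale0r.
have [ir|ir] := eqVneq ((s^-1)%g i) r; last exact: kk0 pi ir.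
by apply: kk0 pj _; rewrite -ir (inj_eq perm_inj) eq_sym.
Qed.

(** The orbit sums of the tensors with factors [a j] in the matrix positions
    [(R j, om j)]: the positions [om j] are distinct, which is where [d <= n]
    is used. *)
Lemma orbit_element (a : 'I_d -> C) (R : fN) : exists x : TF, forall r R' S p q,
  en r (restr (cf x) R' S) p q
  = \sum_(s : 'S_d) ((R' == wact R s) && (S == wact om s))%:R *: kx r a s p q.
Proof.
have [x xE] := choice (fun b => orbit_sums b R).
exists (\sum_(b : fB) (\prod_j cd (b j) (a j)) *: x b) => r R' S p q.
have E1 (b : fB) : en r (restr (cf (x b)) R' S) p q
    = \sum_(s : 'S_d) ((R' == wact R s) && (S == wact om s))%:R *: kx r (bC \o b) s p q.
  transitivity (en r (fun b' => \sum_(s : 'S_d) ((-1) ^+ inversion_sign s (par \o b) *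
      ((R' == wact R s) && (S == wact om s))%:R) * (wact b s == b')%:R) p q).
    apply: eq_en => b'; rewrite /restr xE; apply: eq_bigr => s _; rewrite -mulrA -natrM mulnb.
    congr (_ * (nat_of_bool _)%:R); apply/eqP/andP.
      move=> /ffunP e; split; last by apply/eqP/ffunP => j; have := e j; rewrite !ffunE => -[].
      by apply/andP; split; apply/eqP/ffunP => j; have := e j; rewrite !ffunE => -[].
    by case=> /andP[/eqP -> /eqP ->] /eqP <-; apply/ffunP => j; rewrite !ffunE.
  rewrite en_sum; apply: eq_bigr => s _; rewrite enZ en_point mulrC -scalerA; congr (_ *: _).
  rewrite -[RHS]sign_kx /kx /=; congr (_ *: (_ *: bC _)); last by rewrite ffunE.
  by apply: eq_bigr => j _; rewrite ffunE.
transitivity (\sum_(b : fB) (\prod_j cd (b j) (a j)) *: en r (restr (cf (x b)) R' S) p q).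
  rewrite -(eq_bigr _ (fun b _ => enZ r _ _ p q)) -en_sum; apply: eq_en => b.
  by rewrite /restr cf_sumE; apply: eq_bigr => b' _; rewrite cfZ.
under eq_bigr do rewrite E1 scaler_sumr.
rewrite exchange_big; apply: eq_bigr => s _ /=.
under eq_bigr do rewrite scalerA [_ * _%:R]mulrC -scalerA.
rewrite -scaler_sumr; congr (_ *: _).
rewrite /kx -(en_distr r (fun j => a (s j))) [RHS](reindex_inj (@wact_inj _ _ s)) /=.
apply: eq_bigr => b _; rewrite scalerA; congr (_ * _ *: bC _); last by rewrite ffunE.
  by rewrite (reindex_perm s); apply: eq_bigr => j _; rewrite ffunE.
by apply: eq_bigr => j _; rewrite ffunE.
Qed.

Definition one_slot (c : C) (j0 : 'I_d) : 'I_d -> C := fun j => if j == j0 then c else 1.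

Lemma prod_delta_fun (K : eqType) (p q : {ffun 'I_d -> K}) : \prod_j (p j == q j)%:R = (p == q)%:R :> F.
Proof.
have [->|pq] := eqVneq p q; first by rewrite big1 // => j _; rewrite eqxx.
have [j pqj] := neq_ffun pq.
by rewrite (bigD1 j) //= (negPf pqj) mul0r.
Qed.

Lemma kx_one r (s : 'S_d) p q : kx r (fun _ => 1) s p q = (p == q)%:R *: 1.
Proof.
rewrite /kx; congr (_ *: _); rewrite -prod_delta_fun; apply: eq_bigr => j _.
by rewrite /kk; case: eqP => // _; rewrite rho1.
Qed.

Lemma kx_slot r c (s : 'S_d) p q : kx r (one_slot c (s r)) s p q = (p == q)%:R *: c.
Proof.
rewrite /kx {2}/one_slot eqxx; congr (_ *: _); rewrite -prod_delta_fun; apply: eq_bigr => j _.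
by rewrite /kk; case: eqP => // /eqP jr; rewrite /one_slot (inj_eq perm_inj) (negPf jr) rho1.
Qed.

Lemma kx_radical r c j0 (s : 'S_d) p q : (forall p q, rho c p q = 0) -> s r != j0 ->
  kx r (one_slot c j0) s p q = 0.
Proof.
move=> c0 sr; have jr : ((s^-1)%g j0 == r) = false.
  by apply/negP => /eqP e; case/eqP: sr; rewrite -e permKV.
rewrite /kx (bigD1 ((s^-1)%g j0)) //= /kk jr permKV /one_slot eqxx.
by rewrite c0 mul0r scale0r.
Qed.

Lemma kx_unit r c j m p q : j != r ->
  (forall p' q', rho c p' q' = (p' == m)%:R * (q' == m)%:R) ->
  kx r (one_slot c j) 1%g p q = ((p == q) && (p j == m))%:R *: 1.
Proof.
move=> jr cE; rewrite /kx perm1 {2}/one_slot eq_sym (negPf jr); congr (_ *: _).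
rewrite -mulnb natrM -prod_delta_fun (bigD1 j) //= [in RHS](bigD1 j) //= perm1.
rewrite {1}/kk (negPf jr) {1}/one_slot eqxx cE [RHS]mulrAC; congr (_ * _).
  by rewrite -!natrM !mulnb; case: (eqVneq (p j) m) => [->|]; rewrite ?andbT ?andbF 1?eq_sym.
apply: eq_bigr => i ij; rewrite perm1 /kk /one_slot (negPf ij).
by case: eqP => // _; rewrite rho1.
Qed.

Section Central.
Variable z : TF.
Hypothesis z_central : forall x, z * x = x * z.

Local Notation Z r R S p q := (en r (restr (cf z) R S) p q).

(** Compare the entries of [z * x] and [x * z] in the column positions [om],
    for the orbit sum [x]. On the left only the trivial permutation
    contributes, because the positions [om j] are distinct. *)
Lemma central_commutation r (a : 'I_d -> C) (R R' : fN) p q :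
  \sum_s Z r R' R p s * kx r a 1%g s q
  = \sum_(s : 'S_d) (R' == wact R s)%:R *: \sum_t kx r a s p t * Z r (wact om s) om t q.
Proof.
have [x xE] := orbit_element a R.
have := congr1 (fun y => en r (restr (cf y) R' om) p q) (z_central x).
rewrite !en_mul => E.
transitivity (\sum_T \sum_s Z r R' T p s * en r (restr (cf x) T om) s q).
  rewrite (bigD1 R) //= [X in _ = _ + X]big1 ?addr0 => [|T TR].
    apply: eq_bigr => s _; congr (_ * _); rewrite xE (bigD1 1%g) //= !wact1 !eqxx scale1r.
    by rewrite big1 ?addr0 // => t t1; rewrite [om == _]eq_sym om_perm (negPf t1) andbF scale0r.
  rewrite big1 // => s _; rewrite xE big1 ?mulr0 // => t _.
  rewrite [om == _]eq_sym om_perm; case: (eqVneq t 1%g) => [->|]; last by rewrite andbF scale0r.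
  by rewrite wact1 (negPf TR) scale0r.
rewrite E; under eq_bigr do under eq_bigr do rewrite xE mulr_suml.
under eq_bigr do rewrite exchange_big.
rewrite exchange_big; apply: eq_bigr => s _ /=.
rewrite (bigD1 (wact om s)) //= [X in _ + X]big1 ?addr0 => [|T TR]; last first.
  by rewrite big1 // => t _; rewrite (negPf TR) andbF scale0r mul0r.
by rewrite scaler_sumr; apply: eq_bigr => t _; rewrite eqxx andbT scalerAl.
Qed.

(** By centrality the whole action is determined by its values in the weight
    space where the matrix positions are distinct. *)
Lemma central_weight r R R' p q :
  Z r R' R p q = \sum_(s : 'S_d) (R' == wact R s)%:R *: Z r (wact om s) om p q.
Proof.
have := central_commutation r (fun _ => 1) R R' p q.
rewrite (bigD1 q) //= kx_one eqxx scale1r mulr1 big1 ?addr0 => [->|s sq]; last first.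
  by rewrite kx_one (negPf sq) scale0r mulr0.
apply: eq_bigr => s _; rewrite (bigD1 p) //= kx_one eqxx scale1r mul1r big1 ?addr0 // => t tp.
by rewrite kx_one eq_sym (negPf tp) scale0r mul0r.
Qed.

(** Passing [z] permutes the slots by [s]. *)
Lemma central_slot r (a : 'I_d -> C) (s : 'S_d) p q :
  \sum_t Z r (wact om s) om p t * kx r a 1%g t q
  = \sum_t kx r a s p t * Z r (wact om s) om t q.
Proof.
rewrite central_commutation (bigD1 s) //= eqxx scale1r [X in _ + X]big1 ?addr0 // => t ts.
have -> : (wact om s == wact om t) = false.
  apply/negP => /eqP st; case/eqP: ts; have := om_perm (s^-1 * t)%g.
  by rewrite -wactM -st wactM mulVg wact1 eqxx => /esym/eqP/(canRL (mulKVg _)); rewrite mulg1.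
by rewrite scale0r.
Qed.

(** Since [s] moves [r], passing an element of the radical in slot [r] through
    [z] brings it to a semisimple slot, where it acts by zero. *)
Lemma rho_moved r (s : 'S_d) p q : s r != r ->
  forall m m', rho (Z r (wact om s) om p q) m m' = 0.
Proof.
move=> sr; apply: socle_in_radical => c c0; split.
  have := central_slot r (one_slot c (s r)) s p q.
  rewrite big1 => [|t _]; last by rewrite kx_radical ?mulr0 // perm1 eq_sym.
  rewrite (bigD1 p) //= kx_slot eqxx scale1r big1 ?addr0 // => t tp.
  by rewrite kx_slot eq_sym (negPf tp) scale0r mul0r.
have := central_slot r (one_slot c r) s p q.
rewrite [RHS]big1 => [|t _]; last by rewrite kx_radical ?mul0r.
have k1 t : kx r (one_slot c r) 1%g t q = (t == q)%:R *: c.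
  by have := kx_slot r c 1%g t q; rewrite perm1.
rewrite (bigD1 q) //= k1 eqxx scale1r big1 ?addr0 // => t tq.
by rewrite k1 (negPf tq) scale0r mulr0.
Qed.

Lemma sm_moved (s : 'S_d) p q : s != 1%g -> sm (restr (cf z) (wact om s) om) p q = 0.
Proof.
move=> s1; have [r sr] : exists r, s r != r.
  apply: contrapT => no; case/eqP: s1; apply/permP => j; rewrite perm1.
  by apply: contrapT => /eqP sj; apply: no; exists j.
by rewrite (sm_en r) rho_moved.
Qed.

Lemma rho_nontrivial r (s : 'S_d) p q m m' : s != 1%g -> rho (Z r (wact om s) om p q) m m' = 0.
Proof. by move=> s1; rewrite rho_en sm_moved // mulr0. Qed.

Lemma Z1_central r p q a : Z r om om p q * a = a * Z r om om p q.
Proof.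
have := central_slot r (one_slot a r) 1%g p q; rewrite !wact1.
have k1 t t' : kx r (one_slot a r) 1%g t t' = (t == t')%:R *: a.
  by have := kx_slot r a 1%g t t'; rewrite perm1.
rewrite (bigD1 q) //= k1 eqxx scale1r big1 ?addr0 => [->|t tq]; last first.
  by rewrite k1 (negPf tq) scale0r mulr0.
rewrite (bigD1 p) //= k1 eqxx scale1r big1 ?addr0 // => t tp.
by rewrite k1 eq_sym (negPf tp) scale0r mul0r.
Qed.

(** [z] commutes with the projection to the vector [q j] in slot [j]. *)
Lemma Z1_diagonal r p q : p != q -> Z r om om p q = 0.
Proof.
move=> pq; have [j pqj] := neq_ffun pq.
have [jr|jr] := eqVneq j r.
  rewrite /en big1 // => b _; rewrite (bigD1 j) //= /kk jr eqxx -jr (negPf pqj).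
  by rewrite mul0r mulr0 scale0r.
have [c cE] := rho_unit (erefl (col (q j))).
have := central_slot r (one_slot c j) 1%g p q; rewrite !wact1.
rewrite (bigD1 q) //= (kx_unit _ _ jr cE) !eqxx scale1r mulr1 big1 ?addr0 => [->|t tq]; last first.
  by rewrite (kx_unit _ _ jr cE) (negPf tq) scale0r mulr0.
by rewrite big1 // => t _; rewrite (kx_unit _ _ jr cE) (negPf pqj) andbF scale0r mul0r.
Qed.

(** By [central_weight] only the permutations [s] matter, and by [sm_moved]
    only the trivial one. *)
Lemma rho_weight r R R' p q m m' :
  rho (Z r R' R p q) m m' = (R' == R)%:R * rho (Z r om om p q) m m'.
Proof.
rewrite central_weight rho_sumE (bigD1 1%g) //= !wact1 rhoZ big1 ?addr0 // => s s1.
by rewrite rhoZ rho_nontrivial ?mulr0.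
Qed.

End Central.

Lemma rho_product r z z' p m m' : (forall x, z * x = x * z) -> (forall x, z' * x = x * z') ->
  rho (en r (restr (cf (z * z')) om om) p p) m m'
  = rho (en r (restr (cf z) om om) p p * en r (restr (cf z') om om) p p) m m'.
Proof.
move=> cz cz'; rewrite en_mul rho_sumE (bigD1 om) //= [X in _ + X]big1 ?addr0 => [|T Tom].
  rewrite (bigD1 p) //= [X in _ + X]big1 ?addr0 // => s sp.
  by rewrite (Z1_diagonal cz) ?mul0r // eq_sym.
rewrite rho_sumE big1 // => s _; rewrite rhoM big1 // => l _.
by rewrite (rho_weight cz) eq_sym (negPf Tom) !mul0r.
Qed.

(** A central idempotent acts by [0] or [1] on the tensor products of simple
    modules: one slot at a time, it acts through a central idempotent of [C]. *)
Lemma central_idempotent_scalar z (r0 : 'I_d) : (forall x, z * x = x * z) -> z * z = z ->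
  exists2 g : F, g = 0 \/ g = 1 & forall R' R p q,
    sm (restr (cf z) R' R) p q = ((R' == R) && (p == q))%:R * g.
Proof.
move=> cz zz; pose c r p := en r (restr (cf z) om om) p p.
have cE r p : (forall m m', rho (c r p) m m' = 0) \/ (forall m m', rho (c r p) m m' = (m == m')%:R).
  apply: rho_idempotent => [a|m m']; first exact: Z1_central.
  by rewrite rhoB /c -(rho_product r p m m' cz cz) zz subrr.
have smE r p m m' : sm (restr (cf z) om om) (setq p r m) (setq p r m') = rho (c r p) m m'.
  by rewrite /c rho_en eqxx mul1r.
have off p q : p != q -> sm (restr (cf z) om om) p q = 0.
  move=> pq; have [j pqj] := neq_ffun pq.
  rewrite (sm_en j); have [<-|ne] := eqVneq p (setq q j (p j)); last first.
    by rewrite Z1_diagonal // rho0.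
  by have [h|h] := cE j p; rewrite -/(c j p) h // (negPf pqj).
pose gam p := sm (restr (cf z) om om) p p.
have gam_set p r m : gam (setq p r m) = gam p.
  rewrite /gam smE -{2 3}(setq_id p r) smE.
  by have [h|h] := cE r p; rewrite !h ?eqxx.
have gam_const p p' : gam p = gam p'.
  (* Replace the coordinates of [p'] by those of [p] one after the other. *)
  pose mix k : fQ := [ffun j : 'I_d => if (j < k)%N then p j else p' j].
  have step k : (k <= d)%N -> gam (mix k) = gam p'.
    elim: k => [_|k IH kd].
      by congr gam; apply/ffunP => j; rewrite ffunE.
    rewrite -(IH (ltnW kd)) -(gam_set (mix k) (Ordinal kd) (p (Ordinal kd))).
    congr gam; apply/ffunP => j; rewrite !ffunE ltnS leq_eqVlt.
    case: (eqVneq j (Ordinal kd)) => [->|jk]; first by rewrite /= eqxx.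
    by rewrite (_ : (j == k :> nat) = false) //; apply/negP => /eqP jk'; case/eqP: jk; apply: val_inj.
  rewrite -(step d) //; congr gam; apply/ffunP => j; by rewrite ffunE ltn_ord.
have [p0 _] := two_col; pose pp : fQ := [ffun _ => p0].
exists (gam pp).
  have -> : gam pp = rho (c r0 pp) (pp r0) (pp r0) by rewrite -smE setq_id.
  by have [h|h] := cE r0 pp; rewrite h ?eqxx; [left|right].
move=> R' R p q; have -> : sm (restr (cf z) R' R) p q
    = (R' == R)%:R * sm (restr (cf z) om om) p q.
  by rewrite (sm_en r0) [in RHS](sm_en r0) (rho_weight cz).
rewrite -mulnb natrM -mulrA; congr (_ * _).
have [->|pq] := eqVneq p q; last by rewrite mul0r off.
by rewrite mul1r; apply: gam_const.
Qed.

(** ** Idempotents acting by zero on the semisimple tensor products *)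

Definition homog (e : bool) (c : C) : Prop := forall b, cd b c != 0 -> par b = e.
Definition radical (c : C) : Prop := forall p q, rho c p q = 0.
(** The zeroth power is the whole algebra, whereas the empty product is only
    [1]. *)
Definition radical_power (m : nat) (c : C) : Prop :=
  m = 0%N \/ exists s : seq C, [/\ size s = m, forall x, x \in s -> radical x & c = \prod_(x <- s) x].

Lemma radical_mull a c : radical c -> radical (a * c).
Proof. by move=> c0 p q; rewrite rhoM big1 // => s _; rewrite c0 mulr0. Qed.

Lemma radical_mulr a c : radical c -> radical (c * a).
Proof. by move=> c0 p q; rewrite rhoM big1 // => s _; rewrite c0 mul0r. Qed.

Lemma radical_powerM m m' a b :
  radical_power m a -> radical_power m' b -> radical_power (m + m') (a * b).
Proof.
case=> [->|[s [<- s0 ->]]].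
  case=> [->|[[|x s'] [<- s'0 ->]]]; [by left|by left|right].
  exists (a * x :: s'); split=> [//|y|]; last by rewrite !big_cons mulrA.
  rewrite inE => /orP[/eqP ->|ys]; last by apply: s'0; rewrite inE ys orbT.
  by apply: radical_mull; apply: s'0; rewrite mem_head.
case=> [->|[s' [<- s'0 ->]]].
  case/lastP: s s0 => [|s x] s0; [by left|right].
  exists (rcons s (x * b)); split=> [|y|]; first by rewrite !size_rcons addn0.
    rewrite mem_rcons inE => /orP[/eqP ->|ys].
      by apply: radical_mulr; apply: s0; rewrite mem_rcons mem_head.
    by apply: s0; rewrite mem_rcons inE ys orbT.
  by rewrite -!cats1 !big_cat !big_seq1 /= mulrA.
right; exists (s ++ s'); split=> [|y|]; [by rewrite size_cat| |by rewrite big_cat].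
by rewrite mem_cat => /orP[/s0|/s'0].
Qed.

Lemma homogM e e' a b : homog e a -> homog e' b -> homog (e (+) e') (a * b).
Proof.
move=> ha hb v nz; apply: contrapT => no; case/eqP: nz.
rewrite (cd_sum a) mulr_suml cd_sumE big1 // => t _.
rewrite (cd_sum b) mulr_sumr cd_sumE big1 // => u _.
rewrite -scalerAr -scalerAl !cdZ.
have [->|ta] := eqVneq (cd t a) 0; first by rewrite mul0r mulr0.
have [->|ub] := eqVneq (cd u b) 0; first by rewrite mul0r.
have [->|/par_mul nz] := eqVneq (cd v (bC t * bC u)) 0; first by rewrite !mulr0.
by case: no; rewrite nz (ha _ ta) (hb _ ub).
Qed.

Local Notation fC := {ffun 'I_d -> C}.
Definition pure (u : fC) (b : fB) : F := \prod_j cd (b j) (u j).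

(** Homogeneity of the factors makes the product of two pure tensors pure, up
    to a sign. *)
Definition deep_tensor (m : nat) (u : fC) : Prop :=
  (exists e : 'I_d -> bool, forall j, homog (e j) (u j)) /\
  exists2 w : 'I_d -> nat, (forall j, radical_power (w j) (u j)) & (m <= \sum_j w j)%N.

Definition deep_span (m : nat) (a : fB -> F) : Prop :=
  exists2 s : seq (F * fC), (forall e, e \in s -> deep_tensor m e.2) &
    forall b, a b = \sum_(e <- s) e.1 * pure e.2 b.

Lemma bstar_pure (e e' : 'I_d -> bool) (u v : fC) b :
  (forall j, homog (e j) (u j)) -> (forall j, homog (e' j) (v j)) ->
  bstar (pure u) (pure v) b = (-1) ^+ koszul_sign e e' * pure [ffun j => u j * v j] b.
Proof.
move=> hu hv; rewrite /bstar /bterm.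
transitivity ((-1) ^+ koszul_sign e e' * \sum_(b1 : fB) \sum_(b2 : fB)
    \prod_j (cd (b1 j) (u j) * (cd (b2 j) (v j) * cd (b j) (bC (b1 j) * bC (b2 j))))).
  rewrite mulr_sumr; apply: eq_bigr => b1 _; rewrite mulr_sumr; apply: eq_bigr => b2 _.
  rewrite !big_split /= -!mulrA.
  have [u0|] := eqVneq (pure u b1) 0; first by rewrite -/(pure u b1) u0 !mul0r !mulr0.
  have [v0|] := eqVneq (pure v b2) 0; first by rewrite -/(pure v b2) v0 !mul0r !mulr0.
  move=> nv nu; congr (_ ^+ _ * _); congr (nat_of_bool _); apply: eq_koszul_sign => j /=.
    by apply: hu; apply: contraNneq nu => z; rewrite /pure (bigD1 j) //= z mul0r.
  by apply: hv; apply: contraNneq nv => z; rewrite /pure (bigD1 j) //= z mul0r.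
congr (_ * _); rewrite /pure.
transitivity (\sum_(b1 : fB) \prod_j \sum_t (cd (b1 j) (u j) *
    (cd t (v j) * cd (b j) (bC (b1 j) * bC t)))).
  by apply: eq_bigr => b1 _; rewrite bigA_distr_bigA.
rewrite -(bigA_distr_bigA (fun j t' => \sum_t (cd t' (u j) * (cd t (v j) * cd (b j) (bC t' * bC t))))).
apply: eq_bigr => j _; rewrite ffunE {2}(cd_sum (u j)) mulr_suml cd_sumE.
apply: eq_bigr => t' _; rewrite {2}(cd_sum (v j)) mulr_sumr cd_sumE.
by apply: eq_bigr => t _; rewrite -scalerAr -scalerAl !cdZ mulrCA.
Qed.

Lemma deep_spanD m (K : eqType) (r : seq K) (P : pred K) (f : K -> fB -> F) :
  (forall i, P i -> deep_span m (f i)) -> deep_span m (fun b => \sum_(i <- r | P i) f i b).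
Proof.
move=> fm; elim: r => [|i r [s sm_ sE]]; first by exists [::] => // b; rewrite !big_nil.
case Pi : (P i); last by exists s => // b; rewrite big_cons Pi.
have [s' s'm s'E] := fm i Pi; exists (s' ++ s) => [u|b].
  by rewrite mem_cat => /orP[/s'm|/sm_].
by rewrite big_cons Pi big_cat /= s'E sE.
Qed.

Lemma deep_spanZ m c (f : fB -> F) : deep_span m f -> deep_span m (fun b => c * f b).
Proof.
case=> s sm_ sE; exists [seq (c * u.1, u.2) | u <- s] => [u /mapP[u' /sm_ ? ->] //|b].
by rewrite sE big_map mulr_sumr; apply: eq_bigr => u _; rewrite mulrA.
Qed.

Lemma deep_tensor_span m u : deep_tensor m u -> deep_span m (pure u).
Proof.
move=> um; exists [:: (1, u)] => [u'|b]; first by rewrite inE => /eqP ->.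
by rewrite big_seq1 mul1r.
Qed.

Lemma eq_deep_span m f f' : f =1 f' -> deep_span m f -> deep_span m f'.
Proof. by move=> ff [s sm_ sE]; exists s => // b; rewrite -ff sE. Qed.

Lemma deep_bstar m m' x y : deep_span m x -> deep_span m' y -> deep_span (m + m') (bstar x y).
Proof.
move=> [s sm_ sE] [s' s'm s'E].
have E b : bstar x y b = \sum_(u <- s) \sum_(v <- s') (u.1 * v.1) * bstar (pure u.2) (pure v.2) b.
  rewrite /bstar /bterm; under [RHS]eq_bigr do under eq_bigr do rewrite mulr_sumr.
  under [RHS]eq_bigr do rewrite exchange_big.
  rewrite [RHS]exchange_big; apply: eq_bigr => b1 _ /=.
  under [RHS]eq_bigr do under eq_bigr do rewrite mulr_sumr.
  under [RHS]eq_bigr do rewrite exchange_big.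
  rewrite [RHS]exchange_big; apply: eq_bigr => b2 _ /=.
  rewrite sE s'E big_distrlr mulr_suml mulr_sumr; apply: eq_bigr => u _ /=.
  rewrite mulr_suml mulr_sumr; apply: eq_bigr => v _.
  move: ((-1) ^+ _) (pure u.2 b1) (pure v.2 b2) (\prod_j _) (u.1) (v.1) => *; ring.
apply: (eq_deep_span (fun b => esym (E b))).
have {E}E : (fun b => \sum_(u <- s) \sum_(v <- s') (u.1 * v.1) * bstar (pure u.2) (pure v.2) b)
   =1 (fun b => \sum_(u <- s | u \in s) \sum_(v <- s' | v \in s') (u.1 * v.1) * bstar (pure u.2) (pure v.2) b).
  by move=> b; rewrite big_seq; apply: eq_bigr => u _; rewrite big_seq.
apply: (eq_deep_span (fun b => esym (E b))).
apply: deep_spanD => u us; apply: deep_spanD => v vs; apply: deep_spanZ.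
have [[eu hu] [wu ru lu]] := sm_ u us; have [[ev hv] [wv rv lv]] := s'm v vs.
apply: (eq_deep_span (fun b => esym (bstar_pure b hu hv))); apply/deep_spanZ/deep_tensor_span.
split; first by exists (fun j => eu j (+) ev j) => j; rewrite ffunE; apply: homogM.
exists (fun j => wu j + wv j)%N => [j|]; first by rewrite ffunE; apply: radical_powerM.
by rewrite big_split leq_add.
Qed.

(** If the exponents add up to more than [d * M], one factor lies in a power of
    the radical beyond the [M]-th. *)
Lemma deep_span_bound : exists M, forall a, deep_span M a -> forall b, a b = 0.
Proof.
have [M nil] := rho_nilpotent; exists (d * M).+1 => a [s sm_ sE] b; rewrite sE big_seq big1 // => u us.
have [_ [w rw lw]] := sm_ u us.
have [j wj] : exists j, (M < w j)%N.
  apply: contrapT => no; move: lw; rewrite ltnNge => /negP; apply.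
  rewrite -[X in (X * _)%N]card_ord -sum_nat_const; apply: leq_sum => j _.
  by rewrite leqNgt; apply/negP => wj; apply: no; exists j.
have uj : u.2 j = 0.
  have [w0|[r [rs r0 ->]]] := rw j; first by rewrite w0 in wj.
  by apply: nil => //; rewrite rs ltnW.
by rewrite /pure (bigD1 j) //= uj cd0 mul0r mulr0.
Qed.

(** Modulo the radical every basis element is a combination [b1] of even lifts
    [U] of matrix units. Expanding all the slots, the terms without a factor in
    the radical add up to zero, since their coefficients are entries of [a]. *)
Lemma deep_of_sm (a : fB -> F) : (forall p q, sm a p q = 0) -> deep_span 1 a.
Proof.
move=> a0.
have homog0 e : homog e 0 by move=> b; rewrite cd0 eqxx.
have /choice[U UE] (m : Q * Q) : exists s, homog false s /\ (col m.1 = col m.2 ->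
    forall p q, rho s p q = (p == m.1)%:R * (q == m.2)%:R).
  have [mm|mm] := eqVneq (col m.1) (col m.2); last by exists 0; split=> // e; rewrite e eqxx in mm.
  have [s sE] := rho_unit mm; exists (\sum_(t | ~~ par t) cd t s *: bC t); split=> [v|_ p q].
    rewrite cd_sumE => nz; apply/negbTE/negP => pv; case/eqP: nz; rewrite big1 // => t pt.
    by rewrite cdZ cd_bC; case: eqP => [vt|]; rewrite ?mulr0 // -vt pv in pt *.
  rewrite -sE [in RHS](cd_sum s) !rho_sumE [RHS](bigID par) /= [X in _ = X + _]big1 ?add0r // => t pt.
  by rewrite rhoZ rho_odd ?mulr0.
pose b1 t := \sum_(m : Q * Q) rho (bC t) m.1 m.2 *: U m.
pose b2 t := bC t - b1 t.
have rho_b1 t p q : rho (b1 t) p q = rho (bC t) p q.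
  rewrite rho_sumE (bigD1 (p, q)) //= big1 ?addr0 => [|m mpq].
    rewrite rhoZ; have [->|nz] := eqVneq (rho (bC t) p q) 0; first by rewrite mul0r.
    by rewrite (UE (p, q)).2 /= ?eqxx ?mulr1 //; exact: rho_col nz.
  rewrite rhoZ; have [->|nz] := eqVneq (rho (bC t) m.1 m.2) 0; first by rewrite mul0r.
  rewrite (UE m).2; last exact: rho_col nz.
  rewrite -natrM mulnb; case: andP; rewrite ?mulr0 // => -[/eqP pm /eqP qm].
  by rewrite pm qm -surjective_pairing eqxx in mpq.
have b2_rad t : radical (b2 t) by move=> p q; rewrite rhoB rho_b1 subrr.
have b1_hom t : homog (par t) (b1 t).
  case pt : (par t).
    by rewrite /b1 big1 // => m _; rewrite rho_odd // scale0r.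
  move=> v; rewrite cd_sumE => nz; apply/negbTE/negP => pv; case/eqP: nz; rewrite big1 // => m _.
  rewrite cdZ; have [->|nz] := eqVneq (cd v (U m)) 0; first by rewrite mulr0.
  by have := (UE m).1 v nz; rewrite pv.
have bC_hom t : homog (par t) (bC t).
  by move=> v; rewrite cd_bC; case: (eqVneq v t) => [->//|]; rewrite eqxx.
have b2_hom t : homog (par t) (b2 t).
  move=> v; rewrite /b2 cdD -scaleN1r cdZ; have [->|nz _] := eqVneq (cd v (b1 t)) 0.
    by rewrite mulr0 addr0; apply: bC_hom.
  exact: b1_hom nz.
pose u (A : {set 'I_d}) (b : fB) : fC := [ffun j => if j \in A then b1 (b j) else b2 (b j)].
have aE b : \sum_(A : {set 'I_d} | A != [set: 'I_d]%SET) \sum_(b' : fB) a b' * pure (u A b') b = a b.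
  have point b' : (b' == b)%:R = \sum_(A : {set 'I_d}) pure (u A b') b.
    transitivity (\prod_j (cd (b j) (b1 (b' j)) + cd (b j) (b2 (b' j)))).
      rewrite -prod_delta_fun; apply: eq_bigr => j _.
      by rewrite -cdD /b2 addrC subrK cd_bC eq_sym.
    rewrite bigA_distr; apply: eq_bigr => A _; apply: eq_bigr => j _.
    by rewrite ffunE; case: ifP.
  transitivity (\sum_(b' : fB) a b' * (b' == b)%:R); last first.
    rewrite (bigD1 b) //= eqxx mulr1 big1 ?addr0 // => b' /negPf ->; by rewrite mulr0.
  under [RHS]eq_bigr do rewrite point mulr_sumr.
  rewrite [RHS]exchange_big [RHS](bigD1 [set: 'I_d]%SET) //= [X in _ = X + _](_ : _ = 0) ?add0r //.
  transitivity (\sum_(b' : fB) \sum_(m : {ffun 'I_d -> Q * Q})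
     (a b' * \prod_j rho (bC (b' j)) (m j).1 (m j).2) * \prod_j cd (b j) (U (m j))).
    apply: eq_bigr => b' _; under [RHS]eq_bigr do rewrite -mulrA -big_split /=.
    rewrite -mulr_sumr; congr (_ * _).
    rewrite -(bigA_distr_bigA (fun j m => rho (bC (b' j)) m.1 m.2 * cd (b j) (U m))).
    apply: eq_bigr => j _; rewrite ffunE inE cd_sumE; apply: eq_bigr => m _; exact: cdZ.
  rewrite exchange_big big1 // => m _ /=; rewrite -mulr_suml.
  have := a0 [ffun j => (m j).1] [ffun j => (m j).2]; rewrite /sm => sm0.
  rewrite [X in X * _](_ : _ = 0) ?mul0r // -[RHS]sm0; apply: eq_bigr => b' _; congr (_ * _).
  by apply: eq_bigr => j _; rewrite !ffunE.
apply: (eq_deep_span aE); apply: deep_spanD => A AT; apply: deep_spanD => b' _.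
apply: deep_spanZ; apply: deep_tensor_span; split.
  by exists (fun j => par (b' j)) => j; rewrite ffunE; case: ifP.
exists (fun j => nat_of_bool (j \notin A)) => [j|].
  rewrite ffunE; case: ifP => _; [by left|right].
  by exists [:: b2 (b' j)]; rewrite big_seq1; split=> // x; rewrite inE => /eqP ->.
have [j jA] : exists j, j \notin A.
  apply: contrapT => no; case/eqP: AT; apply/setP => j; rewrite inE; apply: contrapT => jA.
  by apply: no; exists j; apply/negP.
by rewrite (bigD1 j) //= jA.
Qed.

(** By [deep_of_sm] the idempotent lies in the first step of the filtration by
    powers of the radical; being equal to its powers, it lies in every step. *)
Lemma sm_detects (y : TF) : y * y = y ->
  (forall R S p q, sm (restr (cf y) R S) p q = 0) -> y = 0.
Proof.
move=> yy sm0; apply: cf_detects => // w.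
have [M bound] := deep_span_bound.
have deep_y k : forall R S, deep_span k.+1 (restr (cf y) R S).
  elim: k => [|k IH] R S; first exact: deep_of_sm.
  rewrite -yy; apply: (eq_deep_span (f := fun b => \sum_T bstar (restr (cf y) R T) (restr (cf y) T S) b)).
    by move=> b; rewrite -star_restr /restr cfM.
  apply: deep_spanD => T _; rewrite -[k.+2]add1n; apply: deep_bstar => //; exact: deep_of_sm.
have weaken m m' a : (m' <= m)%N -> deep_span m a -> deep_span m' a.
  move=> mm [s sm_ sE]; exists s => // u /sm_ [h [w' rw lw]]; split=> //.
  by exists w' => //; apply: leq_trans lw.
have -> : w = mkw [ffun j => (w j).1.1] [ffun j => (w j).1.2] [ffun j => (w j).2].
  by apply/ffunP => j; rewrite !ffunE; case: (w j) => [[]].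
by apply: (bound (restr (cf y) _ _)); apply: weaken (deep_y M _ _).
Qed.

(** If neither [z] nor [1 - z] acted by zero, both would act by [1], and so would
    their product, which is zero. *)
Lemma central_idempotent_trivial (z : TF) : (forall x, z * x = x * z) -> z * z = z -> z = 0 \/ z = 1.
Proof.
move=> cz zz; pose z' := 1 - z.
have cz' x : z' * x = x * z' by rewrite mulrBl mulrBr mul1r mulr1 cz.
have zz' : z' * z' = z' by rewrite /z' mulrBl mul1r mulrBr mulr1 zz subrr subr0.
have z0 : z * z' = 0 by rewrite mulrBr mulr1 zz subrr.
have done_ : z' = 0 -> z = 1 by move=> /eqP; rewrite subr_eq0 => /eqP.
(* For [d = 0] there is a single word, and [cf] is multiplicative with values in
   a field. *)
have [d0|d_gt0] := posnP d.
  have jF (j : 'I_d) : False by have := ltn_ord j; rewrite {2}d0.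
  have one_word (w w' : word) : w = w' by apply/ffunP => j; case: (jF j).
  have starE x y w : cf (x * y) w = cf x w * cf y w.
    rewrite cfM /star (bigD1 w) //= [X in _ + X]big1 ?addr0 => [|u uw]; last first.
      by rewrite (one_word u w) eqxx in uw.
    rewrite (bigD1 w) //= [X in _ + X]big1 ?addr0 => [|u uw]; last first.
      by rewrite (one_word u w) eqxx in uw.
    rewrite /star_term; have -> : koszul_sign (lpar \o w) (lpar \o w) = false.
      by rewrite /koszul_sign big1 // => -[j]; case: (jF j).
    by rewrite [\prod_(j < d) _]big1 ?mulr1 ?mul1r // => j; case: (jF j).
  have w0 : word by apply: finfun => j; case: (jF j).
  have : cf z w0 * cf z' w0 = 0 by rewrite -starE z0 cf0.
  move=> /eqP; rewrite mulf_eq0 => /orP[]/eqP h; [left|right; apply: done_];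
    by apply: cf_detects => // w; rewrite (one_word w w0).
pose r0 := Ordinal d_gt0.
have [g [-> gE|g1 gE]] := central_idempotent_scalar r0 cz zz.
  by left; apply: sm_detects => // R S p q; rewrite gE mulr0.
have [g' [-> gE'|g1' gE']] := central_idempotent_scalar r0 cz' zz'.
  by right; apply: done_; apply: sm_detects => // R S p q; rewrite gE' mulr0.
have [p0 _] := two_col; pose p : fQ := [ffun _ => p0].
have := rho_product r0 p p0 p0 cz cz'; rewrite z0.
have z_diag y (gy : F) : gy = 1 ->
    (forall R' R p q, sm (restr (cf y) R' R) p q = ((R' == R) && (p == q))%:R * gy) ->
    rho (en r0 (restr (cf y) om om) p p) p0 p0 = 1.
  by move=> gy1 yE; rewrite rho_en yE gy1 !eqxx !mulr1.
rewrite rhoM (bigD1 p0) //= (z_diag z g g1 gE) (z_diag z' g' g1' gE') mul1r big1 ?addr0.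
  have -> : en r0 (restr (cf 0) om om) p p = 0.
    by rewrite /en big1 // => b _; rewrite /restr cf0 mul0r scale0r.
  by rewrite rho0 => /esym/eqP; rewrite oner_eq0.
move=> m mp; rewrite rho_en gE.
rewrite (_ : (setq p r0 p0 == setq p r0 m) = false) ?andbF ?mul0r ?mulr0 ?mul0r //.
apply/negP => /eqP/ffunP/(_ r0); rewrite !ffunE eqxx => e; by rewrite e eqxx in mp.
Qed.

End CentralIdempotents.

(** * From central idempotents to ideals *)

Lemma eq_star (R : comNzRingType) (d : nat) (L : finType) (par : L -> bool)
    (G G' : L -> L -> L -> R) (x y : {ffun 'I_d -> L} -> R) w :
  (forall a b c, G a b c = G' a b c) -> star par G x y w = star par G' x y w.
Proof.
move=> GG; apply: eq_bigr => u _; apply: eq_bigr => v _; rewrite /star_term.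
by congr (_ * (_ * _)); apply: eq_bigr => j _.
Qed.

(** A word with distinct letters has a trivial stabiliser. *)
Lemma xi_injective (R : comNzRingType) (d : nat) (L : finType) (par : L -> bool)
    (t w : {ffun 'I_d -> L}) : injective t ->
  xi par R t w = \sum_(s : 'S_d) (-1) ^+ inversion_sign s (par \o t) * (wact t s == w)%:R.
Proof.
move=> t_inj; apply: eq_bigl => s; apply/forallP => r; apply/implyP => /eqP/ffunP tr.
suff -> : r = 1%g by rewrite mulg1.
by apply/permP => j; apply: t_inj; rewrite perm1 -[RHS]tr ffunE.
Qed.

Lemma fac_injective (d : nat) (L : finType) (cl : L -> bool) (t : {ffun 'I_d -> L}) :
  injective t -> fac cl t = 1%N.
Proof.
move=> t_inj; apply: big1 => l _.
have : (#|[set j | t j == l]%SET| <= 1)%N.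
  by apply/card_le1P => j jl i; rewrite !inE in jl *; rewrite -(eqP jl) (inj_eq t_inj).
by case: #|_| => [|[]].
Qed.

(** A decomposition into two ideals splits the unit into central orthogonal
    idempotents. *)
Lemma indecomposable_of_central_idempotents (F : fieldType) (A : algType F)
    (gr : int -> bool -> set A) :
  (forall z : A, (forall x, z * x = x * z) -> z * z = z -> z = 0 \/ z = 1) ->
  indecomposable gr.
Proof.
move=> trivial [J1 [J2 [[[[sub1 id1] _] [[sub2 id2] _]]]]].
move=> [[x1 J1x1 nz1] [x2 J2x2 nz2]] cap sum.
have [z1 [z2 [J1z J2z one]]] := sum 1.
have [_ lin1] := sub1; have [_ lin2] := sub2.
have z1z2 : z1 * z2 = 0.
  by apply: cap; [case: (id1 z2 z1 J1z)|case: (id2 z1 z2 J2z)].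
have z2z1 : z2 * z1 = 0.
  by apply: cap; [case: (id1 z2 z1 J1z)|case: (id2 z1 z2 J2z)].
have opp J : (forall (c : F) x y, J x -> J y -> J (c *: x + y)) -> forall x y : A, J x -> J y -> J (x - y).
  by move=> lin x y Jx Jy; rewrite addrC -scaleN1r; apply: lin.
case: (trivial z1) => [x||z0|z1_1].
- apply/eqP; rewrite -subr_eq0; apply/eqP; apply: cap.
    by apply: (opp _ lin1); [case: (id1 x z1 J1z)|case: (id1 x z1 J1z)].
  have -> : z1 * x - x * z1 = x * z2 - z2 * x.
    have -> : z1 = 1 - z2 by rewrite one addrK.
    by rewrite mulrBl mulrBr mul1r mulr1 opprB addrC addrA subrK.
  by apply: (opp _ lin2); [case: (id2 x z2 J2z)|case: (id2 x z2 J2z)].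
- by rewrite -[RHS]mulr1 one mulrDr z1z2 addr0.
- case/eqP: nz1; apply: cap => //; rewrite -[x1]mulr1 one z0 add0r.
  by case: (id2 x1 z2 J2z).
case/eqP: nz2; apply: cap => //; rewrite -[x2]mulr1 -z1_1.
by case: (id1 x2 z1 J1z).
Qed.

Theorem theorem7p52
  (k : idomainType) (char0 : [pchar k] =i pred0)
  (n d : nat) (n_gt0 : (0 < n)%N) (le_dn : (d <= n)%N)
  (A : algType k) (gr : int -> bool -> set A)
  (A_super : graded_superalgebra gr)
  (disp : Order.disp_t) (I : finPOrderType disp)
  (X Y : I -> {fset A}) (ei : I -> A)
  (A_her : heredity_data gr setT X Y ei)
  (aa : set A) (aa_conf : conforming gr aa X Y ei)
  (aa_unital : aa 1)
  (F : fieldType) (phi : {rmorphism k -> F})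
  (* A_F *)
  (AF : algType F) (iotaA : A -> AF)
  (AF_ext : is_algebra_base_change phi setT iotaA)
  (odd_rad : parity_part (gr_ext gr setT iotaA) true `<=` @jacobson F AF)
  (e : A) (Xb Yb : I -> {fset A})
  (e_in_aa : aa e) (e_adapted : adapted gr X Y e Xb Yb)
  (* (eAe)_F *)
  (AbF : algType F) (iotaAb : A -> AbF)
  (AbF_ext : is_algebra_base_change phi (corner e) iotaAb)
  (AbF_indec : indecomposable (gr_ext gr (corner e) iotaAb))
  (Ibar_gt1 : (1 < #|Ibar phi iotaA X Y ei e|)%N)
  (* M_n(eAe)^{(x) d} *)
  (TP : algType k) (tau : {ffun 'I_d -> 'M[A]_n} -> TP)
  (TP_tensor : is_tensor_power gr e tau)
  (* T(n, d)_F *)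
  (TF : algType F) (iotaT : TP -> TF)
  (TF_ext : is_algebra_base_change phi (T_alg gr Xb Yb tau) iotaT) :
  indecomposable (gr_ext (tensor_gr gr e tau) (T_alg gr Xb Yb tau) iotaT).
Proof.
pose L := letter X Y Xb Yb n.
pose lp : L -> bool := @lpar k A gr disp I X Y Xb Yb n.
pose lc : L -> bool := @lcl k A gr disp I X Y Xb Yb n.
pose G : L -> L -> L -> k := @Gk k A gr disp I X Y ei A_her Xb Yb n.
pose xel (t : {ffun 'I_d -> L}) : TP :=
  xi_elt gr tau [ffun j => (bprod (val (t j).1.1), (t j).1.2, (t j).2)].
have par_G a b c : G a b c != 0 -> lp c = lp a (+) lp b.
  rewrite /G /Gk mulf_eq0 negb_or => /andP[_ nz].
  by rewrite /lp /lpar (coA_deg_mul A_super nz).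
have cl_par c : lc c -> ~~ lp c by rewrite /lc /lp /lcl /lpar /odd_odd /deg /= => /andP[-> ->].
(* Two factors that are neither odd nor marked lie in [aa], and so does their
   product. *)
have cl_G a b c : lc c -> G a b c != 0 -> [|| lc a, lc b, lp a | lp b].
  move=> c_odd; rewrite /G /Gk mulf_eq0 negb_or => /andP[_ nz]; move: c_odd.
  have := coA_even_even A_super aa_conf (t := val a.1.1) (u := val b.1.1) (v := val c.1.1).
  rewrite /even_even /lc /lp /lcl /lpar /odd_odd /deg /=.
  case: (degA gr (bx (val a.1.1))).2; case: (degA gr (by_ (val a.1.1))).2;
    case: (degA gr (bx (val b.1.1))).2; case: (degA gr (by_ (val b.1.1))).2 => //= h /andP[cx cy].
  by have := h A_her isT isT nz; rewrite cx.
pose cfk_ : TP -> {ffun 'I_d -> L} -> k := cfk (Xb := Xb) (Yb := Yb) A_her TP_tensor.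
have [cf [cf_linear cf_iotaT cf_mul cf_det]] : exists cf : TF -> {ffun 'I_d -> L} -> F,
  [/\ forall c x y w, cf (c *: x + y) w = c * cf x w + cf y w,
      forall x w, T_alg gr Xb Yb tau x -> cf (iotaT x) w = phi (cfk_ x w),
      forall x y w, cf (x * y) w = star lp (fun a b c => phi (G a b c)) (cf x) (cf y) w &
      forall y, y * y = y -> (forall w, cf y w = 0) -> y = 0].
  apply: (extended_coefficients char0 par_G cl_G cl_par (cfk := cfk_) (xel := xel) _ _ _ _ _ TF_ext).
  - exact: (cfk_lin A_her TP_tensor).
  - exact: (cfk_inj e_adapted).
  - exact: (cfkM A_super A_her e_adapted TP_tensor).
  - exact: (cfk_xi A_super A_her e_adapted TP_tensor).
  - exact: (T_algP A_super A_her e_adapted TP_tensor char0).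
(* The words used here have distinct letters, so [eta] and [xi] agree. *)
have iotaT_orbit (b : {ffun 'I_d -> cidx X Y Xb Yb}) (R : {ffun 'I_d -> 'I_n}) : exists x : TF, forall w,
    cf x w = \sum_(s : 'S_d) (-1) ^+ inversion_sign s ((fun t => (deg gr (val t)).2) \o b) *
      (wact (mkw b R (om le_dn)) s == w)%:R.
  pose t : {ffun 'I_d -> L} := mkw b R (om le_dn).
  have t_inj : injective t.
    by move=> i j; rewrite !ffunE => -[_ _ ij]; apply: val_inj.
  have t_odd : no_odd_repeat lp t.
    by apply/no_odd_repeatP => i j ij /t_inj e'; rewrite e' eqxx in ij.
  exists (iotaT (eta_elt gr Xb Yb tau [ffun j => (bprod (val (t j).1.1), (t j).1.2, (t j).2)])) => w.
  rewrite cf_iotaT; last exact: (T_alg_eta A_super A_her e_adapted tau t_odd).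
  rewrite /cfk_ (cfk_eta A_super A_her e_adapted) fac_injective // mul1r xi_injective // rmorph_sum.
  apply: eq_bigr => s _; rewrite rmorphM rmorph_sign rmorph_nat; congr (_ ^+ _ * _).
  by congr (nat_of_bool _); apply: eq_inversion_sign => j; rewrite /= !ffunE.
have bC_par (t u v : cidx X Y Xb Yb) : cd A_her e_adapted AbF_ext v (bC iotaAb t * bC iotaAb u) != 0 ->
    (deg gr (val v)).2 = (deg gr (val t)).2 (+) (deg gr (val u)).2.
  by move=> /(cd_bCM_deg A_super) ->.
pose C_ext := AbF_ext.
have GF_phi (a b c : L) : phi (G a b c) = GF (bC iotaAb) (cd A_her e_adapted C_ext) a b c.
  rewrite /G /Gk /GF rmorphM rmorph_nat; congr (_ * _).
  rewrite /bC -(iotaM_corner C_ext); try exact: (bprod_cidx e_adapted).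
  by rewrite cd_iota //; apply: (corner_mul e_adapted); exact: (bprod_cidx e_adapted).
have rho_odd := @rho_odd_bC _ _ _ A_super _ _ _ _ _ A_her _ _ _ e_adapted _ _ _ _ C_ext _ _ AF_ext odd_rad.
apply: indecomposable_of_central_idempotents => z.
apply: (central_idempotent_trivial (cd_lin A_her e_adapted C_ext) (cd_sum A_her e_adapted C_ext)
  (cd_bC A_her e_adapted C_ext) bC_par (@rho_lin _ _ _ _ _ _ _ _ A_her _ _ _ e_adapted _ _ _ _ C_ext)
  (@rhoM _ _ _ _ _ _ _ _ A_her _ _ _ e_adapted _ _ _ _ C_ext)
  (@rho1 _ _ _ _ _ _ _ _ A_her _ _ _ e_adapted _ _ _ _ C_ext)
  (@rho_col _ _ _ _ _ _ _ _ A_her _ _ _ e_adapted _ _ _ _ C_ext)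
  (@rho_unit _ _ _ _ _ _ _ _ A_her _ _ _ e_adapted _ _ _ _ C_ext)
  rho_odd (rho_kernel_nilpotent A_her e_adapted C_ext)
  (@central_idempotent_rho _ _ _ A_super _ _ _ _ _ A_her _ _ _ e_adapted _ _ _ _ C_ext AbF_indec rho_odd)
  (two_colours A_her e_adapted C_ext AF_ext Ibar_gt1) cf_linear _ iotaT_orbit cf_det).
by move=> x y w; rewrite cf_mul; apply: eq_star.
Qed.
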